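(* Let $r\ge0$ be an integer, let $s=\sigma+it$ be a complex number, and let $\zeta^{(r)}(s,\alpha)=\frac{\partial^r}{\partial s^r}\zeta(s,\alpha)$. If $\sigma<1$, then $$\int_0^1\zeta^{(r)}(s,\alpha)\,d\alpha=0,$$ and for every integer $n\ne0$, $$\int_0^1\zeta^{(r)}(s,\alpha)e^{-2\pi i n\alpha}\,d\alpha=(2\pi i n)^{s-1}\sum_{\ell=0}^{r}(-1)^{r-\ell}\binom r\ell\Gamma^{(r-\ell)}(1-s)\,\log^{\ell}(2\pi i n).$$ If $\sigma<\frac12$, then Parseval's equation holds: $$\int_0^1\left|\zeta^{(r)}(s,\alpha)\right|^2d\alpha=e^{-\pi t}\sum_{n\ge1}(2\pi n)^{2\sigma-2}\left|\sum_{\ell=0}^{r}(-1)^{r-\ell}\binom r\ell\Gamma^{(r-\ell)}(1-s)\left(\log 2\pi n+\frac{\pi i}{2}\right)^{\ell}\right|^2$$ $$\qquad+\,e^{\pi t}\sum_{n\ge1}(2\pi n)^{2\sigma-2}\left|\sum_{\ell=0}^{r}(-1)^{r-\ell}\binom r\ell\Gamma^{(r-\ell)}(1-s)\left(\log 2\pi n-\frac{\pi i}{2}\right)^{\ell}\right|^2.$$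
   Context: The Hurwitz zeta function $\zeta(s,\alpha)$ is defined by $\zeta(s,\alpha)=\sum_{n\ge 0}(n+\alpha)^{-s}$ for $\operatorname{Re}s>1$ and by analytic continuation in $s$. $\Gamma^{(k)}$ is the $k$-th derivative of the gamma function, and $\log^\ell x=(\log x)^\ell$. Logarithms and complex powers take their principal values. *)

(* Defs.v *)
From Stdlib Require Import Reals ClassicalEpsilon.
From Coquelicot Require Import Coquelicot.

Open Scope R_scope.

Definition Cexp (z : C) : C :=
  (exp (Re z) * cos (Im z), exp (Re z) * sin (Im z)).

(* Principal argument, with values in (-PI, PI] for z <> 0. *)
Definition Carg (z : C) : R :=
  if Rle_dec 0 (Im z) then acos (Re z / Cmod z) else - acos (Re z / Cmod z).

Definition Clog (z : C) : C := (ln (Cmod z), Carg z).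

(* Principal value of z^w for z <> 0; natural powers are Coquelicot's Cpow. *)
Definition Cpower (z w : C) : C := Cexp (w * Clog z)%C.

Definition C_derive_n (k : nat) (f : C -> C) : C -> C := Nat.iter k C_derive f.

(* Euler's integral. It defines Gamma for 0 < Re z only, which suffices for
   the values and derivatives at 1 - s with Re s < 1. *)
Definition Gamma (z : C) : C :=
  RInt_gen (V := C_R_CompleteNormedModule)
    (fun x : R => (Cpower (RtoC x) (z - 1) * RtoC (exp (- x)))%C)
    (at_right 0) (Rbar_locally p_infty).

Definition analytic_at (f : C -> C) (z0 : C) : Prop :=
  exists a : nat -> C,
    locally (T := C_UniformSpace) z0 (fun z : C =>
      is_pseries (K := C_AbsRing) (V := C_NormedModule) a (z - z0)%C (f z)).

(* f is the continuation of sum_(n >= 0) (n + alpha)^(-s) to C \ {1}, unique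
   there since C \ {1} is connected; its value at 1 is left free. *)
Definition is_hurwitz_continuation (alpha : R) (f : C -> C) : Prop :=
  (forall s : C, 1 < Re s ->
     is_series (K := C_AbsRing) (V := C_NormedModule)
       (fun n : nat => Cpower (RtoC (INR n + alpha)) (- s)%C) (f s))
  /\ (forall s : C, s <> RtoC 1 -> analytic_at f s).

(* Meaningful for 0 < alpha and s <> 1. *)
Definition hurwitz_zeta (s : C) (alpha : R) : C :=
  epsilon (inhabits (fun _ : C => RtoC 0)) (is_hurwitz_continuation alpha) s.

Definition hurwitz_zeta_derive (r : nat) (s : C) (alpha : R) : C :=
  C_derive_n r (fun w : C => hurwitz_zeta w alpha) s.

(* The integral over (0,1], improper at the left endpoint, where the
   integrands are in general unbounded. *)
Definition is_integral01 {V : NormedModule R_AbsRing} (f : R -> V) (v : V) : Prop :=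
  is_RInt_gen f (at_right 0) (at_point 1) v.

(* sum_n _ r has the r + 1 terms l = 0, ..., r; Binomial.C is the binomial
   coefficient, not the complex numbers. With L = log z, z^(s-1) times this sum
   is the r-th derivative in s of z^(s-1) Gamma(1-s). *)
Definition gamma_log_sum (r : nat) (s L : C) : C :=
  sum_n (G := C_AbelianMonoid)
    (fun l : nat =>
       (RtoC ((-1) ^ (r - l) * Binomial.C r l)
        * C_derive_n (r - l) Gamma (1 - s) * L ^ l)%C) r.

Definition two_pi_i (n : Z) : C := (RtoC (2 * PI * IZR n) * Ci)%C.

(* Main.v *)
(* Write zeta(s,a) = 1/(s-1) + Y(s,a). The first-order Euler-Maclaurin identity
     Y(s,a) = 1/2 - int_1^a x^(-s) dx + s int_0^1 (1-u) Y(s+1,a+u) du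
   continues Y to all s from Re s > 1, and transports from s+1 to s the Taylor
   expansion in s (locally uniformly in a > 0), dY/da = - 1 - s Y(s+1,a) and
   Y(s,a+1) = Y(s,a) - a^(-s). By the identity theorem along a ray avoiding 1,
   this is the continuation chosen by hurwitz_zeta.

   For Re s < 1 the n-th Fourier coefficient is int_0^1 a^(-s) e(-na) da + Q(s)
   with Q(s) = int_1^2 Y(s,a) e(-na) da, and 2 pi i n Q(s) = 1 - s Q(s+1) by
   parts. The tail integrals int_1^oo x^(-s) e^(-zx) dx obey the same recursion in
   the limit z -> 2 pi i n, Re z > 0, and the limit is Q(s) when Re s > 2; hence
   it is Q(s) for all s. So the coefficient is the limit of the Laplace integral
   int_0^oo x^(-s) e^(-zx) dx = Gamma(1-s) z^(s-1). The r-th derivative in s is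
   obtained by comparing Taylor coefficients, since the Taylor coefficients of
   zeta at s are dominated by a multiple of a^(-beta), beta < 1.

   For beta < 1/2 the derivative is square integrable. After damping at both
   ends it is approximated uniformly by its convolutions with the kernels
   cos(pi x)^(2m), which are trigonometric polynomials, and Parseval follows from
   the best approximation property of the partial Fourier sums. *)

Require Import Defs.
From Stdlib Require Import Reals Lra Lia Psatz Factorial FunctionalExtensionality Arith ZArith ClassicalEpsilon.
From Coquelicot Require Import Coquelicot.
Open Scope R_scope.

(** * Complex-valued functions of a real variable *)

(** The pole is subtracted because a recursion for zeta itself would call its value at s + 1 = 1
    when s = 0. [Y] is entire in s, so the descent by unit steps meets no exceptional point and
    every Taylor expansion of [Y] can be used on a disc of radius 1. The blow-up at a = 0 is
    confined to the explicit power a^(-s); the rest is needed only for a in [1, 2], where crude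
    bounds suffice. On the imaginary axis the Laplace integral over [1, oo) converges only
    conditionally for 0 < Re s <= 1 and diverges for Re s <= 0. Hence its value is reached as a
    limit, carried down by a recursion, and not as an integral. All integrals are improper Riemann
    integrals. Dominated convergence is replaced by a Weierstrass test with majorants M(x) that have
    elementary antiderivatives. Contours are avoided too: Cauchy estimates become (rho |log x|)^k /
    k! <= e^(rho |log x|), and the rotation of the Laplace integral becomes a vanishing derivative
    along a segment. Derivatives in s are always read off as k! times a Taylor coefficient. *)

Lemma C_eq (z w : C) : Re z = Re w -> Im z = Im w -> z = w.
Proof. destruct z, w; simpl; intros -> ->; reflexivity. Qed.

(** Componentwise, like [Cder] below, so that real calculus and [auto_derive] apply to each part;
    [Ccont_continuous] returns to the product topology, which the integration theorems ask for. *)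
Definition Ccont (f : R -> C) (x : R) : Prop :=
  continuous (fun t => Re (f t)) x /\ continuous (fun t => Im (f t)) x.

Definition Cder (f : R -> C) (x : R) (l : C) : Prop :=
  is_derive (fun t => Re (f t)) x (Re l) /\ is_derive (fun t => Im (f t)) x (Im l).

Lemma Ccont_continuous (f : R -> C) (x : R) :
  Ccont f x -> continuous (T := R_UniformSpace) (U := C_R_CompleteNormedModule) f x.
Proof.
  intros [H1 H2] P [e He].
  assert (A : locally x (fun t => ball (Re (f x)) e (Re (f t)))).
  { apply H1. exists e; auto. }
  assert (B : locally x (fun t => ball (Im (f x)) e (Im (f t)))).
  { apply H2. exists e; auto. }
  unfold filtermap. generalize (filter_and _ _ A B). apply filter_imp.
  intros t [a b]. apply He. split; assumption.
Qed.

Lemma Ccont_ext_loc (f g : R -> C) (x : R) :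
  locally x (fun t => f t = g t) -> Ccont f x -> Ccont g x.
Proof.
  intros H [A B]; split.
  - apply continuous_ext_loc with (fun t => Re (f t)); auto.
    revert H; apply filter_imp; intros t ->; auto.
  - apply continuous_ext_loc with (fun t => Im (f t)); auto.
    revert H; apply filter_imp; intros t ->; auto.
Qed.

Lemma Ccont_ext (f g : R -> C) (x : R) :
  (forall t, f t = g t) -> Ccont f x -> Ccont g x.
Proof. intros H; apply Ccont_ext_loc. apply filter_forall; auto. Qed.

Lemma Ccont_const (c : C) (x : R) : Ccont (fun _ => c) x.
Proof. split; apply continuous_const. Qed.

Lemma Ccont_RtoC (f : R -> R) (x : R) : continuous f x -> Ccont (fun t => RtoC (f t)) x.
Proof. intros H; split; simpl; auto. apply continuous_const. Qed.

Lemma Ccont_plus (f g : R -> C) (x : R) :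
  Ccont f x -> Ccont g x -> Ccont (fun t => (f t + g t)%C) x.
Proof.
  intros [A B] [D E]; split; simpl.
  - apply (continuous_plus (fun t => Re (f t)) (fun t => Re (g t))); auto.
  - apply (continuous_plus (fun t => Im (f t)) (fun t => Im (g t))); auto.
Qed.

Lemma Ccont_opp (f : R -> C) (x : R) :
  Ccont f x -> Ccont (fun t => (- f t)%C) x.
Proof.
  intros [A B]; split; simpl.
  - apply (continuous_opp (fun t => Re (f t))); auto.
  - apply (continuous_opp (fun t => Im (f t))); auto.
Qed.

Lemma Ccont_minus (f g : R -> C) (x : R) :
  Ccont f x -> Ccont g x -> Ccont (fun t => (f t - g t)%C) x.
Proof. intros A B. apply Ccont_plus; auto. apply Ccont_opp; auto. Qed.

Lemma Ccont_mult (f g : R -> C) (x : R) :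
  Ccont f x -> Ccont g x -> Ccont (fun t => (f t * g t)%C) x.
Proof.
  intros [A B] [D E]; split; simpl.
  - apply (continuous_minus (fun t => Re (f t) * Re (g t)) (fun t => Im (f t) * Im (g t)));
      apply (continuous_mult (K := R_AbsRing)); auto.
  - apply (continuous_plus (fun t => Re (f t) * Im (g t)) (fun t => Im (f t) * Re (g t)));
      apply (continuous_mult (K := R_AbsRing)); auto.
Qed.

Lemma Ccont_comp (f : R -> C) (g : R -> R) (x : R) :
  continuous g x -> Ccont f (g x) -> Ccont (fun t => f (g t)) x.
Proof.
  intros Hg [A B]; split.
  - apply (continuous_comp g (fun t => Re (f t))); auto.
  - apply (continuous_comp g (fun t => Im (f t))); auto.
Qed.

Lemma continuous_of_ex_derive (f : R -> R) (x l : R) : is_derive f x l -> continuous f x.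
Proof. intros H. apply (ex_derive_continuous (K := R_AbsRing) (V := R_NormedModule)). exists l; auto. Qed.

Lemma Cder_cont (f : R -> C) (x : R) (l : C) : Cder f x l -> Ccont f x.
Proof. intros [A B]; split; eapply continuous_of_ex_derive; eauto. Qed.

Lemma Ccont_Cexp (f : R -> C) (x : R) : Ccont f x -> Ccont (fun t => Cexp (f t)) x.
Proof.
  intros [A B]; split; simpl; apply (continuous_mult (K := R_AbsRing)).
  - apply (continuous_comp (fun t => Re (f t)) exp); auto.
    eapply continuous_of_ex_derive. apply is_derive_exp.
  - apply (continuous_comp (fun t => Im (f t)) cos); auto.
    eapply continuous_of_ex_derive. apply is_derive_cos.
  - apply (continuous_comp (fun t => Re (f t)) exp); auto.
    eapply continuous_of_ex_derive. apply is_derive_exp.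
  - apply (continuous_comp (fun t => Im (f t)) sin); auto.
    eapply continuous_of_ex_derive. apply is_derive_sin.
Qed.

Lemma Ccont_pow (f : R -> C) (n : nat) (x : R) : Ccont f x -> Ccont (fun t => (f t ^ n)%C) x.
Proof.
  intros H; induction n as [|n IH]; simpl.
  - apply Ccont_const.
  - apply Ccont_mult; auto.
Qed.

Lemma norm_C_R (z : C) : norm (V := C_R_NormedModule) z = Cmod z.
Proof.
  unfold norm; simpl. unfold prod_norm, Cmod, norm; simpl. unfold abs; simpl.
  f_equal. rewrite !Rmult_1_r, <- !Rabs_mult.
  rewrite !Rabs_pos_eq; auto; apply Rle_0_sqr.
Qed.

Lemma continuous_Cmod (f : R -> C) (x : R) : Ccont f x -> continuous (fun t => Cmod (f t)) x.
Proof.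
  intros H. apply Ccont_continuous in H.
  apply (continuous_comp (V := C_R_NormedModule) f (fun z => norm z)) in H.
  - revert H. apply continuous_ext. intros t. apply norm_C_R.
  - apply (filterlim_norm (K := R_AbsRing) (V := C_R_NormedModule)).
Qed.

Lemma Cder_ext_loc (f g : R -> C) (x : R) (l : C) :
  locally x (fun t => f t = g t) -> Cder f x l -> Cder g x l.
Proof.
  intros H [A B]; split.
  - apply (is_derive_ext_loc (fun t => Re (f t))); auto.
    revert H; apply filter_imp; intros t ->; auto.
  - apply (is_derive_ext_loc (fun t => Im (f t))); auto.
    revert H; apply filter_imp; intros t ->; auto.
Qed.

Lemma Cder_ext (f g : R -> C) (x : R) (l : C) :
  (forall t, f t = g t) -> Cder f x l -> Cder g x l.
Proof. intros H; apply Cder_ext_loc. apply filter_forall; auto. Qed.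

Lemma Cder_eq (f : R -> C) (x : R) (l l' : C) : Cder f x l -> l = l' -> Cder f x l'.
Proof. intros H <-; exact H. Qed.

Lemma Cder_const (c : C) (x : R) : Cder (fun _ => c) x 0.
Proof. split; simpl; apply (is_derive_const (K := R_AbsRing) (V := R_NormedModule)). Qed.

Lemma Cder_RtoC (f : R -> R) (x l : R) : is_derive f x l -> Cder (fun t => RtoC (f t)) x (RtoC l).
Proof. intros H; split; simpl; auto. apply (is_derive_const (K := R_AbsRing) (V := R_NormedModule)). Qed.

Lemma Cder_plus (f g : R -> C) (x : R) (l m : C) :
  Cder f x l -> Cder g x m -> Cder (fun t => (f t + g t)%C) x (l + m)%C.
Proof.
  intros [A B] [D E]; split; simpl.
  - apply (is_derive_plus (fun t => Re (f t)) (fun t => Re (g t))); auto.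
  - apply (is_derive_plus (fun t => Im (f t)) (fun t => Im (g t))); auto.
Qed.

Lemma Cder_opp (f : R -> C) (x : R) (l : C) :
  Cder f x l -> Cder (fun t => (- f t)%C) x (- l)%C.
Proof.
  intros [A B]; split; simpl.
  - apply (is_derive_opp (fun t => Re (f t))); auto.
  - apply (is_derive_opp (fun t => Im (f t))); auto.
Qed.

Lemma Cder_minus (f g : R -> C) (x : R) (l m : C) :
  Cder f x l -> Cder g x m -> Cder (fun t => (f t - g t)%C) x (l - m)%C.
Proof. intros A B. apply Cder_plus; auto. apply Cder_opp; auto. Qed.

Lemma Cder_mult (f g : R -> C) (x : R) (l m : C) :
  Cder f x l -> Cder g x m -> Cder (fun t => (f t * g t)%C) x (l * g x + f x * m)%C.
Proof.
  intros [A B] [D E]; split; simpl.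
  - evar_last.
    apply (is_derive_minus (fun t => Re (f t) * Re (g t)) (fun t => Im (f t) * Im (g t)));
      apply Derive.is_derive_mult; eauto.
    unfold minus, plus, opp; simpl; unfold Re, Im; simpl; match goal with |- @eq _ ?a ?b => change (@eq R a b) end; ring.
  - evar_last.
    apply (is_derive_plus (fun t => Re (f t) * Im (g t)) (fun t => Im (f t) * Re (g t)));
      apply Derive.is_derive_mult; eauto.
    unfold minus, plus, opp; simpl; unfold Re, Im; simpl; match goal with |- @eq _ ?a ?b => change (@eq R a b) end; ring.
Qed.

Lemma Cder_scal (c : C) (f : R -> C) (x : R) (l : C) :
  Cder f x l -> Cder (fun t => (c * f t)%C) x (c * l)%C.
Proof.
  intros H. eapply Cder_eq.
  apply (Cder_mult (fun _ => c) f); [apply Cder_const | exact H]. ring.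
Qed.

Lemma Cder_comp (f : R -> C) (g : R -> R) (x : R) (l : C) (m : R) :
  Cder f (g x) l -> is_derive g x m -> Cder (fun t => f (g t)) x (RtoC m * l)%C.
Proof.
  intros [A B] D; split.
  - evar_last. apply (is_derive_comp (fun t => Re (f t))); eauto.
    unfold scal, Re; simpl; unfold mult; simpl; ring.
  - evar_last. apply (is_derive_comp (fun t => Im (f t))); eauto.
    unfold scal, Im; simpl; unfold mult; simpl; ring.
Qed.

Lemma Cder_Cexp (f : R -> C) (x : R) (l : C) :
  Cder f x l -> Cder (fun t => Cexp (f t)) x (l * Cexp (f x))%C.
Proof.
  intros [A B]; split; simpl.
  - evar_last.
    apply Derive.is_derive_mult.
    apply (is_derive_comp exp (fun t => Re (f t))); eauto. apply is_derive_exp.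
    apply (is_derive_comp cos (fun t => Im (f t))); eauto. apply is_derive_cos.
    unfold scal; simpl; unfold mult; simpl. unfold Re, Im.
    match goal with |- @eq _ ?a ?b => change (@eq R a b) end; ring.
  - evar_last.
    apply Derive.is_derive_mult.
    apply (is_derive_comp exp (fun t => Re (f t))); eauto. apply is_derive_exp.
    apply (is_derive_comp sin (fun t => Im (f t))); eauto. apply is_derive_sin.
    unfold scal; simpl; unfold mult; simpl. unfold Re, Im.
    match goal with |- @eq _ ?a ?b => change (@eq R a b) end; ring.
Qed.

Lemma Cder_id (x : R) : Cder (fun t => RtoC t) x 1.
Proof. apply Cder_RtoC. apply (is_derive_id (K := R_AbsRing)). Qed.

(** * The complex exponential and powers of positive reals *)

Lemma Cexp_0 : Cexp 0 = 1%C.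
Proof. unfold Cexp; simpl. rewrite exp_0, cos_0, sin_0. apply C_eq; simpl; ring. Qed.

Lemma Cexp_plus (z w : C) : Cexp (z + w) = (Cexp z * Cexp w)%C.
Proof.
  apply C_eq; simpl; unfold Re, Im; simpl; rewrite exp_plus, ?cos_plus, ?sin_plus; ring.
Qed.

Lemma Cmod_Cexp (z : C) : Cmod (Cexp z) = exp (Re z).
Proof.
  unfold Cmod, Cexp; simpl.
  replace (_ + _) with (exp (Re z) * exp (Re z) * (Rsqr (sin (Im z)) + Rsqr (cos (Im z))))
    by (unfold Rsqr; ring).
  rewrite sin2_cos2, Rmult_1_r. apply sqrt_square. left; apply exp_pos.
Qed.

Lemma Cexp_RtoC (x : R) : Cexp (RtoC x) = RtoC (exp x).
Proof. apply C_eq; simpl; rewrite ?cos_0, ?sin_0; ring. Qed.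

(** The principal power of a positive base, free of the case distinction in [Carg] and hence
    differentiable by inspection; [Cpower_cpw] ties it to [Cpower]. *)
Definition cpw (x : R) (w : C) : C := Cexp (w * RtoC (ln x)).

Lemma cpw_plus (x : R) (v w : C) : cpw x (v + w) = (cpw x v * cpw x w)%C.
Proof. unfold cpw. rewrite <- Cexp_plus. f_equal. ring. Qed.

Lemma cpw_1 (x : R) : 0 < x -> cpw x 1 = RtoC x.
Proof.
  intros H; unfold cpw. rewrite Cmult_1_l, Cexp_RtoC, exp_ln; auto.
Qed.

Lemma cpw_one (w : C) : cpw 1 w = 1%C.
Proof. unfold cpw. rewrite ln_1, Cmult_0_r. apply Cexp_0. Qed.

Lemma cpw_S (x : R) (w : C) : 0 < x -> cpw x (w + 1) = (RtoC x * cpw x w)%C.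
Proof. intros H. rewrite cpw_plus, cpw_1; auto. ring. Qed.

Lemma Cmod_cpw (x : R) (w : C) : 0 < x -> Cmod (cpw x w) = Rpower x (Re w).
Proof.
  intros H. unfold cpw. rewrite Cmod_Cexp. unfold Rpower. f_equal. unfold Re; simpl. ring.
Qed.

Lemma Cpower_cpw (x : R) (w : C) : 0 < x -> Cpower (RtoC x) w = cpw x w.
Proof.
  intros H. unfold Cpower, cpw. f_equal. f_equal.
  unfold Clog. rewrite Cmod_R, Rabs_pos_eq by lra.
  unfold Carg. simpl. destruct (Rle_dec 0 0) as [_|n]; [|exfalso; apply n; lra].
  rewrite Cmod_R, Rabs_pos_eq by lra. replace (x / x) with 1 by (field; lra).
  rewrite acos_1. reflexivity.
Qed.

Lemma Cder_cpw (w : C) (x : R) : 0 < x ->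
  Cder (fun t => cpw t w) x (w * cpw x (w - 1))%C.
Proof.
  intros H. eapply Cder_eq.
  - apply (Cder_Cexp (fun t => (w * RtoC (ln t))%C)).
    apply Cder_scal. apply Cder_RtoC. apply is_derive_ln; auto.
  - fold (cpw x w).
    replace (cpw x w) with (RtoC x * cpw x (w - 1))%C.
    + rewrite RtoC_inv by lra. field. intros E; apply RtoC_inj in E; lra.
    + rewrite <- cpw_S; auto. f_equal; ring.
Qed.

Lemma Ccont_cpw (w : C) (x : R) : 0 < x -> Ccont (fun t => cpw t w) x.
Proof. intros H; eapply Cder_cont. apply Cder_cpw; auto. Qed.

Lemma Cder_one_sub (u : R) : Cder (fun t => RtoC (1 - t)) u (- (1))%C.
Proof.
  rewrite <- RtoC_opp. apply (Cder_RtoC (fun t => 1 - t)). auto_derive; auto; ring.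
Qed.

Lemma Ccont_one_sub (u : R) : Ccont (fun t => RtoC (1 - t)) u.
Proof. eapply Cder_cont, Cder_one_sub. Qed.

Lemma locally_half (x : R) : 0 < x -> locally x (fun y => x / 2 < y).
Proof.
  intros Hx. assert (Hx2 : 0 < x / 2) by lra. exists (mkposreal _ Hx2). intros y Hy.
  change (Rabs (y - x) < x / 2) in Hy. apply Rabs_def2 in Hy. lra.
Qed.

Lemma locally_pos (x : R) : 0 < x -> locally x (fun y => 0 < y).
Proof. intros Hx. generalize (locally_half x Hx). apply filter_imp. intros; lra. Qed.

Lemma Cminus_neq_0 (z w : C) : z <> w -> (z - w)%C <> 0.
Proof. intros H E. apply H. replace z with (z - w + w)%C by ring. rewrite E. ring. Qed.

Lemma Cmod_minus_pos (z w : C) : z <> w -> 0 < Cmod (z - w).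
Proof. intros H. apply Cmod_gt_0, Cminus_neq_0; auto. Qed.

Lemma Cminus_sym_neq_0 (z w : C) : (z - w)%C <> 0 -> (w - z)%C <> 0.
Proof. intros H E. apply H. replace (z - w)%C with (- (w - z))%C by ring. rewrite E. ring. Qed.

(** * Complex series *)

(** Componentwise again; [cser_is_series] identifies it with convergence in the complex normed
    module, the form used in the definition of the continuation. *)
Definition cser (a : nat -> C) (l : C) : Prop :=
  is_series (fun n => Re (a n)) (Re l) /\ is_series (fun n => Im (a n)) (Im l).

(** Indexed by the number of terms, so that the empty sum exists and the tail in [cser_tail] needs
    no predecessor. *)
Fixpoint csum (a : nat -> C) (n : nat) : C :=
  match n with O => RtoC 0 | S k => (csum a k + a k)%C end.

Lemma csum_ext (a b : nat -> C) (n : nat) :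
  (forall k, (k < n)%nat -> a k = b k) -> csum a n = csum b n.
Proof.
  induction n as [|n IH]; intros H; simpl; auto.
  rewrite IH, H; auto.
Qed.

Lemma csum_scal (c : C) (a : nat -> C) (n : nat) :
  csum (fun k => (c * a k)%C) n = (c * csum a n)%C.
Proof. induction n as [|n IH]; simpl; [ring | rewrite IH; ring]. Qed.

Lemma csum_zero (a : nat -> C) (n : nat) :
  (forall k, (k < n)%nat -> a k = RtoC 0) -> csum a n = RtoC 0.
Proof.
  induction n as [|n IH]; intros H; simpl; auto.
  rewrite IH, H; auto. ring.
Qed.

Lemma csum_sum_n (a : nat -> C) (n : nat) : sum_n (G := C_AbelianMonoid) a n = csum a (S n).
Proof.
  induction n as [|n IH].
  - rewrite sum_O. simpl. ring.
  - rewrite sum_Sn, IH. reflexivity.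
Qed.

Lemma Re_csum (a : nat -> C) (n : nat) : Re (csum a (S n)) = sum_n (fun k => Re (a k)) n.
Proof.
  induction n as [|n IH].
  - rewrite sum_O. unfold Re, Im; simpl. ring.
  - rewrite sum_Sn, <- IH. reflexivity.
Qed.

Lemma Im_csum (a : nat -> C) (n : nat) : Im (csum a (S n)) = sum_n (fun k => Im (a k)) n.
Proof.
  induction n as [|n IH].
  - rewrite sum_O. unfold Re, Im; simpl. ring.
  - rewrite sum_Sn, <- IH. reflexivity.
Qed.

Lemma cser_ext (a b : nat -> C) (l : C) : (forall n, a n = b n) -> cser a l -> cser b l.
Proof.
  intros H [A B]; split.
  - apply (is_series_ext (fun n => Re (a n))); auto. intros n; rewrite H; auto.
  - apply (is_series_ext (fun n => Im (a n))); auto. intros n; rewrite H; auto.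
Qed.

Lemma cser_eq (a : nat -> C) (l l' : C) : cser a l -> l = l' -> cser a l'.
Proof. intros H <-; exact H. Qed.

Lemma cser_unique (a : nat -> C) (l l' : C) : cser a l -> cser a l' -> l = l'.
Proof.
  intros [A B] [A' B']; apply C_eq.
  - rewrite <- (is_series_unique _ _ A); apply (is_series_unique _ _ A').
  - rewrite <- (is_series_unique _ _ B); apply (is_series_unique _ _ B').
Qed.

Lemma cser_plus (a b : nat -> C) (l m : C) :
  cser a l -> cser b m -> cser (fun n => (a n + b n)%C) (l + m)%C.
Proof.
  intros [A B] [A' B']; split; simpl.
  - apply (is_series_plus (fun n => Re (a n)) (fun n => Re (b n))); auto.
  - apply (is_series_plus (fun n => Im (a n)) (fun n => Im (b n))); auto.
Qed.

Lemma cser_scal (c : C) (a : nat -> C) (l : C) :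
  cser a l -> cser (fun n => (c * a n)%C) (c * l)%C.
Proof.
  intros [A B]; split; simpl.
  - apply (is_series_minus (fun n => Re c * Re (a n)) (fun n => Im c * Im (a n)));
      apply (is_series_scal (K := R_AbsRing) (V := R_NormedModule)); auto.
  - apply (is_series_plus (fun n => Re c * Im (a n)) (fun n => Im c * Re (a n)));
      apply (is_series_scal (K := R_AbsRing) (V := R_NormedModule)); auto.
Qed.

Lemma cser_minus (a b : nat -> C) (l m : C) :
  cser a l -> cser b m -> cser (fun n => (a n - b n)%C) (l - m)%C.
Proof.
  intros A B. apply (cser_eq _ (l + (- (1)) * m)%C); [|ring].
  apply (cser_ext (fun n => (a n + (- (1)) * b n)%C)); [intros; ring|].
  apply cser_plus; auto. apply cser_scal; auto.
Qed.

Lemma cser_incr (a : nat -> C) (l : C) :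
  cser (fun n => a (S n)) l -> cser a (a 0%nat + l)%C.
Proof.
  intros [A B]; split; simpl.
  - apply is_series_decr_1.
    match goal with |- is_series _ ?x => replace x with (Re l); auto end.
    unfold plus, opp, Re; simpl; ring.
  - apply is_series_decr_1.
    match goal with |- is_series _ ?x => replace x with (Im l); auto end.
    unfold plus, opp, Im; simpl; ring.
Qed.

Lemma cser_decr (a : nat -> C) (l : C) :
  cser a l -> cser (fun n => a (S n)) (l - a 0%nat)%C.
Proof.
  intros [A B]; split; simpl.
  - apply (is_series_incr_1 (fun n => Re (a n))).
    match goal with |- is_series _ ?x => replace x with (Re l); auto end.
    unfold plus, opp, Re; simpl; ring.
  - apply (is_series_incr_1 (fun n => Im (a n))).
    match goal with |- is_series _ ?x => replace x with (Im l); auto end.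
    unfold plus, opp, Im; simpl; ring.
Qed.

Lemma cser_tail (a : nat -> C) (l : C) (N : nat) :
  cser a l -> cser (fun n => a (N + n)%nat) (l - csum a N)%C.
Proof.
  intros H; induction N as [|N IH]; simpl.
  - apply (cser_eq _ l); auto. ring.
  - apply cser_decr in IH. rewrite Nat.add_0_r in IH.
    apply (cser_eq _ (l - csum a N - a N)%C); [|ring].
    revert IH. apply cser_ext. intros n; f_equal. lia.
Qed.

Lemma cser_bound (a : nat -> C) (l : C) (b : nat -> R) (m : R) :
  cser a l -> (forall n, Cmod (a n) <= b n) -> is_series b m -> Cmod l <= m.
Proof.
  intros H Hb Hm.
  destruct (Req_dec (Cmod l) 0) as [E|E].
  - rewrite E.
    apply (is_series_unique) in Hm as Hm'. rewrite <- Hm'.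
    apply Rle_trans with (Series (fun n => 0 * b n)).
    + rewrite Series_scal_l. lra.
    + apply Series_le. intros n; rewrite Rmult_0_l; split; [lra|]. eapply Rle_trans; [apply Cmod_ge_0 | apply Hb].
      exists m; auto.
  - (* rotate so that the sum becomes real *)
    assert (P : 0 < Cmod l) by (generalize (Cmod_ge_0 l); lra).
    set (u := (Cconj l / RtoC (Cmod l))%C).
    assert (Hl0 : RtoC (Cmod l) <> 0) by (intros E'; apply RtoC_inj in E'; lra).
    assert (Hu : Cmod u = 1).
    { unfold u. rewrite Cmod_div; auto. rewrite Cmod_conj, Cmod_R, Rabs_pos_eq by lra. field; lra. }
    assert (Hul : (u * l)%C = RtoC (Cmod l)).
    { unfold u. assert (K := Cmod2_conj l). rewrite RtoC_pow in K.
      unfold Cdiv. rewrite <- (Cmult_assoc (Cconj l)), (Cmult_comm (/ _)), Cmult_assoc, (Cmult_comm (Cconj l)), <- K.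
      simpl. rewrite Cmult_1_r, <- Cmult_assoc, Cinv_r, Cmult_1_r; auto. }
    destruct (cser_scal u a l H) as [A _]. rewrite Hul in A. change (Re (RtoC (Cmod l))) with (Cmod l) in A. clearbody u.
    rewrite <- (is_series_unique _ _ A), <- (is_series_unique _ _ Hm).
    apply Rle_trans with (Series (fun n => Rabs (Re (u * a n)%C))).
    + eapply Rle_trans; [apply Rle_abs|]. apply Series_Rabs.
      apply (ex_series_le (V := R_CompleteNormedModule) _ b); [|exists m; auto].
      intros n. change (Rabs (Rabs (Re (u * a n)%C)) <= b n). rewrite Rabs_Rabsolu.
      eapply Rle_trans; [apply re_le_Cmod|]. rewrite Cmod_mult, Hu, Rmult_1_l; auto.
    + apply Series_le; [|exists m; auto].
      intros n; split; [apply Rabs_pos|].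
      eapply Rle_trans; [apply re_le_Cmod|]. rewrite Cmod_mult, Hu, Rmult_1_l; auto.
Qed.

Lemma im_le_Cmod (z : C) : Rabs (Im z) <= Cmod z.
Proof. eapply Rle_trans; [apply Rmax_r|apply Rmax_Cmod]. Qed.

Lemma Cmod_le_sum (z : C) : Cmod z <= Rabs (Re z) + Rabs (Im z).
Proof.
  replace z with (RtoC (Re z) + RtoC (Im z) * Ci)%C at 1.
  - eapply Rle_trans; [apply Cmod_triangle|]. rewrite Cmod_mult, Cmod_Ci, !Cmod_R. lra.
  - apply C_eq; simpl; ring.
Qed.

Lemma cser_ex (a : nat -> C) (b : nat -> R) :
  (forall n, Cmod (a n) <= b n) -> ex_series b -> exists l, cser a l.
Proof.
  intros H Hb.
  destruct (ex_series_le (V := R_CompleteNormedModule) (fun n => Re (a n)) b) as [x Hx]; auto.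
  { intros n. eapply Rle_trans; [apply re_le_Cmod | apply H]. }
  destruct (ex_series_le (V := R_CompleteNormedModule) (fun n => Im (a n)) b) as [y Hy]; auto.
  { intros n. eapply Rle_trans; [apply im_le_Cmod | apply H]. }
  exists (x, y). split; auto.
Qed.

Lemma cser_of_csum (a : nat -> C) (l : C) (e : nat -> R) :
  (forall N, Cmod (l - csum a N) <= e N) -> is_lim_seq e 0 -> cser a l.
Proof.
  intros H He.
  apply is_lim_seq_incr_1 in He.
  split.
  - change (is_lim_seq (sum_n (fun n => Re (a n))) (Re l)).
    apply is_lim_seq_ext with (fun n => Re l - Re (l - csum a (S n))%C).
    { intros n. rewrite <- Re_csum. unfold Re; simpl; ring. }
    replace (Finite (Re l)) with (Rbar_minus (Re l) 0) by (simpl; f_equal; ring).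
    apply is_lim_seq_minus'; [apply is_lim_seq_const|].
    apply is_lim_seq_abs_0.
    apply (is_lim_seq_le_le (fun _ => 0) _ (fun n => e (S n))); auto.
    + intros n; split; [apply Rabs_pos|]. eapply Rle_trans; [apply re_le_Cmod|apply H].
    + apply is_lim_seq_const.
  - change (is_lim_seq (sum_n (fun n => Im (a n))) (Im l)).
    apply is_lim_seq_ext with (fun n => Im l - Im (l - csum a (S n))%C).
    { intros n. rewrite <- Im_csum. unfold Im; simpl; ring. }
    replace (Finite (Im l)) with (Rbar_minus (Im l) 0) by (simpl; f_equal; ring).
    apply is_lim_seq_minus'; [apply is_lim_seq_const|].
    apply is_lim_seq_abs_0.
    apply (is_lim_seq_le_le (fun _ => 0) _ (fun n => e (S n))); auto.
    + intros n; split; [apply Rabs_pos|]. eapply Rle_trans; [apply im_le_Cmod|apply H].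
    + apply is_lim_seq_const.
Qed.

Lemma cser_is_series (a : nat -> C) (l : C) :
  cser a l <-> is_series (K := C_AbsRing) (V := C_NormedModule) a l.
Proof.
  split.
  - intros [A B] P [e He].
    assert (A' : eventually (fun n => ball (Re l) e (sum_n (fun k => Re (a k)) n))).
    { apply A. exists e; auto. }
    assert (B' : eventually (fun n => ball (Im l) e (sum_n (fun k => Im (a k)) n))).
    { apply B. exists e; auto. }
    unfold filtermap. generalize (filter_and _ _ A' B'). apply filter_imp.
    intros n [x y]. apply He.
    change (sum_n (G := C_AbelianMonoid) a n) with (sum_n (G := C_AbelianMonoid) a n).
    rewrite <- Re_csum in x. rewrite <- Im_csum in y.
    rewrite <- csum_sum_n in x, y. split; assumption.
  - intros H.
    assert (H2 : forall e : posreal, eventually (fun n =>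
       ball (M := C_UniformSpace) l e (sum_n (G := C_AbelianMonoid) a n))).
    { intros e. apply H. exists e; auto. }
    split; intros P [e He]; unfold filtermap; generalize (H2 e); apply filter_imp;
      intros n [x y]; apply He.
    + rewrite <- Re_csum, <- csum_sum_n. exact x.
    + rewrite <- Im_csum, <- csum_sum_n. exact y.
Qed.

Lemma sum_f_R0_Re_csum (a b : nat -> C) (n : nat) :
  csum (fun k => (a k * b (n - k)%nat)%C) (S n) =
  (sum_f_R0 (fun k => Re (a k) * Re (b (n - k)%nat)) n
   - sum_f_R0 (fun k => Im (a k) * Im (b (n - k)%nat)) n,
   sum_f_R0 (fun k => Re (a k) * Im (b (n - k)%nat)) n
   + sum_f_R0 (fun k => Im (a k) * Re (b (n - k)%nat)) n).
Proof.
  apply C_eq.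
  - rewrite Re_csum, sum_n_Reals. simpl. rewrite <- minus_sum. reflexivity.
  - rewrite Im_csum, sum_n_Reals. simpl. rewrite <- plus_sum. reflexivity.
Qed.

(** Cauchy product: real and imaginary parts reduce to four real Cauchy products, each absolutely
    convergent because components are bounded by moduli. *)
Lemma cser_mult (a b : nat -> C) (la lb : C) :
  cser a la -> cser b lb ->
  ex_series (fun n => Cmod (a n)) -> ex_series (fun n => Cmod (b n)) ->
  cser (fun n => csum (fun k => (a k * b (n - k)%nat)%C) (S n)) (la * lb)%C.
Proof.
  intros [A B] [D E] Ha Hb.
  assert (K : forall (c : nat -> C), ex_series (fun n => Cmod (c n)) ->
    ex_series (fun n => Rabs (Re (c n))) /\ ex_series (fun n => Rabs (Im (c n)))).
  { intros c Hc; split; apply (ex_series_le (V := R_CompleteNormedModule) _ (fun n => Cmod (c n))); auto;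
      intros n; unfold norm; simpl; unfold abs; simpl; rewrite Rabs_Rabsolu.
    apply re_le_Cmod. apply im_le_Cmod. }
  destruct (K a Ha) as [a1 a2]. destruct (K b Hb) as [b1 b2].
  split.
  - apply (is_series_ext (fun n => sum_f_R0 (fun k => Re (a k) * Re (b (n - k)%nat)) n
      - sum_f_R0 (fun k => Im (a k) * Im (b (n - k)%nat)) n)).
    { intros n; rewrite sum_f_R0_Re_csum; reflexivity. }
    apply (is_series_minus (V := R_NormedModule)).
    + apply (is_series_mult (fun n => Re (a n)) (fun n => Re (b n))); auto.
    + apply (is_series_mult (fun n => Im (a n)) (fun n => Im (b n))); auto.
  - apply (is_series_ext (fun n => sum_f_R0 (fun k => Re (a k) * Im (b (n - k)%nat)) n
      + sum_f_R0 (fun k => Im (a k) * Re (b (n - k)%nat)) n)).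
    { intros n; rewrite sum_f_R0_Re_csum; reflexivity. }
    apply (is_series_plus (V := R_NormedModule)).
    + apply (is_series_mult (fun n => Re (a n)) (fun n => Im (b n))); auto.
    + apply (is_series_mult (fun n => Im (a n)) (fun n => Re (b n))); auto.
Qed.

Lemma cser_zero : cser (fun _ => RtoC 0) 0.
Proof.
  apply (cser_of_csum _ _ (fun _ => 0)); [|apply is_lim_seq_const].
  intros N. rewrite csum_zero; auto. replace (0 - 0)%C with (RtoC 0) by ring. rewrite Cmod_0; lra.
Qed.

Lemma geom_series (q : R) : 0 <= q < 1 -> is_series (fun n => q ^ n) (/ (1 - q)).
Proof. intros H. apply is_series_geom. rewrite Rabs_pos_eq; lra. Qed.

Lemma cgeom (z : C) : Cmod z < 1 -> cser (fun n => (z ^ n)%C) (/ (1 - z))%C.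
Proof.
  intros H.
  assert (Hz : (1 - z)%C <> 0).
  { intros E. assert (E' : z = 1%C).
    { replace z with (1 - (1 - z))%C by ring. rewrite E. ring. }
    rewrite E', Cmod_1 in H. lra. }
  apply (cser_of_csum _ _ (fun N => Cmod z ^ N * / Cmod (1 - z))).
  - intros N. replace (/ (1 - z) - csum (fun n => z ^ n)%C N)%C with (z ^ N * / (1 - z))%C.
    + rewrite Cmod_mult, Cmod_pow, Cmod_inv; auto. lra.
    + assert (csum (fun n => z ^ n)%C N = (1 - z ^ N) * / (1 - z))%C as ->; [|field; auto].
      induction N as [|N IH]; simpl; [field; auto|]. rewrite IH. field; auto.
  - replace (Finite 0) with (Rbar_mult 0 (/ Cmod (1 - z))) by (simpl; f_equal; ring).
    apply is_lim_seq_mult'; [|apply is_lim_seq_const].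
    apply is_lim_seq_geom. rewrite Rabs_pos_eq; auto. apply Cmod_ge_0.
Qed.

(** * Improper integrals of complex-valued functions *)

Definition igen (f : R -> C) (Fa Fb : (R -> Prop) -> Prop) (l : C) : Prop :=
  is_RInt_gen (V := C_R_NormedModule) f Fa Fb l.

Definition rgen (f : R -> R) (Fa Fb : (R -> Prop) -> Prop) (l : R) : Prop :=
  is_RInt_gen (V := R_NormedModule) f Fa Fb l.

(** Lets pointwise hypotheses be demanded only on the set swept by the integration intervals,
    typically open at a singular end: near the two filters the interval is oriented and stays inside
    [D]. *)
Definition dom (Fa Fb : (R -> Prop) -> Prop) (D : R -> Prop) : Prop :=
  filter_prod Fa Fb (fun ab => fst ab <= snd ab /\ forall x, fst ab <= x <= snd ab -> D x).

Definition Clim (f : R -> C) (F : (R -> Prop) -> Prop) (l : C) : Prop :=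
  forall eps : R, 0 < eps -> F (fun x => Cmod (f x - l) < eps).

Lemma locally_Cmod (l : C) (P : C -> Prop) :
  locally (T := C_UniformSpace) l P -> exists eps : R, 0 < eps /\ forall z, Cmod (z - l) < eps -> P z.
Proof.
  intros [e He]. exists e. split; [apply cond_pos|].
  intros z Hz. apply He. apply C_NormedModule_mixin_compat1. exact Hz.
Qed.

Lemma Ccont_eps (f : R -> C) (x : R) : Clim f (locally x) (f x) -> Ccont f x.
Proof.
  intros H; split; intros P [e He]; unfold filtermap; generalize (H e (cond_pos e)); apply filter_imp;
    intros t Ht; apply He.
  - eapply Rle_lt_trans; [|exact Ht].
    apply (re_le_Cmod (f t - f x)%C).
  - eapply Rle_lt_trans; [|exact Ht].
    apply (im_le_Cmod (f t - f x)%C).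
Qed.

Lemma Ccont_Clim (f : R -> C) (x : R) : Ccont f x -> Clim f (locally x) (f x).
Proof.
  intros [A B] e He.
  assert (He2 : 0 < e / 2) by lra.
  assert (A' : locally x (fun t => ball (Re (f x)) (mkposreal _ He2) (Re (f t)))).
  { apply A. exists (mkposreal _ He2); auto. }
  assert (B' : locally x (fun t => ball (Im (f x)) (mkposreal _ He2) (Im (f t)))).
  { apply B. exists (mkposreal _ He2); auto. }
  generalize (filter_and _ _ A' B'). apply filter_imp. intros t [a b].
  eapply Rle_lt_trans; [apply Cmod_le_sum|].
  change (Rabs (Re (f t) - Re (f x)) < e / 2) in a.
  change (Rabs (Im (f t) - Im (f x)) < e / 2) in b.
  change (Rabs (Re (f t) - Re (f x)) + Rabs (Im (f t) - Im (f x)) < e). lra.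
Qed.

Lemma igen_pair (f : R -> C) (Fa Fb : (R -> Prop) -> Prop) (l : C) :
  Filter Fa -> Filter Fb ->
  rgen (fun t => Re (f t)) Fa Fb (Re l) -> rgen (fun t => Im (f t)) Fa Fb (Im l) -> igen f Fa Fb l.
Proof.
  intros FFa FFb A B P HP. destruct HP as [e He].
  assert (A' := A (ball (M := R_UniformSpace) (Re l) e)). assert (B' := B (ball (M := R_UniformSpace) (Im l) e)).
  assert (HA : locally (T := R_UniformSpace) (Re l) (ball (Re l) e)) by (exists e; auto).
  assert (HB : locally (T := R_UniformSpace) (Im l) (ball (Im l) e)) by (exists e; auto).
  specialize (A' HA). specialize (B' HB).
  unfold filtermapi in *.
  generalize (filter_and (F := filter_prod Fa Fb) _ _ A' B'). apply filter_imp.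
  intros [a b] [[u [Hu Pu]] [v [Hv Pv]]]. exists (u, v). split.
  - apply (is_RInt_fct_extend_pair (U := R_NormedModule) (V := R_NormedModule)); auto.
  - apply He. split; auto.
Qed.

Lemma igen_Re (f : R -> C) (Fa Fb : (R -> Prop) -> Prop) (l : C) :
  Filter Fa -> Filter Fb -> igen f Fa Fb l -> rgen (fun t => Re (f t)) Fa Fb (Re l).
Proof.
  intros FFa FFb A P [e He].
  assert (A' := A (ball (M := C_UniformSpace) l e)).
  assert (HA : locally (T := C_UniformSpace) l (ball l e)) by (exists e; auto).
  specialize (A' HA). unfold filtermapi in *. revert A'. apply filter_imp.
  intros [a b] [z [Hz Pz]]. exists (Re z). split.
  - apply (is_RInt_fct_extend_fst (U := R_NormedModule) (V := R_NormedModule) f); auto.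
  - apply He. apply Pz.
Qed.

Lemma igen_Im (f : R -> C) (Fa Fb : (R -> Prop) -> Prop) (l : C) :
  Filter Fa -> Filter Fb -> igen f Fa Fb l -> rgen (fun t => Im (f t)) Fa Fb (Im l).
Proof.
  intros FFa FFb A P [e He].
  assert (A' := A (ball (M := C_UniformSpace) l e)).
  assert (HA : locally (T := C_UniformSpace) l (ball l e)) by (exists e; auto).
  specialize (A' HA). unfold filtermapi in *. revert A'. apply filter_imp.
  intros [a b] [z [Hz Pz]]. exists (Im z). split.
  - apply (is_RInt_fct_extend_snd (U := R_NormedModule) (V := R_NormedModule) f); auto.
  - apply He. apply Pz.
Qed.

Section Gen.

Context (Fa Fb : (R -> Prop) -> Prop) {FFa : ProperFilter Fa} {FFb : ProperFilter Fb}.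

Lemma igen_unique (f : R -> C) (l l' : C) : igen f Fa Fb l -> igen f Fa Fb l' -> l = l'.
Proof.
  intros A B.
  rewrite <- (is_RInt_gen_unique (V := C_R_CompleteNormedModule) _ _ A).
  apply (is_RInt_gen_unique (V := C_R_CompleteNormedModule) _ _ B).
Qed.

Lemma igen_plus (f g : R -> C) (l m : C) :
  igen f Fa Fb l -> igen g Fa Fb m -> igen (fun x => (f x + g x)%C) Fa Fb (l + m)%C.
Proof. intros A B. apply (is_RInt_gen_plus (V := C_R_NormedModule)); auto. Qed.

Lemma igen_minus (f g : R -> C) (l m : C) :
  igen f Fa Fb l -> igen g Fa Fb m -> igen (fun x => (f x - g x)%C) Fa Fb (l - m)%C.
Proof. intros A B. apply (is_RInt_gen_minus (V := C_R_NormedModule)); auto. Qed.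

Lemma igen_eq (f : R -> C) (l l' : C) : igen f Fa Fb l -> l = l' -> igen f Fa Fb l'.
Proof. intros H <-; exact H. Qed.

Lemma igen_ext (D : R -> Prop) (f g : R -> C) (l : C) :
  dom Fa Fb D -> (forall x, D x -> f x = g x) -> igen f Fa Fb l -> igen g Fa Fb l.
Proof.
  intros HD H. apply (is_RInt_gen_ext (V := C_R_NormedModule)).
  revert HD. unfold dom. apply filter_imp. intros [a b] [Hab HD] x Hx. simpl in *.
  apply H, HD. rewrite Rmin_left, Rmax_right in Hx; lra.
Qed.

Lemma igen_ext_all (f g : R -> C) (l : C) :
  (forall x, f x = g x) -> igen f Fa Fb l -> igen g Fa Fb l.
Proof.
  intros H. apply (is_RInt_gen_ext (V := C_R_NormedModule)).
  apply filter_forall. intros; auto.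
Qed.

Lemma rgen_ext_all (f g : R -> R) (l : R) :
  (forall x, f x = g x) -> rgen f Fa Fb l -> rgen g Fa Fb l.
Proof.
  intros H. apply (is_RInt_gen_ext (V := R_NormedModule)).
  apply filter_forall. intros; auto.
Qed.

Lemma rgen_ext (D : R -> Prop) (f g : R -> R) (l : R) :
  dom Fa Fb D -> (forall x, D x -> f x = g x) -> rgen f Fa Fb l -> rgen g Fa Fb l.
Proof.
  intros HD H. apply (is_RInt_gen_ext (V := R_NormedModule)).
  revert HD. unfold dom. apply filter_imp. intros [a b] [Hab HD] x Hx. simpl in *.
  apply H, HD. rewrite Rmin_left, Rmax_right in Hx; lra.
Qed.

Lemma rgen_scal (c : R) (f : R -> R) (l : R) :
  rgen f Fa Fb l -> rgen (fun x => c * f x) Fa Fb (c * l).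
Proof. intros H. apply (is_RInt_gen_scal (V := R_NormedModule) f c l H). Qed.

Lemma rgen_plus (f g : R -> R) (l m : R) :
  rgen f Fa Fb l -> rgen g Fa Fb m -> rgen (fun x => f x + g x) Fa Fb (l + m).
Proof. intros A B. apply (is_RInt_gen_plus (V := R_NormedModule)); auto. Qed.

Lemma rgen_minus (f g : R -> R) (l m : R) :
  rgen f Fa Fb l -> rgen g Fa Fb m -> rgen (fun x => f x - g x) Fa Fb (l - m).
Proof. intros A B. apply (is_RInt_gen_minus (V := R_NormedModule)); auto. Qed.

Lemma igen_scal (c : C) (f : R -> C) (l : C) :
  igen f Fa Fb l -> igen (fun x => (c * f x)%C) Fa Fb (c * l)%C.
Proof.
  intros H. assert (A := igen_Re _ _ _ _ _ _ H). assert (B := igen_Im _ _ _ _ _ _ H).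
  apply igen_pair; try typeclasses eauto; simpl.
  - apply rgen_minus; apply rgen_scal; auto.
  - apply rgen_plus; apply rgen_scal; auto.
Qed.

Lemma igen_RtoC (f : R -> R) (l : R) :
  rgen f Fa Fb l -> igen (fun x => RtoC (f x)) Fa Fb (RtoC l).
Proof.
  intros H. apply igen_pair; try typeclasses eauto; simpl; auto.
  apply (rgen_ext_all (fun x => 0 * f x)); [intros; ring|].
  assert (K := rgen_scal 0 _ _ H). rewrite Rmult_0_l in K. exact K.
Qed.

Lemma igen_zero : igen (fun _ => RtoC 0) Fa Fb 0.
Proof.
  intros P HP. unfold filtermapi. apply filter_forall. intros [a b].
  exists (RtoC 0). split.
  - evar_last. apply (is_RInt_const (V := C_R_NormedModule)).
    apply C_eq; simpl; unfold scal; simpl; unfold mult; simpl; ring.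
  - apply locally_singleton; auto.
Qed.

Lemma igen_csum (f : nat -> R -> C) (l : nat -> C) (n : nat) :
  (forall k, igen (f k) Fa Fb (l k)) ->
  igen (fun x => csum (fun k => f k x) n) Fa Fb (csum l n).
Proof.
  intros H; induction n as [|n IH]; simpl.
  - apply igen_zero.
  - apply igen_plus; auto.
Qed.

Lemma igen_norm (D : R -> Prop) (f : R -> C) (M : R -> R) (l : C) (m : R) :
  dom Fa Fb D -> (forall x, D x -> Cmod (f x) <= M x) ->
  igen f Fa Fb l -> rgen M Fa Fb m -> Cmod l <= m.
Proof.
  intros HD H A B. rewrite <- norm_C_R.
  apply (RInt_gen_norm (V := C_R_CompleteNormedModule) (Fa := Fa) (Fb := Fb) f M); auto;
    revert HD; unfold dom; apply filter_imp; intros [a b] [Hab HD]; simpl in *; auto.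
  intros x Hx. apply Rle_trans with (Cmod (f x)); auto. right; apply norm_C_R.
Qed.

Lemma rgen_le (D : R -> Prop) (f g : R -> R) (l m : R) :
  dom Fa Fb D -> (forall x, D x -> f x <= g x) ->
  rgen f Fa Fb l -> rgen g Fa Fb m -> l <= m.
Proof.
  intros HD H A B.
  assert (K := rgen_minus _ _ _ _ B A).
  assert (K2 := igen_norm D (fun _ => RtoC 0) (fun x => g x - f x) 0 (m - l) HD).
  rewrite Cmod_0 in K2. assert (K3 : 0 <= m - l); [|lra].
  apply K2; auto.
  - intros x Hx. rewrite ?Cmod_0. generalize (H x Hx). lra.
  - apply igen_zero.
Qed.

(** The boundary values are limits of the antiderivative, so singular endpoints, infinity and
    ordinary points are treated alike, and convergence of the integral comes together with its
    value. *)
Lemma igen_ftc (F f : R -> C) (D : R -> Prop) (la lb : C) :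
  dom Fa Fb D -> (forall x, D x -> Cder F x (f x)) -> (forall x, D x -> Ccont f x) ->
  Clim F Fa la -> Clim F Fb lb -> igen f Fa Fb (lb - la)%C.
Proof.
  intros HD H1 H2 La Lb P HP.
  apply locally_Cmod in HP. destruct HP as [e [He HP]].
  unfold filtermapi.
  assert (E : filter_prod Fa Fb (fun ab => Cmod (F (fst ab) - la) < e / 2 /\ Cmod (F (snd ab) - lb) < e / 2)).
  { exists (fun x => Cmod (F x - la) < e / 2) (fun x => Cmod (F x - lb) < e / 2); simpl; auto.
    apply La; lra. apply Lb; lra. }
  generalize (filter_and (F := filter_prod Fa Fb) _ _ HD E). apply filter_imp.
  intros [a b] [[Hab HDab] [Ea Eb]]; simpl in *.
  exists (F b - F a)%C. split.
  - apply (is_RInt_derive (V := C_R_CompleteNormedModule) F f).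
    + intros x Hx. rewrite Rmin_left, Rmax_right in Hx by lra.
      destruct (H1 x (HDab x Hx)) as [U V].
      unfold is_derive.
      apply (filterdiff_ext_lin (K := R_AbsRing) F (fun y => (scal y (Re (f x)), scal y (Im (f x))))); [|reflexivity].
      apply (filterdiff_ext (fun t => (Re (F t), Im (F t)))); [intros y; destruct (F y); reflexivity|].
      apply (filterdiff_comp_2 (K := R_AbsRing) (U := R_NormedModule) (V := R_NormedModule) (fun t => Re (F t)) (fun t => Im (F t)) (fun a b => (a, b)) _ _ (fun a b => (a, b))); auto.
      apply filterdiff_ext with (fun t : R * R => t). intros [u v]; reflexivity.
      apply filterdiff_ext_lin with (fun t : R * R => t). apply filterdiff_id. intros [u v]; reflexivity.
    + intros x Hx. rewrite Rmin_left, Rmax_right in Hx by lra.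
      apply Ccont_continuous. auto.
  - apply HP. replace (F b - F a - (lb - la))%C with ((F b - lb) + - (F a - la))%C by ring.
    eapply Rle_lt_trans; [apply Cmod_triangle|]. rewrite Cmod_opp. lra.
Qed.

End Gen.

Lemma ex_RInt_Ccont (f : R -> C) (D : R -> Prop) (a b : R) :
  a <= b -> (forall x, a <= x <= b -> D x) -> (forall x, D x -> Ccont f x) ->
  ex_RInt (V := C_R_CompleteNormedModule) f a b.
Proof.
  intros Hab HD Hc. apply (ex_RInt_continuous (V := C_R_CompleteNormedModule)).
  intros x Hx. rewrite Rmin_left, Rmax_right in Hx by lra.
  apply Ccont_continuous; auto.
Qed.

Lemma RInt_dominated (f : R -> C) (M : R -> R) (D : R -> Prop) (a b : R) :
  a <= b -> (forall x, a <= x <= b -> D x) -> (forall x, D x -> Ccont f x) ->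
  (forall x, D x -> continuous M x) -> (forall x, D x -> Cmod (f x) <= M x) ->
  Cmod (RInt (V := C_R_CompleteNormedModule) f a b) <= RInt M a b.
Proof.
  intros Hab HD Hc HM H. rewrite <- norm_C_R.
  apply (norm_RInt_le (V := C_R_NormedModule) f M a b); auto.
  - intros x Hx. apply Rle_trans with (Cmod (f x)); auto. right; apply norm_C_R.
  - apply (RInt_correct (V := C_R_CompleteNormedModule)). eapply ex_RInt_Ccont; eauto.
  - apply (RInt_correct (V := R_CompleteNormedModule)).
    apply (ex_RInt_continuous (V := R_CompleteNormedModule)).
    intros x Hx. rewrite Rmin_left, Rmax_right in Hx by lra. auto.
Qed.

(** By additivity over adjacent intervals. With its mirror image for the right endpoint it supplies
    the Cauchy estimates of [igen_dominated]. *)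
Lemma RInt_diff_left (f : R -> C) (M : R -> R) (D : R -> Prop) (a a' b : R) :
  a <= a' <= b -> (forall x, a <= x <= b -> D x) -> (forall x, D x -> Ccont f x) ->
  (forall x, D x -> continuous M x) -> (forall x, D x -> Cmod (f x) <= M x) ->
  Cmod (RInt (V := C_R_CompleteNormedModule) f a b - RInt (V := C_R_CompleteNormedModule) f a' b)
   <= RInt M a b - RInt M a' b.
Proof.
  intros Hab HD Hc HM H.
  assert (E1 : RInt (V := C_R_CompleteNormedModule) f a b =
    (RInt (V := C_R_CompleteNormedModule) f a a' + RInt (V := C_R_CompleteNormedModule) f a' b)%C).
  { symmetry. apply (RInt_Chasles (V := C_R_CompleteNormedModule));
      eapply ex_RInt_Ccont; eauto; try tauto; intros x Hx; apply HD; lra. }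
  assert (E2 : RInt M a b = RInt M a a' + RInt M a' b).
  { symmetry. apply (RInt_Chasles (V := R_CompleteNormedModule));
      apply (ex_RInt_continuous (V := R_CompleteNormedModule)); intros x Hx;
      rewrite Rmin_left, Rmax_right in Hx by lra; apply HM, HD; lra. }
  rewrite E1, E2.
  assert (Z : forall u v : C, (u + v - v)%C = u) by (intros; ring). rewrite Z.
  assert (Z' : forall u v : R, u + v - v = u) by (intros; ring). rewrite Z'.
  apply RInt_dominated with D; auto; try tauto. intros x Hx; apply HD; lra.
Qed.

Lemma RInt_diff_right (f : R -> C) (M : R -> R) (D : R -> Prop) (a b b' : R) :
  a <= b <= b' -> (forall x, a <= x <= b' -> D x) -> (forall x, D x -> Ccont f x) ->
  (forall x, D x -> continuous M x) -> (forall x, D x -> Cmod (f x) <= M x) ->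
  Cmod (RInt (V := C_R_CompleteNormedModule) f a b' - RInt (V := C_R_CompleteNormedModule) f a b)
   <= RInt M a b' - RInt M a b.
Proof.
  intros Hab HD Hc HM H.
  assert (E1 : RInt (V := C_R_CompleteNormedModule) f a b' =
    (RInt (V := C_R_CompleteNormedModule) f a b + RInt (V := C_R_CompleteNormedModule) f b b')%C).
  { symmetry. apply (RInt_Chasles (V := C_R_CompleteNormedModule));
      eapply ex_RInt_Ccont; eauto; try tauto; intros x Hx; apply HD; lra. }
  assert (E2 : RInt M a b' = RInt M a b + RInt M b b').
  { symmetry. apply (RInt_Chasles (V := R_CompleteNormedModule));
      apply (ex_RInt_continuous (V := R_CompleteNormedModule)); intros x Hx;
      rewrite Rmin_left, Rmax_right in Hx by lra; apply HM, HD; lra. }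
  rewrite E1, E2.
  assert (Z : forall u v : C, (u + v - u)%C = v) by (intros; ring). rewrite Z.
  assert (Z' : forall u v : R, u + v - u = v) by (intros; ring). rewrite Z'.
  apply RInt_dominated with D; auto; try tauto. intros x Hx; apply HD; lra.
Qed.

Lemma series_tail (b : nat -> R) : ex_series b ->
  exists e, is_lim_seq e 0 /\ forall N, is_series (fun n => b (N + n)%nat) (e N).
Proof.
  intros Hb. exists (fun N => Series (fun n => b (N + n)%nat)). split.
  - apply is_lim_seq_incr_1.
    apply is_lim_seq_ext with (fun N => Series b - sum_n b N).
    { intros N. rewrite (Series_incr_n b (S N)); [|lia|auto]. simpl pred. rewrite <- sum_n_Reals.
      assert (Z : forall u v : R, u + v - u = v) by (intros; ring). apply Z. }
    replace 0 with (Series b - Series b) by ring.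
    apply is_lim_seq_minus'; [apply is_lim_seq_const|].
    apply (Series_correct b Hb).
  - intros N. apply Series_correct.
    apply (ex_series_ext (fun n => b (N + n)%nat)); auto. apply (ex_series_incr_n b N). auto.
Qed.

Lemma is_series_scal_r (c : R) (b : nat -> R) (l : R) : is_series b l -> is_series (fun n => b n * c) (l * c).
Proof.
  intros H. rewrite Rmult_comm. apply (is_series_ext (fun n => c * b n)). intros; apply Rmult_comm.
  apply (is_series_scal (K := R_AbsRing) (V := R_NormedModule)). auto.
Qed.

Section Gen.

Context (Fa Fb : (R -> Prop) -> Prop) {FFa : ProperFilter Fa} {FFb : ProperFilter Fb}.

(** Cauchy's criterion in a complete space: the integrals of [M] over intervals near the two ends
    are all close to [m], so those of [f] are close to one another. Most improper integrals below
    owe their existence to it. *)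
Lemma igen_dominated (D : R -> Prop) (f : R -> C) (M : R -> R) (m : R) :
  dom Fa Fb D -> (forall x, D x -> Ccont f x) -> (forall x, D x -> continuous M x) ->
  (forall x, D x -> Cmod (f x) <= M x) -> rgen M Fa Fb m -> exists l, igen f Fa Fb l.
Proof.
  intros HD Hc HM H Hm.
  assert (K := proj1 (filterlim_locally_cauchy (U := C_R_CompleteNormedModule) (F := filter_prod Fa Fb)
    (fun ab => RInt (V := C_R_CompleteNormedModule) f (fst ab) (snd ab)))).
  destruct K as [l Hl].
  - intros eps.
    (* Two integrals of [M] within eps/8 of [m] differ by less than eps/4; the two endpoint moves
       together then cost less than eps/2. *)
    assert (He : 0 < eps / 8) by (destruct eps; simpl; lra).
    assert (HB : locally (T := R_UniformSpace) m (ball m (mkposreal _ He))) by (exists (mkposreal _ He); auto).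
    specialize (Hm _ HB). unfold filtermapi in Hm. unfold dom in HD.
    destruct (filter_and (F := filter_prod Fa Fb) _ _ HD Hm) as [Q R' HQ HR K]. simpl in K.
    assert (KM : forall a b, Q a -> R' b -> (a <= b /\ forall x, a <= x <= b -> D x) /\ Rabs (RInt M a b - m) < eps / 8).
    { intros a b Ha Hb. destruct (K a b Ha Hb) as [K1 [y [K2 K3]]]. split; auto.
      rewrite (is_RInt_unique (V := R_CompleteNormedModule) M a b y K2). exact K3. }
    exists (fun ab => Q (fst ab) /\ R' (snd ab)). split.
    + exists Q R'; auto.
    + assert (L : forall a a' b, Q a -> Q a' -> R' b ->
        Cmod (RInt (V := C_R_CompleteNormedModule) f a b - RInt (V := C_R_CompleteNormedModule) f a' b) < eps / 4).
      { intros a a' b Ha Ha' Hb. destruct (KM a b Ha Hb) as [[k1 k2] k3]. destruct (KM a' b Ha' Hb) as [[k4 k5] k6].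
        apply Rabs_def2 in k3. apply Rabs_def2 in k6.
        destruct (Rle_dec a a').
        - eapply Rle_lt_trans; [apply (RInt_diff_left f M D); auto; lra|]. lra.
        - rewrite <- Cmod_opp, Copp_minus_distr.
          eapply Rle_lt_trans; [apply (RInt_diff_left f M D); auto; lra|]. lra. }
      assert (L' : forall a b b', Q a -> R' b -> R' b' ->
        Cmod (RInt (V := C_R_CompleteNormedModule) f a b - RInt (V := C_R_CompleteNormedModule) f a b') < eps / 4).
      { intros a b b' Ha Hb Hb'. destruct (KM a b Ha Hb) as [[k1 k2] k3]. destruct (KM a b' Ha Hb') as [[k4 k5] k6].
        apply Rabs_def2 in k3. apply Rabs_def2 in k6.
        destruct (Rle_dec b' b).
        - eapply Rle_lt_trans; [apply (RInt_diff_right f M D); auto; lra|]. lra.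
        - rewrite <- Cmod_opp, Copp_minus_distr.
          eapply Rle_lt_trans; [apply (RInt_diff_right f M D); auto; lra|]. lra. }
      intros [a b] [a' b'] [Ha Hb] [Ha' Hb']; simpl in *.
      apply C_NormedModule_mixin_compat1.
      assert (Z : forall x y z : C, Cmod (minus x y) <= Cmod (x - z) + Cmod (z - y)).
      { intros x y z. replace (minus x y) with ((x - z) + (z - y))%C.
        apply Cmod_triangle. change (x - z + (z - y) = x - y)%C. ring. }
      eapply Rle_lt_trans; [apply (Z _ _ (RInt (V := C_R_CompleteNormedModule) f a' b))|].
      generalize (L' a' b' b Ha' Hb' Hb) (L a' a b Ha' Ha Hb). lra.
  - exists l. unfold igen, is_RInt_gen. intros P HP.
    specialize (Hl P HP). unfold filtermap in Hl. unfold filtermapi. unfold dom in HD.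
    generalize (filter_and (F := filter_prod Fa Fb) _ _ HD Hl). apply filter_imp.
    intros [a b] [[H1 H2] H3]. simpl in *. eexists; split; [|exact H3].
    apply (RInt_correct (V := C_R_CompleteNormedModule)). eapply ex_RInt_Ccont; eauto.
Qed.

(** Termwise integration: the tail of the series is at most [e N * M x] with [e N] independent of x,
    so the single integral of [M] controls all remainders. The case N = 0 dominates [F] itself and
    gives its integrability. *)
Lemma igen_Mtest (D : R -> Prop) (A : nat -> R -> C) (F : R -> C) (I : nat -> C)
    (M : R -> R) (m : R) (b : nat -> R) :
  dom Fa Fb D -> (forall x, D x -> continuous M x) -> rgen M Fa Fb m ->
  (forall k x, D x -> Cmod (A k x) <= b k * M x) -> ex_series b ->
  (forall x, D x -> Ccont F x) ->
  (forall x, D x -> cser (fun k => A k x) (F x)) ->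
  (forall k, igen (A k) Fa Fb (I k)) ->
  exists L, igen F Fa Fb L /\ cser I L.
Proof.
  intros HD HMc HM HA Hb HF Hs HI.
  destruct (series_tail b Hb) as [e [He1 He2]].
  assert (T2 : forall N x, D x -> Cmod (F x - csum (fun k => A k x) N) <= e N * M x).
  { intros N x Hx. apply (cser_bound _ _ (fun n => b (N + n)%nat * M x)  _ (cser_tail _ _ N (Hs x Hx))).
    - intros n. apply HA; auto.
    - apply (is_series_scal_r (M x)). apply He2. }
  destruct (igen_dominated D F (fun x => e O * M x) (e O * m)) as [L HL]; auto.
  - intros x Hx. apply (continuous_mult (K := R_AbsRing) (fun _ => e O) M); auto. apply continuous_const.
  - intros x Hx. assert (K := T2 O x Hx). simpl in K.
    replace (F x - 0)%C with (F x) in K by ring. auto.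
  - apply rgen_scal; auto.
  - exists L. split; auto.
    apply (cser_of_csum _ _ (fun N => e N * m)).
    + intros N.
      apply (igen_norm Fa Fb D _ (fun x => e N * M x) _ _ HD (T2 N)).
      * apply igen_minus; auto. apply igen_csum; auto.
      * apply rgen_scal; auto.
    + replace (Finite 0) with (Rbar_mult 0 m) by (simpl; f_equal; ring).
      apply is_lim_seq_mult'; auto. apply is_lim_seq_const.
Qed.

(** The bound at radius [rho] makes the k-th term at most (|h| / rho)^k M, a geometric majorant.
    Expansions in s are carried through integrals in this form. *)
Lemma igen_series (D : R -> Prop) (A : nat -> R -> C) (F : R -> C) (I : nat -> C)
    (M : R -> R) (m rho : R) (h : C) :
  dom Fa Fb D -> 0 < rho -> Cmod h < rho ->
  (forall x, D x -> continuous M x) -> rgen M Fa Fb m ->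
  (forall k x, D x -> Cmod (A k x) * rho ^ k <= M x) ->
  (forall x, D x -> Ccont F x) ->
  (forall x, D x -> cser (fun k => (A k x * h ^ k)%C) (F x)) ->
  (forall k, igen (A k) Fa Fb (I k)) ->
  exists L, igen F Fa Fb L /\ cser (fun k => (I k * h ^ k)%C) L.
Proof.
  intros HD Hrho Hh HMc HM HA HF Hs HI.
  set (q := Cmod h / rho).
  assert (Hq : 0 <= q < 1).
  { unfold q; split. apply Rdiv_le_0_compat; auto; apply Cmod_ge_0.
    apply (Rmult_lt_reg_r rho); auto. unfold Rdiv. rewrite Rmult_assoc, Rinv_l; lra. }
  apply (igen_Mtest D (fun k x => A k x * h ^ k)%C F (fun k => I k * h ^ k)%C M m (fun k => q ^ k)); auto.
  - intros k x Hx. rewrite Cmod_mult, Cmod_pow.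
    replace (Cmod h ^ k) with (rho ^ k * q ^ k).
    + rewrite <- Rmult_assoc, Rmult_comm. apply Rmult_le_compat_l; auto. apply pow_le; lra.
    + unfold q, Rdiv. rewrite Rpow_mult_distr, pow_inv. field. apply pow_nonzero; lra.
  - exists (/ (1 - q)). apply geom_series; auto.
  - intros k. apply (igen_ext_all Fa Fb (fun x => h ^ k * A k x)%C); [intros; ring|].
    rewrite Cmult_comm. apply igen_scal; auto.
Qed.

End Gen.

Lemma Ccont_csum (A : nat -> R -> C) (N : nat) (x : R) :
  (forall k, Ccont (A k) x) -> Ccont (fun t => csum (fun k => A k t) N) x.
Proof.
  intros H; induction N as [|N IH]; simpl.
  - apply Ccont_const.
  - apply Ccont_plus; auto.
Qed.

Lemma Ccont_Mtest (A : nat -> R -> C) (F : R -> C) (b : nat -> R) (x0 : R) :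
  ex_series b -> (forall k, Ccont (A k) x0) ->
  locally x0 (fun x => (forall k, Cmod (A k x) <= b k) /\ cser (fun k => A k x) (F x)) ->
  Ccont F x0.
Proof.
  intros Hb Hc Hl. apply Ccont_eps. intros eps Heps.
  destruct (series_tail b Hb) as [e [He1 He2]].
  assert (T2 : forall N, locally x0 (fun x => Cmod (F x - csum (fun k => A k x) N) <= e N)).
  { intros N. revert Hl. apply filter_imp. intros x [H1 H2].
    apply (cser_bound _ _ (fun n => b (N + n)%nat)  _ (cser_tail _ _ N H2)); auto. }
  assert (He : 0 < eps / 3) by lra.
  assert (HN : exists N, e N < eps / 3).
  { apply is_lim_seq_spec in He1. destruct (He1 (mkposreal _ He)) as [N HN]. exists N.
    specialize (HN N (Nat.le_refl N)). simpl in HN. rewrite Rminus_0_r in HN.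
    eapply Rle_lt_trans; [apply Rle_abs|exact HN]. }
  destruct HN as [N HN].
  assert (Hs := Ccont_Clim _ _ (Ccont_csum A N x0 Hc) _ He).
  assert (Hx0 := locally_singleton _ _ (T2 N)). simpl in Hx0.
  generalize (filter_and _ _ (T2 N) Hs). apply filter_imp. intros x [H1 H2].
  replace (F x - F x0)%C with ((F x - csum (fun k => A k x) N) + (csum (fun k => A k x) N - csum (fun k => A k x0) N)
     + - (F x0 - csum (fun k => A k x0) N))%C by ring.
  eapply Rle_lt_trans; [apply Cmod_triangle|]. rewrite Cmod_opp.
  eapply Rle_lt_trans; [apply Rplus_le_compat_r; apply Cmod_triangle|]. lra.
Qed.

(** * The exponential series *)

Ltac pl := match goal with |- context[@plus ?G ?a ?b] => change (@plus G a b) with (Rplus a b) end.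

Lemma dom_points (a b : R) (D : R -> Prop) :
  a <= b -> (forall x, a <= x <= b -> D x) ->
  dom (at_point (T := R_UniformSpace) a) (at_point (T := R_UniformSpace) b) D.
Proof.
  intros H HD. exists (fun x => x = a) (fun x => x = b); [reflexivity|reflexivity|].
  intros x y -> ->; simpl; auto.
Qed.

Lemma Clim_point (f : R -> C) (a : R) : Clim f (at_point (T := R_UniformSpace) a) (f a).
Proof.
  intros e He. unfold at_point. replace (f a - f a)%C with (RtoC 0) by ring. rewrite Cmod_0; auto.
Qed.

Lemma rgen_ftc (Fa Fb : (R -> Prop) -> Prop) {FFa : ProperFilter Fa} {FFb : ProperFilter Fb}
    (F f : R -> R) (D : R -> Prop) (la lb : R) :
  dom Fa Fb D -> (forall x, D x -> is_derive F x (f x)) -> (forall x, D x -> continuous f x) ->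
  filterlim F Fa (locally la) -> filterlim F Fb (locally lb) -> rgen f Fa Fb (lb - la).
Proof.
  intros HD H1 H2 La Lb.
  assert (K : forall G l, filterlim F G (locally l) -> Clim (fun x => RtoC (F x)) G (RtoC l)).
  { intros G l H e He.
    assert (B : locally (T := R_UniformSpace) l (ball l (mkposreal _ He))) by (exists (mkposreal _ He); auto).
    specialize (H _ B). unfold filtermap in H.
    assert (E : forall x, ball (M := R_UniformSpace) l (mkposreal _ He) (F x) = (Cmod (RtoC (F x) - RtoC l) < e)).
    { intros x. rewrite <- RtoC_minus, Cmod_R. reflexivity. }
    replace (fun x => Cmod (RtoC (F x) - RtoC l) < e) with (fun x => ball (M := R_UniformSpace) l (mkposreal _ He) (F x)); auto.
    apply FunctionalExtensionality.functional_extensionality. exact E. }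
  assert (Q := igen_ftc Fa Fb (fun x => RtoC (F x)) (fun x => RtoC (f x)) D (RtoC la) (RtoC lb) HD).
  apply igen_Re in Q; try typeclasses eauto.
  - exact Q.
  - intros x Hx. apply Cder_RtoC; auto.
  - intros x Hx. apply Ccont_RtoC; auto.
  - auto.
  - auto.
Qed.

Lemma filterlim_point (F : R -> R) (a : R) : filterlim F (at_point (T := R_UniformSpace) a) (locally (F a)).
Proof. intros P HP. unfold filtermap, at_point. apply locally_singleton; auto. Qed.

Lemma rgen_pow01 (n : nat) :
  rgen (fun t => t ^ n) (at_point (T := R_UniformSpace) 0) (at_point (T := R_UniformSpace) 1) (/ INR (S n)).
Proof.
  assert (Hn : INR (S n) <> 0) by (apply not_0_INR; lia).
  replace (/ INR (S n)) with (1 ^ S n / INR (S n) - 0 ^ S n / INR (S n)).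
  - apply (rgen_ftc _ _ (fun t => t ^ S n / INR (S n)) _ (fun _ => True)).
    + apply dom_points; auto; lra.
    + intros x _. auto_derive; auto. simpl Nat.pred. field; auto.
    + intros x _. apply (continuous_of_ex_derive _ _ (INR n * 1 * x ^ pred n)).
      apply is_derive_pow. apply (is_derive_id (K := R_AbsRing)).
    + apply (filterlim_point (fun t => t ^ S n / INR (S n))).
    + apply (filterlim_point (fun t => t ^ S n / INR (S n))).
  - rewrite pow1, pow_i by lia. field; auto.
Qed.

Lemma exp_le (x y : R) : x <= y -> exp x <= exp y.
Proof. intros [H| ->]; [left; apply exp_increasing; auto|right; auto]. Qed.

Definition expc (z : C) (k : nat) : C := (z ^ k * RtoC (/ INR (fact k)))%C.

Lemma expc_S (z : C) (k : nat) : (RtoC (INR (S k)) * expc z (S k) = z * expc z k)%C.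
Proof.
  unfold expc. rewrite fact_simpl, mult_INR, Rinv_mult, RtoC_mult.
  assert (RtoC (INR (S k)) * RtoC (/ INR (S k)) = 1)%C as E.
  { rewrite <- RtoC_mult. f_equal. apply Rinv_r. apply not_0_INR; lia. }
  simpl Cpow.
  transitivity ((RtoC (INR (S k)) * RtoC (/ INR (S k))) * (z * (z ^ k * RtoC (/ INR (fact k)))))%C; [ring|].
  rewrite E. ring.
Qed.

Lemma Cder_powS (f : R -> C) (k : nat) (x : R) (l : C) : Cder f x l ->
  Cder (fun t => (f t ^ S k)%C) x (RtoC (INR (S k)) * l * f x ^ k)%C.
Proof.
  intros H. induction k as [|k IH].
  - apply (Cder_ext f); [intros; simpl; ring|]. eapply Cder_eq; [exact H|]. simpl. ring.
  - apply (Cder_ext (fun t => f t * f t ^ S k)%C); [intros; reflexivity|].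
    eapply Cder_eq; [apply Cder_mult; eauto|].
    rewrite (S_INR (S k)), RtoC_plus. simpl Cpow. ring.
Qed.

Lemma Cder_tz (z : C) (t : R) : Cder (fun t => (RtoC t * z)%C) t z.
Proof.
  eapply Cder_eq; [apply (Cder_mult (fun t => RtoC t) (fun _ => z)); [apply Cder_id|apply Cder_const]|]. ring.
Qed.

Lemma Cder_expsum (z : C) (N : nat) (t : R) :
  Cder (fun t => csum (expc (RtoC t * z)) (S N)) t (z * csum (expc (RtoC t * z)) N)%C.
Proof.
  induction N as [|N IH].
  - simpl. apply (Cder_ext (fun _ => RtoC (/ 1))). intros; unfold expc; simpl; ring.
    eapply Cder_eq; [apply Cder_const|]. ring.
  - change (Cder (fun t => csum (expc (RtoC t * z)) (S N) + expc (RtoC t * z) (S N))%C t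
      (z * (csum (expc (RtoC t * z)) N + expc (RtoC t * z) N))%C).
    eapply Cder_eq; [apply Cder_plus; [exact IH|]|rewrite Cmult_plus_distr_l; reflexivity].
    unfold expc. eapply Cder_eq.
    + apply (Cder_mult (fun t => (RtoC t * z) ^ S N)%C (fun _ => RtoC (/ INR (fact (S N))))); [|apply Cder_const].
      apply Cder_powS. apply Cder_tz.
    + assert (K := expc_S (RtoC t * z) N). unfold expc in K.
      rewrite fact_simpl, mult_INR, Rinv_mult, RtoC_mult.
      assert (RtoC (INR (S N)) * RtoC (/ INR (S N)) = 1)%C as E.
      { rewrite <- RtoC_mult. f_equal. apply Rinv_r. apply not_0_INR; lia. }
      transitivity ((RtoC (INR (S N)) * RtoC (/ INR (S N))) * (z * ((RtoC t * z) ^ N * RtoC (/ INR (fact N)))))%C; [ring|].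
      rewrite E. ring.
Qed.

Lemma csum_expc_0 (N : nat) : csum (expc 0) (S N) = 1%C.
Proof.
  induction N as [|N IH]; simpl.
  - unfold expc; simpl. rewrite Rinv_1. ring.
  - simpl in IH. rewrite IH. unfold expc. simpl Cpow. ring.
Qed.

(** Induction on N for all z at once: the remainder of order N + 1 is the integral over t in [0, 1]
    of z times the remainder of order N at tz, and the integral of t^N supplies the new factor 1 /
    (N + 1). *)
Lemma Cexp_taylor (N : nat) : forall z : C,
  Cmod (Cexp z - csum (expc z) N) <= Cmod z ^ N / INR (fact N) * exp (Cmod z).
Proof.
  induction N as [|N IH]; intros z.
  - simpl. replace (Cexp z - 0)%C with (Cexp z) by ring. rewrite Cmod_Cexp.
    replace (1 / 1 * exp (Cmod z)) with (exp (Cmod z)) by field.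
    apply exp_le. eapply Rle_trans; [apply Rle_abs|apply re_le_Cmod].
  - set (G := fun t => (Cexp (RtoC t * z) - csum (expc (RtoC t * z)) (S N))%C).
    assert (P : igen (fun t => z * (Cexp (RtoC t * z) - csum (expc (RtoC t * z)) N))%C
      (at_point (T := R_UniformSpace) 0) (at_point (T := R_UniformSpace) 1) (G 1 - G 0)%C).
    { apply (igen_ftc _ _ G _ (fun _ => True)).
      - apply dom_points; auto; lra.
      - intros x _. unfold G.
        eapply Cder_eq; [apply Cder_minus; [apply Cder_Cexp; apply Cder_tz|apply Cder_expsum]|]. cbv beta. ring.
      - intros x _. assert (T := Cder_cont _ _ _ (Cder_tz z x)).
        apply Ccont_mult; [apply Ccont_const|]. apply Ccont_minus; [apply Ccont_Cexp; auto|].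
        apply Ccont_csum. intros k. unfold expc. apply Ccont_mult; [|apply Ccont_const].
        apply Ccont_pow; auto.
      - apply Clim_point.
      - apply Clim_point. }
    assert (E0 : G 0 = 0%C).
    { unfold G. replace (RtoC 0 * z)%C with (RtoC 0) by ring. rewrite csum_expc_0, Cexp_0. ring. }
    assert (E1 : G 1 = (Cexp z - csum (expc z) (S N))%C).
    { unfold G. rewrite Cmult_1_l; auto. }
    rewrite E0, E1 in P. replace (Cexp z - csum (expc z) (S N) - 0)%C with (Cexp z - csum (expc z) (S N))%C in P by ring.
    assert (Q := rgen_scal _ _ (Cmod z ^ S N / INR (fact N) * exp (Cmod z)) _ _ (rgen_pow01 N)).
    assert (B : forall t, 0 <= t <= 1 ->
      Cmod (z * (Cexp (RtoC t * z) - csum (expc (RtoC t * z)) N)) <= Cmod z ^ S N / INR (fact N) * exp (Cmod z) * t ^ N).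
    { intros t Ht. rewrite Cmod_mult.
    eapply Rle_trans; [apply Rmult_le_compat_l; [apply Cmod_ge_0|apply IH]|].
    rewrite Cmod_mult, Cmod_R, Rabs_pos_eq by lra. rewrite Rpow_mult_distr.
    assert (X : exp (t * Cmod z) <= exp (Cmod z)).
    { apply exp_le. rewrite <- (Rmult_1_l (Cmod z)) at 2. apply Rmult_le_compat_r; [apply Cmod_ge_0|lra]. }
    assert (0 <= Cmod z * (t ^ N * Cmod z ^ N / INR (fact N))).
    { apply Rmult_le_pos; [apply Cmod_ge_0|]. apply Rdiv_le_0_compat; [|apply INR_fact_lt_0].
      apply Rmult_le_pos; apply pow_le; [lra|apply Cmod_ge_0]. }
    simpl pow.
    replace (Cmod z * (t ^ N * Cmod z ^ N / INR (fact N) * exp (t * Cmod z)))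
      with (Cmod z * (t ^ N * Cmod z ^ N / INR (fact N)) * exp (t * Cmod z)) by ring.
    replace (Cmod z * Cmod z ^ N / INR (fact N) * exp (Cmod z) * t ^ N) with
      (Cmod z * (t ^ N * Cmod z ^ N / INR (fact N)) * exp (Cmod z)) by (unfold Rdiv; ring).
    apply Rmult_le_compat_l; auto. }
    eapply Rle_trans; [apply (igen_norm _ _ (fun t => 0 <= t <= 1) _ _ _ _ (dom_points 0 1 _ Rle_0_1 (fun x H => H)) B P Q)|].
    right. rewrite fact_simpl, mult_INR. field. split; apply not_0_INR; auto. apply fact_neq_0.
Qed.

Lemma Cexp_series (z : C) : cser (expc z) (Cexp z).
Proof.
  apply (cser_of_csum _ _ _ (fun N => Cexp_taylor N z)).
  replace (Finite 0) with (Rbar_mult 0 (exp (Cmod z))) by (simpl; f_equal; ring).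
  apply is_lim_seq_mult'; [|apply is_lim_seq_const].
  apply is_lim_seq_Reals. apply cv_speed_pow_fact.
Qed.

(** A single term is at most the sum of the nonnegative series for e^y. Being uniform in k, it plays
    the part of a Cauchy estimate. *)
Lemma pow_fact_le_exp (y : R) (k : nat) : 0 <= y -> y ^ k / INR (fact k) <= exp y.
Proof.
  intros Hy. destruct (Cexp_series (RtoC y)) as [H _].
  rewrite Cexp_RtoC in H. change (Re (RtoC (exp y))) with (exp y) in H.
  assert (E : forall n, Re (expc (RtoC y) n) = y ^ n / INR (fact n)).
  { intros n. unfold expc. rewrite <- RtoC_pow, <- RtoC_mult. reflexivity. }
  assert (P : forall n, 0 <= Re (expc (RtoC y) n)).
  { intros n; rewrite E. apply Rdiv_le_0_compat; [apply pow_le; auto|apply INR_fact_lt_0]. }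
  rewrite <- E.
  apply Rle_trans with (sum_n (fun n => Re (expc (RtoC y) n)) k).
  - destruct k; [rewrite sum_O; lra|]. rewrite sum_Sn.
    assert (0 <= sum_n (fun n => Re (expc (RtoC y) n)) k); [|pl; lra].
    clear -P. induction k. rewrite sum_O; auto. rewrite sum_Sn. pl. specialize (P (S k)). lra.
  - apply (is_lim_seq_incr_compare (sum_n (fun n => Re (expc (RtoC y) n)))); auto.
    intros n. rewrite sum_Sn. specialize (P (S n)). pl; lra.
Qed.

(** The coefficient of h^k in x^(s + h), as [cpw_series] confirms. *)
Definition pcoef (s : C) (k : nat) (x : R) : C := (cpw x s * RtoC (ln x ^ k / INR (fact k)))%C.

Lemma cpw_series (x : R) (s h : C) : cser (fun k => (pcoef s k x * h ^ k)%C) (cpw x (s + h)).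
Proof.
  rewrite cpw_plus. apply (cser_ext (fun k => (cpw x s * expc (h * RtoC (ln x)) k)%C)).
  - intros k. unfold pcoef, expc, Rdiv. rewrite Cpow_mult_l, RtoC_mult, RtoC_pow. ring.
  - apply cser_scal. apply Cexp_series.
Qed.

Lemma Cmod_pcoef (s : C) (k : nat) (x rho : R) : 0 < x -> 0 <= rho ->
  Cmod (pcoef s k x) * rho ^ k <= Rpower x (Re s) * exp (rho * Rabs (ln x)).
Proof.
  intros Hx Hr. unfold pcoef. rewrite Cmod_mult, Cmod_cpw, Cmod_R, Rmult_assoc; auto.
  apply Rmult_le_compat_l; [left; apply exp_pos|].
  eapply Rle_trans; [|apply (pow_fact_le_exp _ k)].
  - right. unfold Rdiv. rewrite Rabs_mult, <- RPow_abs, (Rabs_pos_eq (/ _)).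
    rewrite Rpow_mult_distr; ring. left; apply Rinv_0_lt_compat, INR_fact_lt_0.
  - apply Rmult_le_pos; auto. apply Rabs_pos.
Qed.

Lemma Ccont_pcoef (s : C) (k : nat) (x : R) : 0 < x -> Ccont (pcoef s k) x.
Proof.
  intros Hx. unfold pcoef. apply Ccont_mult; [apply Ccont_cpw; auto|].
  apply Ccont_RtoC. apply (continuous_mult (K := R_AbsRing) (fun x => ln x ^ k) (fun _ => / INR (fact k)));
    [|apply continuous_const].
  eapply continuous_of_ex_derive. apply is_derive_pow. apply is_derive_ln; auto.
Qed.

(** * Power series and the identity theorem *)

(** The coefficient bound at the full radius is carried along with convergence because it gives
    geometric majorants on every smaller disc; shrinking a disc of convergence always provides it,
    see [ps_of_cser]. *)
Definition ps (a : nat -> C) (z0 : C) (rho : R) (f : C -> C) : Prop :=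
  0 < rho /\ (exists M, forall k, Cmod (a k) * rho ^ k <= M) /\
  forall h, Cmod h < rho -> cser (fun k => (a k * h ^ k)%C) (f (z0 + h)%C).

Lemma ps_M_pos (a : nat -> C) (rho M : R) : 0 < rho ->
  (forall k, Cmod (a k) * rho ^ k <= M) -> 0 <= M.
Proof.
  intros Hr H. eapply Rle_trans; [|apply (H O)].
  apply Rmult_le_pos; [apply Cmod_ge_0|apply pow_le; lra].
Qed.

Lemma term_bound (a : nat -> C) (rho M : R) (h : C) (k : nat) : 0 < rho ->
  (forall k, Cmod (a k) * rho ^ k <= M) -> Cmod (a k * h ^ k) <= M * (Cmod h / rho) ^ k.
Proof.
  intros Hr H. rewrite Cmod_mult, Cmod_pow.
  replace (Cmod h ^ k) with (rho ^ k * (Cmod h / rho) ^ k).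
  - rewrite <- Rmult_assoc. apply Rmult_le_compat_r; auto.
    apply pow_le. apply Rdiv_le_0_compat; auto; apply Cmod_ge_0.
  - unfold Rdiv. rewrite Rpow_mult_distr, pow_inv. field. apply pow_nonzero; lra.
Qed.

Lemma ratio_bounds (x rho : R) : 0 <= x < rho -> 0 <= x / rho < 1.
Proof.
  intros H. split. apply Rdiv_le_0_compat; lra.
  apply (Rmult_lt_reg_r rho); [lra|]. unfold Rdiv. rewrite Rmult_assoc, Rinv_l; lra.
Qed.

Lemma ps_ex_series (a : nat -> C) (rho : R) (h : C) :
  0 < rho -> (exists M, forall k, Cmod (a k) * rho ^ k <= M) -> Cmod h < rho ->
  ex_series (fun k => Cmod (a k * h ^ k)).
Proof.
  intros Hr [M H] Hh.
  apply (ex_series_le (V := R_CompleteNormedModule) _ (fun k => M * (Cmod h / rho) ^ k)).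
  - intros k. change (Rabs (Cmod (a k * h ^ k)) <= M * (Cmod h / rho) ^ k).
    rewrite Rabs_pos_eq by apply Cmod_ge_0. apply term_bound; auto.
  - apply (ex_series_scal (K := R_AbsRing) (V := R_NormedModule)).
    apply ex_series_geom. destruct (ratio_bounds (Cmod h) rho). split; auto; apply Cmod_ge_0.
    rewrite Rabs_pos_eq; lra.
Qed.

Lemma ps_shrink (a : nat -> C) (z0 : C) (rho rho' : R) (f : C -> C) :
  ps a z0 rho f -> 0 < rho' <= rho -> ps a z0 rho' f.
Proof.
  intros [H1 [[M H2] H3]] H; split; [lra|split].
  - exists M. intros k. eapply Rle_trans; [|apply (H2 k)].
    apply Rmult_le_compat_l; [apply Cmod_ge_0|]. apply pow_incr; lra.
  - intros h Hh. apply H3; lra.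
Qed.

Lemma ps_minus (a b : nat -> C) (z0 : C) (rho : R) (f g : C -> C) :
  ps a z0 rho f -> ps b z0 rho g -> ps (fun k => a k - b k)%C z0 rho (fun z => f z - g z)%C.
Proof.
  intros [H1 [[M H2] H3]] [_ [[M' H2'] H3']]; split; [auto|split]; auto.
  - exists (M + M'). intros k. specialize (H2 k). specialize (H2' k).
    assert (Cmod (a k - b k) <= Cmod (a k) + Cmod (b k)).
    { eapply Rle_trans; [apply Cmod_triangle|]. rewrite Cmod_opp; lra. }
    assert (0 < rho ^ k) by (apply pow_lt; auto). nra.
  - intros h Hh. apply (cser_ext (fun k => a k * h ^ k - b k * h ^ k)%C). intros; ring.
    apply cser_minus; auto.
Qed.

Lemma cser_0_only (c : C) : cser (fun k => match k with O => c | S _ => RtoC 0 end) c.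
Proof.
  apply (cser_eq _ (c + 0)%C); [|ring]. apply cser_incr. apply cser_zero.
Qed.

Lemma ps_at0 (a : nat -> C) (z0 : C) (rho : R) (f : C -> C) : ps a z0 rho f -> f z0 = a O.
Proof.
  intros [H1 [_ H3]].
  assert (K := H3 0). rewrite Cmod_0 in K. specialize (K H1). replace (z0 + 0)%C with z0 in K by ring.
  apply (cser_unique _ _ _ K).
  apply (cser_ext (fun k => match k with O => a O | S _ => RtoC 0 end)); [|apply cser_0_only].
  intros [|k]; simpl; ring.
Qed.

(* If a_0 .. a_(n-1) vanish then a_n = O(|h|) along any sequence of zeros h of f. *)
Lemma ps_zero (a : nat -> C) (z0 : C) (rho : R) (f : C -> C) :
  ps a z0 rho f ->
  (forall eps, 0 < eps -> exists h, 0 < Cmod h < eps /\ f (z0 + h)%C = 0) ->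
  forall k, a k = 0.
Proof.
  intros [H1 [[M H2] H3]] Hz n.
  induction n as [n IH] using (well_founded_induction Wf_nat.lt_wf).
  destruct (Req_dec (Cmod (a n)) 0) as [E|E]; [apply Cmod_eq_0; auto|exfalso].
  assert (P : 0 < Cmod (a n)) by (generalize (Cmod_ge_0 (a n)); lra).
  assert (HM := ps_M_pos a rho M H1 H2).
  assert (Hrn : 0 < rho ^ S n) by (apply pow_lt; auto).
  (* The first bound makes the ratio |h| / rho less than 1/2, so the tail after the n-th term is at
     most 2 M (|h| / rho)^(n+1). The second makes this smaller than |a_n| |h|^n, so the two cannot
     cancel. *)
  set (eps := Rmin (rho / 2) (Cmod (a n) / (2 * (M + 1) / rho ^ S n) / 2)).
  assert (He0 : 0 < 2 * (M + 1) / rho ^ S n) by (apply Rdiv_lt_0_compat; lra).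
  assert (He : 0 < eps).
  { unfold eps. apply Rmin_pos; [lra|]. apply Rdiv_lt_0_compat; [|lra]. apply Rdiv_lt_0_compat; auto. }
  destruct (Hz eps He) as [h [[Hh0 Hh] Hf]].
  assert (Hh1 : Cmod h < rho / 2) by (eapply Rlt_le_trans; [exact Hh|apply Rmin_l]).
  assert (Hh2 : Cmod h < Cmod (a n) / (2 * (M + 1) / rho ^ S n)).
  { apply Rlt_le_trans with (Cmod (a n) / (2 * (M + 1) / rho ^ S n) / 2).
    - eapply Rlt_le_trans; [exact Hh|apply Rmin_r].
    - assert (0 < Cmod (a n) / (2 * (M + 1) / rho ^ S n)) by (apply Rdiv_lt_0_compat; auto). lra. }
  assert (S1 := H3 h ltac:(lra)). rewrite Hf in S1.
  apply (cser_tail _ _ (S n)) in S1. simpl csum in S1.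
  rewrite csum_zero in S1.
  2:{ intros k Hk. rewrite IH; auto. ring. }
  set (q := Cmod h / rho) in *.
  assert (Hq : 0 <= q < 1 / 2).
  { unfold q. split. apply Rdiv_le_0_compat; lra.
    apply (Rmult_lt_reg_r rho); [lra|]. unfold Rdiv. rewrite Rmult_assoc, Rinv_l; lra. }
  assert (B := cser_bound _ _ (fun j => M * q ^ S n * q ^ j) (M * q ^ S n * / (1 - q)) S1).
  assert (B' : Cmod (0 - (0 + a n * h ^ n)) <= M * q ^ S n * / (1 - q)).
  { apply B.
    - intros j. eapply Rle_trans; [apply (term_bound a rho M h); auto|]. fold q.
      replace (S (n + j)) with (S n + j)%nat by lia. rewrite pow_add. lra.
    - apply (is_series_scal (K := R_AbsRing) (V := R_NormedModule)). apply geom_series; lra. }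
  replace (0 - (0 + a n * h ^ n))%C with (- (a n * h ^ n))%C in B' by ring.
  rewrite Cmod_opp, Cmod_mult, Cmod_pow in B'.
  assert (Hhn : 0 < Cmod h ^ n) by (apply pow_lt; auto).
  assert (X : M * q ^ S n * / (1 - q) <= (2 * (M + 1) / rho ^ S n * Cmod h) * Cmod h ^ n).
  { replace (2 * (M + 1) / rho ^ S n * Cmod h * Cmod h ^ n) with ((M + 1) * q ^ S n * 2).
    - apply Rmult_le_compat.
      + apply Rmult_le_pos; auto; apply pow_le; lra.
      + left; apply Rinv_0_lt_compat; lra.
      + apply Rmult_le_compat_r; [apply pow_le; lra|lra].
      + replace 2 with (/ (1 / 2)) by field. apply Rinv_le_contravar; lra.
    - unfold q, Rdiv. rewrite Rpow_mult_distr, pow_inv. simpl. field. split; [apply pow_nonzero; lra|lra]. }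
  assert (Y : Cmod (a n) <= 2 * (M + 1) / rho ^ S n * Cmod h).
  { apply (Rmult_le_reg_r (Cmod h ^ n)); auto. lra. }
  assert (Z : 2 * (M + 1) / rho ^ S n * Cmod h < Cmod (a n)); [|lra].
  apply (Rmult_lt_compat_l (2 * (M + 1) / rho ^ S n)) in Hh2; auto.
  eapply Rlt_le_trans; [exact Hh2|]. right. field. split; lra.
Qed.

Lemma ps_coef_unique (a b : nat -> C) (z0 : C) (rho : R) (f : C -> C) :
  ps a z0 rho f -> ps b z0 rho f -> forall k, a k = b k.
Proof.
  intros A B k.
  assert (Z := ps_zero _ _ _ _ (ps_minus _ _ _ _ _ _ A B)).
  assert (Zk : (a k - b k)%C = 0).
  { apply Z. intros eps He. exists (RtoC (eps / 2)). rewrite Cmod_R, Rabs_pos_eq by lra.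
    split; [lra|ring]. }
  replace (a k) with ((a k - b k) + b k)%C by ring. rewrite Zk. ring.
Qed.

(** Multiplied through by powers of [R1], so that no negative power of [R1] appears for small n. The
    first-order estimate belongs to the same induction: passing from m to m + 1 in the second-order
    one leaves the term k ((z + k)^m - z^m). *)
Lemma pow_quadratic (z k : C) (R1 : R) : Cmod z + Cmod k <= R1 -> forall n,
  Cmod ((z + k) ^ S n - z ^ S n) * R1 <= INR (S n) * Cmod k * R1 ^ S n /\
  Cmod ((z + k) ^ S n - z ^ S n - RtoC (INR (S n)) * k * z ^ n) * R1 ^ 2 <= INR (S n) ^ 2 * Cmod k ^ 2 * R1 ^ S n.
Proof.
  intros H.
  assert (Z := Cmod_ge_0 z). assert (K := Cmod_ge_0 k).
  assert (Hzk : Cmod (z + k) <= R1) by (eapply Rle_trans; [apply Cmod_triangle|auto]).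
  induction n as [|n [IH1 IH2]].
  - split.
    + simpl. replace ((z + k) * 1 - z * 1)%C with k by ring. lra.
    + replace ((z + k) ^ 1 - z ^ 1 - RtoC (INR 1) * k * z ^ 0)%C with (RtoC 0) by (simpl; ring).
      rewrite Cmod_0, Rmult_0_l. simpl. rewrite !Rmult_1_r, Rmult_1_l.
      apply Rmult_le_pos; [|lra]. apply Rmult_le_pos; auto.
  - set (m := S n) in *.
    assert (Pm : 0 <= INR m) by apply pos_INR.
    assert (PR : 0 <= R1 ^ m) by (apply pow_le; lra).
    assert (Q1 : Cmod (z ^ m) <= R1 ^ m). { rewrite Cmod_pow. apply pow_incr. lra. }
    assert (Q2 : Cmod ((z + k) ^ m) <= R1 ^ m). { rewrite Cmod_pow. apply pow_incr. split; auto. apply Cmod_ge_0. }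
    split.
    + replace ((z + k) ^ S m - z ^ S m)%C with (z * ((z + k) ^ m - z ^ m) + k * (z + k) ^ m)%C by (simpl; ring).
      rewrite S_INR. change (R1 ^ S m) with (R1 * R1 ^ m).
      eapply Rle_trans; [apply Rmult_le_compat_r; [lra|apply Cmod_triangle]|].
      rewrite !Cmod_mult, Rmult_plus_distr_r.
      assert (Cmod z * Cmod ((z + k) ^ m - z ^ m) * R1 <= R1 * (INR m * Cmod k * R1 ^ m)).
      { rewrite Rmult_assoc. apply Rmult_le_compat; auto; try lra. apply Rmult_le_pos; [apply Cmod_ge_0|lra]. }
      assert (Cmod k * Cmod ((z + k) ^ m) * R1 <= Cmod k * R1 ^ m * R1).
      { apply Rmult_le_compat_r; [lra|]. apply Rmult_le_compat_l; auto. }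
      lra.
    + replace ((z + k) ^ S m - z ^ S m - RtoC (INR (S m)) * k * z ^ m)%C
        with (z * ((z + k) ^ m - z ^ m - RtoC (INR m) * k * z ^ n) + k * ((z + k) ^ m - z ^ m))%C
        by (rewrite (S_INR m), RtoC_plus; unfold m; simpl; ring).
      rewrite S_INR. change (R1 ^ S m) with (R1 * R1 ^ m).
      eapply Rle_trans; [apply Rmult_le_compat_r; [apply pow_le; lra|apply Cmod_triangle]|].
      rewrite !Cmod_mult, Rmult_plus_distr_r.
      assert (Cmod z * Cmod ((z + k) ^ m - z ^ m - RtoC (INR m) * k * z ^ n) * R1 ^ 2 <= R1 * (INR m ^ 2 * Cmod k ^ 2 * R1 ^ m)).
      { rewrite Rmult_assoc. apply Rmult_le_compat; auto; try lra. apply Rmult_le_pos; [apply Cmod_ge_0|apply pow_le; lra]. }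
      assert (Cmod k * Cmod ((z + k) ^ m - z ^ m) * R1 ^ 2 <= (Cmod k * R1) * (INR m * Cmod k * R1 ^ m)).
      { replace (Cmod k * Cmod ((z + k) ^ m - z ^ m) * R1 ^ 2) with ((Cmod k * R1) * (Cmod ((z + k) ^ m - z ^ m) * R1)) by ring.
        apply Rmult_le_compat_l; auto. apply Rmult_le_pos; lra. }
      assert (0 <= R1 * R1 ^ m * Cmod k ^ 2 * (INR m + 1)).
      { apply Rmult_le_pos; [|lra]. apply Rmult_le_pos; [|apply pow2_ge_0]. apply Rmult_le_pos; lra. }
      nra.
Qed.

Lemma ex_series_sq_geom (q : R) : 0 < q < 1 -> ex_series (fun n => INR (S n) ^ 2 * q ^ n).
Proof.
  intros Hq.
  apply ex_series_ext with (fun n => Rabs (INR (S n) ^ 2 * q ^ n)).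
  { intros n. apply Rabs_pos_eq. apply Rmult_le_pos; apply pow_le; [apply pos_INR|lra]. }
  apply ex_series_DAlembert with q; [lra| |].
  - intros n. apply Rmult_integral_contrapositive_currified; apply pow_nonzero; [apply not_0_INR; lia|lra].
  - apply is_lim_seq_ext with (fun n => q * (1 + / INR (S n)) ^ 2).
    + intros n. assert (H0 : INR (S n) <> 0) by (apply not_0_INR; lia).
      assert (q ^ n <> 0) by (apply pow_nonzero; lra).
      replace (INR (S (S n)) ^ 2 * q ^ S n / (INR (S n) ^ 2 * q ^ n)) with (q * (1 + / INR (S n)) ^ 2).
      * symmetry. apply Rabs_pos_eq. apply Rmult_le_pos; [lra|]. apply pow2_ge_0.
      * rewrite (S_INR (S n)). simpl pow. field. split; auto.
    + replace (Finite q) with (Finite (q * (1 + 0) ^ 2)) by (f_equal; ring).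
      apply is_lim_seq_mult'; [apply is_lim_seq_const|].
      assert (L : is_lim_seq (fun n => 1 + / INR (S n)) (1 + 0)).
      { apply is_lim_seq_plus'; [apply is_lim_seq_const|].
        apply (is_lim_seq_incr_1 (fun n => / INR n)).
        replace (Finite 0) with (Rbar_inv p_infty) by reflexivity.
        apply is_lim_seq_inv; [apply is_lim_seq_INR|discriminate]. }
      simpl. apply is_lim_seq_mult'; auto. apply is_lim_seq_mult'; auto. apply is_lim_seq_const.
Qed.

Lemma sqrt2_le_2 : sqrt 2 <= 2.
Proof. apply Rsqr_incr_0_var; [|lra]. rewrite Rsqr_sqrt by lra. unfold Rsqr; lra. Qed.

Lemma C_derive_of_quadratic (f : C -> C) (z l : C) (A delta : R) : 0 < delta ->
  (forall k, Cmod k < delta -> Cmod (f (z + k)%C - f z - k * l) <= A * Cmod k ^ 2) ->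
  C_derive f z = l.
Proof.
  intros Hd H. unfold C_derive. apply is_C_lim_unique.
  intros P HP. destruct HP as [e He].
  assert (He0 := cond_pos e).
  (* Balls of [C_UniformSpace] are squares, so the modulus may exceed the radius by the factor sqrt
     2; halving makes room for it. *)
  set (d := Rmin delta (e / (Rabs A + 1)) / 2).
  assert (HA := Rabs_pos A).
  assert (Hd0 : 0 < d).
  { unfold d. apply Rdiv_lt_0_compat; [|lra]. apply Rmin_pos; auto. apply Rdiv_lt_0_compat; lra. }
  exists (mkposreal d Hd0).
  enough (Aux : forall w : C, ball (M := C_UniformSpace) z (mkposreal d Hd0) w -> w <> z ->
    P ((f w - f z) / (w - z))%C) by exact Aux.
  intros w Hw Hwz.
  apply He.
  assert (Hw' : Cmod (w - z) < 2 * d).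
  { apply C_NormedModule_mixin_compat2 in Hw.
    eapply Rlt_le_trans; [exact Hw|]. simpl. apply Rmult_le_compat_r; [lra|].
    apply sqrt2_le_2. }
  assert (Hnz : (w - z)%C <> 0).
  { intros E. apply Hwz. replace w with ((w - z) + z)%C by ring. rewrite E. ring. }
  assert (Hpos : 0 < Cmod (w - z)) by (apply Cmod_gt_0; auto).
  assert (D1 : 2 * d <= delta) by (unfold d; generalize (Rmin_l delta (e / (Rabs A + 1))); lra).
  assert (D2 : 2 * d <= e / (Rabs A + 1)) by (unfold d; generalize (Rmin_r delta (e / (Rabs A + 1))); lra).
  apply C_NormedModule_mixin_compat1.
  change (Cmod ((f w - f z) / (w - z) - l) < e).
  specialize (H (w - z)%C ltac:(lra)). replace (z + (w - z))%C with w in H by ring.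
  replace ((f w - f z) / (w - z) - l)%C with ((f w - f z - (w - z) * l) / (w - z))%C by (field; auto).
  rewrite Cmod_div; auto.
  apply (Rmult_lt_reg_r (Cmod (w - z))); auto. unfold Rdiv at 1. rewrite Rmult_assoc, Rinv_l, Rmult_1_r by lra.
  eapply Rle_lt_trans; [exact H|].
  replace (A * Cmod (w - z) ^ 2) with ((A * Cmod (w - z)) * Cmod (w - z)) by ring.
  apply Rmult_lt_compat_r; auto.
  apply Rle_lt_trans with (Rabs A * Cmod (w - z)).
  { apply Rmult_le_compat_r; [lra|]. apply Rle_abs. }
  apply Rlt_le_trans with ((Rabs A + 1) * (e / (Rabs A + 1))).
  - apply Rle_lt_trans with ((Rabs A + 1) * Cmod (w - z)).
    + apply Rmult_le_compat_r; lra.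
    + apply Rmult_lt_compat_l; lra.
  - right. field. lra.
Qed.

Definition dcoef (a : nat -> C) (k : nat) : C := (RtoC (INR (S k)) * a (S k))%C.

(** The factor k + 1 is at most 2^(k+1), which halving the radius pays for. *)
Lemma dcoef_bound (a : nat -> C) (rho M : R) : 0 < rho ->
  (forall k, Cmod (a k) * rho ^ k <= M) ->
  forall k, Cmod (dcoef a k) * (rho / 2) ^ k <= 2 * M / rho.
Proof.
  intros Hr H k. unfold dcoef. rewrite Cmod_mult, Cmod_R, Rabs_pos_eq by apply pos_INR.
  assert (K : INR (S k) <= 2 * 2 ^ k).
  { clear. induction k; [simpl; lra|]. rewrite S_INR. simpl pow.
    assert (1 <= 2 ^ k) by (apply pow_R1_Rle; lra). lra. }
  assert (P : 0 < rho ^ k) by (apply pow_lt; auto).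
  assert (P2 : 0 < 2 ^ k) by (apply pow_lt; lra).
  specialize (H (S k)). simpl pow in H.
  apply (Rmult_le_reg_r rho); auto.
  replace (2 * M / rho * rho) with (2 * M) by (field; lra).
  unfold Rdiv. rewrite Rpow_mult_distr, pow_inv.
  replace (INR (S k) * Cmod (a (S k)) * (rho ^ k * / 2 ^ k) * rho) with
    ((INR (S k) * / 2 ^ k) * (Cmod (a (S k)) * (rho * rho ^ k))) by ring.
  apply Rmult_le_compat; auto.
  - apply Rmult_le_pos; [apply pos_INR|left; apply Rinv_0_lt_compat; auto].
  - apply Rmult_le_pos; [apply Cmod_ge_0|]. apply Rmult_le_pos; lra.
  - apply (Rmult_le_reg_r (2 ^ k)); auto. rewrite Rmult_assoc, Rinv_l; lra.
Qed.

(** Termwise differentiation on a whole disc and not only at its centre, since the derivative has to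
    be differentiated again. Increments are compared term by term through [pow_quadratic], whose
    factor (n + 1)^2 is summable against a geometric sequence. *)
Lemma ps_C_derive (a : nat -> C) (z0 : C) (rho : R) (f : C -> C) :
  ps a z0 rho f -> ps (dcoef a) z0 (rho / 2) (C_derive f).
Proof.
  intros [H1 [[M H2] H3]]. split; [lra|split].
  - exists (2 * M / rho). apply dcoef_bound; auto.
  - intros h Hh.
    destruct (cser_ex (fun k => dcoef a k * h ^ k)%C (fun k => 2 * M / rho * (Cmod h / (rho / 2)) ^ k)) as [l Hl].
    { intros n. apply term_bound; [lra|]. apply dcoef_bound; auto. }
    { apply (ex_series_scal (K := R_AbsRing) (V := R_NormedModule)).
      apply ex_series_geom. destruct (ratio_bounds (Cmod h) (rho / 2)). split; auto; apply Cmod_ge_0.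
      rewrite Rabs_pos_eq; lra. }
    replace (C_derive f (z0 + h)) with l; auto.
    symmetry.
    (* Room for |h| < rho/2 and |k| < rho/4 together, still strictly inside the disc. *)
    set (R1 := 3 / 4 * rho).
    assert (Hh0 := Cmod_ge_0 h).
    set (q := R1 / rho).
    assert (Hq : q = 3 / 4) by (unfold q, R1; field; lra).
    destruct (ex_series_sq_geom q ltac:(lra)) as [sg Hsg].
    apply (C_derive_of_quadratic _ _ _ (M * q * / R1 ^ 2 * sg) (rho / 4)); [lra|].
    intros k Hk.
    assert (K1 : Cmod h + Cmod k <= R1) by (unfold R1; lra).
    assert (Sk := H3 (h + k)%C ltac:(eapply Rle_lt_trans; [apply Cmod_triangle|]; unfold R1 in K1; lra)).
    replace (z0 + (h + k))%C with (z0 + h + k)%C in Sk by ring.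
    assert (Sh := H3 h ltac:(lra)).
    assert (D := cser_minus _ _ _ _ Sk Sh). apply cser_decr in D.
    simpl Cpow in D.
    assert (D2 := cser_minus _ _ _ _ D (cser_scal k _ _ Hl)).
    replace (f (z0 + h + k)%C - f (z0 + h)%C - (a 0%nat * 1 - a 0%nat * 1) - k * l)%C with
      (f (z0 + h + k)%C - f (z0 + h)%C - k * l)%C in D2 by ring.
    apply (cser_bound _ _ (fun n => M * q * / R1 ^ 2 * Cmod k ^ 2 * (INR (S n) ^ 2 * q ^ n)) _ D2).
    + intros n. cbv beta.
      replace (a (S n) * ((h + k) * (h + k) ^ n) - a (S n) * (h * h ^ n) - k * (dcoef a n * h ^ n))%C
        with (a (S n) * ((h + k) ^ S n - h ^ S n - RtoC (INR (S n)) * k * h ^ n))%C by (unfold dcoef; simpl; ring).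
      rewrite Cmod_mult.
      destruct (pow_quadratic h k R1 K1 n) as [_ Q].
      assert (PR : 0 < R1 ^ 2) by (apply pow_lt; unfold R1; lra).
      assert (Pr : 0 < rho ^ S n) by (apply pow_lt; auto).
      apply (Rmult_le_reg_r (R1 ^ 2)); auto.
      rewrite Rmult_assoc.
      eapply Rle_trans; [apply Rmult_le_compat_l; [apply Cmod_ge_0|exact Q]|].
      replace (R1 ^ S n) with (rho ^ S n * q ^ S n).
      * replace (Cmod (a (S n)) * (INR (S n) ^ 2 * Cmod k ^ 2 * (rho ^ S n * q ^ S n))) with
          (Cmod (a (S n)) * rho ^ S n * (INR (S n) ^ 2 * Cmod k ^ 2 * q ^ S n)) by ring.
        replace (M * q * / R1 ^ 2 * Cmod k ^ 2 * (INR (S n) ^ 2 * q ^ n) * R1 ^ 2) with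
          (M * (INR (S n) ^ 2 * Cmod k ^ 2 * q ^ S n)) by (simpl; field; unfold R1; lra).
        apply Rmult_le_compat_r; auto.
        apply Rmult_le_pos; [apply Rmult_le_pos|]; apply pow_le; [apply pos_INR|apply Cmod_ge_0|lra].
      * rewrite <- Rpow_mult_distr. f_equal. unfold q; field; lra.
    + replace (M * q * / R1 ^ 2 * sg * Cmod k ^ 2) with (M * q * / R1 ^ 2 * Cmod k ^ 2 * sg) by ring.
      apply (is_series_scal (K := R_AbsRing) (V := R_NormedModule)). auto.
Qed.

(** Each derivative halves the radius, which is harmless because finitely many are taken and only
    the value at the centre is read. *)
Lemma C_derive_n_ps (r : nat) : forall (a : nat -> C) (z0 : C) (rho : R) (f : C -> C),
  ps a z0 rho f -> C_derive_n r f z0 = (RtoC (INR (fact r)) * a r)%C.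
Proof.
  induction r as [|r IH]; intros a z0 rho f H.
  - simpl. rewrite (ps_at0 _ _ _ _ H). ring.
  - unfold C_derive_n. rewrite Nat.iter_succ_r. fold (C_derive_n r (C_derive f)).
    rewrite (IH _ _ _ _ (ps_C_derive _ _ _ _ H)). unfold dcoef.
    rewrite fact_simpl, mult_INR, RtoC_mult. ring.
Qed.

Lemma ps_analytic (a : nat -> C) (z0 : C) (rho : R) (f : C -> C) : ps a z0 rho f -> analytic_at f z0.
Proof.
  intros [H1 [_ H3]]. exists a.
  assert (Hr : 0 < rho / 2) by lra.
  exists (mkposreal _ Hr).
  enough (Aux : forall z : C, ball (M := C_UniformSpace) z0 (mkposreal _ Hr) z ->
    is_pseries (K := C_AbsRing) (V := C_NormedModule) a (z - z0)%C (f z)) by exact Aux.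
  intros z Hz.
  apply C_NormedModule_mixin_compat2 in Hz.
  change (Cmod (z - z0) < sqrt 2 * (rho / 2)) in Hz.
  assert (K2 := sqrt2_le_2).
  assert (K := H3 (z - z0)%C ltac:(nra)).
  replace (z0 + (z - z0))%C with z in K by ring.
  unfold is_pseries. apply -> cser_is_series.
  revert K. apply cser_ext. intros n.
  change ((a n * (z - z0) ^ n)%C = (pow_n (K := C_AbsRing) (z - z0)%C n * a n)%C).
  transitivity ((z - z0) ^ n * a n)%C; [apply Cmult_comm|]. reflexivity.
Qed.

Lemma cser_terms_bounded (a : nat -> C) (l : C) : cser a l -> exists M, forall n, Cmod (a n) <= M.
Proof.
  intros [A B].
  assert (K : forall u x, is_series (V := R_NormedModule) u x -> exists M, forall n, Rabs (u n) <= M).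
  { intros u x Hu. assert (L := ex_series_lim_0 u (ex_intro _ x Hu)).
    apply is_lim_seq_Reals in L. destruct (maj_by_pos u (exist _ 0 L)) as [M [_ HM]]. exists M; auto. }
  destruct (K _ _ A) as [M1 H1]. destruct (K _ _ B) as [M2 H2].
  exists (M1 + M2). intros n. eapply Rle_trans; [apply Cmod_le_sum|]. specialize (H1 n). specialize (H2 n). lra.
Qed.

(** The terms of the series at the point eps/2 converge to 0 and so are bounded, which is the
    coefficient bound at that radius. *)
Lemma analytic_ps (f : C -> C) (z0 : C) : analytic_at f z0 -> exists a rho, ps a z0 rho f.
Proof.
  intros [a H]. apply locally_Cmod in H. destruct H as [eps [He H]].
  assert (S1 : forall h, Cmod h < eps -> cser (fun k => a k * h ^ k)%C (f (z0 + h)%C)).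
  { intros h Hh. specialize (H (z0 + h)%C).
    replace (z0 + h - z0)%C with h in H by ring. specialize (H Hh). unfold is_pseries in H.
    apply cser_is_series in H. revert H. apply cser_ext. intros n.
    change ((pow_n (K := C_AbsRing) h n * a n)%C = (a n * h ^ n)%C).
    transitivity (h ^ n * a n)%C; [|apply Cmult_comm]. reflexivity. }
  exists a, (eps / 2). split; [lra|split].
  - assert (Q := S1 (RtoC (eps / 2))). rewrite Cmod_R, Rabs_pos_eq in Q by lra.
    destruct (cser_terms_bounded _ _ (Q ltac:(lra))) as [M HM]. exists M. intros k.
    specialize (HM k). rewrite Cmod_mult, Cmod_pow, Cmod_R, Rabs_pos_eq in HM by lra. auto.
  - intros h Hh. apply S1; lra.
Qed.

(* The infimum of the parameters beyond which f and g agree along the ray is 0: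
   at a positive infimum the local Taylor coefficients of f - g would vanish. *)
Lemma identity_ray (f g : C -> C) (z0 d : C) : d <> 0 ->
  (forall t, 0 <= t -> analytic_at f (z0 + RtoC t * d)%C) ->
  (forall t, 0 <= t -> analytic_at g (z0 + RtoC t * d)%C) ->
  (exists T, 0 <= T /\ forall t, T < t -> f (z0 + RtoC t * d)%C = g (z0 + RtoC t * d)%C) ->
  exists eps, 0 < eps /\ forall h, Cmod h < eps -> f (z0 + h)%C = g (z0 + h)%C.
Proof.
  intros Hd Hf Hg [T0 [HT0 HT]].
  assert (Pd : 0 < Cmod d) by (apply Cmod_gt_0; auto).
  (* [completeness] yields suprema, so the members are negated parameters and [- m] is the infimum
     sought. *)
  set (E := fun u => u <= 0 /\ forall t, - u < t -> f (z0 + RtoC t * d)%C = g (z0 + RtoC t * d)%C).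
  destruct (completeness E) as [m [Hm1 Hm2]].
  { exists 0. intros u [Hu _]; auto. }
  { exists (- T0). split; [lra|]. intros t Ht. apply HT. lra. }
  assert (Hm0 : m <= 0). { apply Hm2. intros u [Hu _]; auto. }
  assert (EQ : forall t, - m < t -> f (z0 + RtoC t * d)%C = g (z0 + RtoC t * d)%C).
  { intros t Ht. destruct (Classical_Prop.classic (exists u, E u /\ - t < u)) as [[u [[_ Hu] Hu2]]|N].
    - apply Hu. lra.
    - exfalso. assert (m <= - t); [|lra]. apply Hm2. intros u Hu.
      destruct (Rle_dec u (- t)); auto. exfalso. apply N. exists u; split; auto; lra. }
  assert (L : exists eps, 0 < eps /\ forall h, Cmod h < eps -> f (z0 + RtoC (- m) * d + h)%C = g (z0 + RtoC (- m) * d + h)%C).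
  { destruct (analytic_ps _ _ (Hf (- m) ltac:(lra))) as [a [r1 Ha]].
    destruct (analytic_ps _ _ (Hg (- m) ltac:(lra))) as [b [r2 Hb]].
    assert (Hr : 0 < Rmin r1 r2) by (destruct Ha, Hb; apply Rmin_pos; auto).
    assert (A := ps_shrink _ _ _ (Rmin r1 r2) _ Ha (conj Hr (Rmin_l _ _))).
    assert (B := ps_shrink _ _ _ (Rmin r1 r2) _ Hb (conj Hr (Rmin_r _ _))).
    assert (D := ps_minus _ _ _ _ _ _ A B).
    assert (Z := ps_zero _ _ _ _ D).
    exists (Rmin r1 r2). split; auto. intros h Hh.
    destruct D as [_ [_ D]]. specialize (D h Hh).
    assert (ZZ : (f (z0 + RtoC (- m) * d + h)%C - g (z0 + RtoC (- m) * d + h)%C)%C = 0).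
    { apply (cser_unique _ _ _ D). apply (cser_ext (fun _ => RtoC 0)); [|apply cser_zero].
      intros k. rewrite Z; [ring|].
      intros eps He. exists (RtoC (eps / Cmod d / 2) * d)%C.
      assert (P : 0 < eps / Cmod d / 2) by (apply Rdiv_lt_0_compat; [apply Rdiv_lt_0_compat; auto|lra]).
      rewrite Cmod_mult, Cmod_R, Rabs_pos_eq by lra.
      replace (eps / Cmod d / 2 * Cmod d) with (eps / 2) by (field; lra). split; [lra|].
      replace (z0 + RtoC (- m) * d + RtoC (eps / Cmod d / 2) * d)%C with
        (z0 + RtoC (- m + eps / Cmod d / 2) * d)%C by (rewrite RtoC_plus; ring).
      rewrite EQ by lra. ring. }
    replace (f (z0 + RtoC (- m) * d + h)%C) with ((f (z0 + RtoC (- m) * d + h)%C - g (z0 + RtoC (- m) * d + h)%C) + g (z0 + RtoC (- m) * d + h)%C)%C by ring.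
    rewrite ZZ. ring. }
  destruct (Req_dec m 0) as [E0|E0].
  - destruct L as [eps [He L]]. exists eps; split; auto. intros h Hh. specialize (L h Hh).
    rewrite E0 in L. replace (z0 + RtoC (- 0) * d + h)%C with (z0 + h)%C in L; auto.
    rewrite Ropp_0. ring.
  - exfalso. destruct L as [eps [He L]].
    (* Agreement on the disc around the point with parameter [- m] prolongs agreement on the ray by
       half the radius, so [E] would have a member above its supremum. *)
    set (u := Rmin 0 (m + eps / Cmod d / 2)).
    assert (P : 0 < eps / Cmod d / 2) by (apply Rdiv_lt_0_compat; [apply Rdiv_lt_0_compat; auto|lra]).
    assert (Eu : E u).
    { split; [apply Rmin_l|]. intros t Ht.
      destruct (Rlt_dec (- m) t) as [H|H]; [apply EQ; auto|].
      assert (Hu : - m - eps / Cmod d / 2 < t).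
      { unfold u in Ht. generalize (Rmin_r 0 (m + eps / Cmod d / 2)). lra. }
      replace (z0 + RtoC t * d)%C with (z0 + RtoC (- m) * d + RtoC (t + m) * d)%C
        by (rewrite RtoC_plus, RtoC_opp; ring).
      apply L. rewrite Cmod_mult, Cmod_R.
      rewrite Rabs_left1 by lra.
      apply Rle_lt_trans with (eps / Cmod d / 2 * Cmod d).
      + apply Rmult_le_compat_r; lra.
      + replace (eps / Cmod d / 2 * Cmod d) with (eps / 2) by (field; lra). lra. }
    specialize (Hm1 u Eu). unfold u in Hm1.
    assert (m < Rmin 0 (m + eps / Cmod d / 2)) by (apply Rmin_glb_lt; lra). lra.
Qed.

(** * The gamma function as a Laplace integral *)

Lemma filterlim_eps (f : R -> R) (F : (R -> Prop) -> Prop) {FF : Filter F} (l : R) :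
  (forall eps, 0 < eps -> F (fun x => Rabs (f x - l) < eps)) -> filterlim f F (locally l).
Proof.
  intros H P [e He]. unfold filtermap. generalize (H e (cond_pos e)).
  apply filter_imp. intros x Hx. apply He. exact Hx.
Qed.

Lemma at_right_pos (d : R) : 0 < d -> at_right 0 (fun x => 0 < x < d).
Proof.
  intros Hd. exists (mkposreal d Hd). intros x Hx Hx0.
  change (Rabs (x - 0) < d) in Hx. rewrite Rminus_0_r, Rabs_pos_eq in Hx; lra.
Qed.

Lemma p_infty_gt (B : R) : Rbar_locally p_infty (fun x => B < x).
Proof. exists B; auto. Qed.

Lemma dom_0_infty : dom (at_right 0) (Rbar_locally p_infty) (fun x => 0 < x).
Proof.
  exists (fun x => 0 < x < 1) (fun x => 1 < x).
  - apply at_right_pos; lra.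
  - apply p_infty_gt.
  - intros x y Hx Hy; simpl. split; [lra|]. intros t Ht; lra.
Qed.

Lemma dom_0_1 : dom (at_right 0) (at_point (T := R_UniformSpace) 1) (fun x => 0 < x <= 1).
Proof.
  exists (fun x => 0 < x < 1) (fun x => x = 1).
  - apply at_right_pos; lra.
  - reflexivity.
  - intros x y Hx ->; simpl. split; [lra|]. intros t Ht; lra.
Qed.

Lemma dom_1_infty : dom (at_point (T := R_UniformSpace) 1) (Rbar_locally p_infty) (fun x => 1 <= x).
Proof.
  exists (fun x => x = 1) (fun x => 1 < x).
  - reflexivity.
  - apply p_infty_gt.
  - intros x y -> Hy; simpl. split; [lra|]. intros t Ht; lra.
Qed.

(** * Real powers and majorants on the half-line *)

Lemma Rpower_pos (x p : R) : 0 < Rpower x p.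
Proof. apply exp_pos. Qed.

Lemma is_derive_Rpower (p x : R) : 0 < x -> is_derive (fun t => Rpower t p) x (p * Rpower x (p - 1)).
Proof. intros Hx. apply is_derive_Reals. apply derivable_pt_lim_power; auto. Qed.

Lemma continuous_Rpower (p x : R) : 0 < x -> continuous (fun t => Rpower t p) x.
Proof. intros Hx. eapply continuous_of_ex_derive. apply is_derive_Rpower; auto. Qed.

Lemma Rpower_base_le (x y q : R) : 0 <= q -> 0 < x <= y -> Rpower x q <= Rpower y q.
Proof. intros Hq H. apply Rle_Rpower_l; auto. Qed.

Lemma Rpower_small (q eps : R) : 0 < q -> 0 < eps -> exists d, 0 < d /\ forall x, 0 < x < d -> Rpower x q < eps.
Proof.
  intros Hq He. exists (Rpower eps (/ q)). split; [apply Rpower_pos|].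
  intros x Hx. replace eps with (Rpower (Rpower eps (/ q)) q).
  - unfold Rpower at 1 2. apply exp_increasing. apply Rmult_lt_compat_l; auto.
    apply ln_increasing; tauto.
  - rewrite Rpower_mult. replace (/ q * q) with 1 by (field; lra). apply Rpower_1; auto.
Qed.

Lemma rgen_Rpower_01 (q : R) : 0 < q ->
  rgen (fun x => Rpower x (q - 1)) (at_right 0) (at_point (T := R_UniformSpace) 1) (/ q).
Proof.
  intros Hq.
  assert (E : Rpower 1 q = 1) by (unfold Rpower; rewrite ln_1, Rmult_0_r; apply exp_0).
  replace (/ q) with (Rpower 1 q / q - 0) by (rewrite E; field; lra).
  apply (rgen_ftc _ _ (fun x => Rpower x q / q) _ (fun x => 0 < x <= 1)).
  - apply dom_0_1.
  - intros x Hx. evar_last.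
    + apply (is_derive_ext (fun x => / q * Rpower x q)). intros; simpl; field; lra.
      apply is_derive_scal. apply is_derive_Rpower; lra.
    + field; lra.
  - intros x Hx. apply continuous_Rpower; lra.
  - apply filterlim_eps; [typeclasses eauto|]. intros eps He.
    destruct (Rpower_small q (eps * q) Hq) as [d [Hd H]]; [apply Rmult_lt_0_compat; auto|].
    generalize (at_right_pos d Hd). apply filter_imp. intros x Hx.
    rewrite Rminus_0_r, Rabs_pos_eq.
    + apply (Rmult_lt_reg_r q); auto. unfold Rdiv. rewrite Rmult_assoc, Rinv_l by lra. rewrite Rmult_1_r. auto.
    + apply Rdiv_le_0_compat; auto. left; apply Rpower_pos.
  - apply (filterlim_point (fun x => Rpower x q / q)).
Qed.

(* The derivative of (x / (1 + x))^(p + 1) / (p + 1). *)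
Definition Wt (p x : R) : R := Rpower x p * Rpower (1 + x) (- (p + 2)).

Lemma continuous_Wt (p x : R) : 0 < x -> continuous (Wt p) x.
Proof.
  intros Hx. apply (continuous_mult (K := R_AbsRing) (fun x => Rpower x p) (fun x => Rpower (1 + x) (- (p + 2)))).
  - apply continuous_Rpower; auto.
  - apply (continuous_comp (fun x => 1 + x) (fun y => Rpower y (- (p + 2)))).
    + apply (continuous_plus (V := R_NormedModule) (fun _ => 1) (fun x => x)); [apply continuous_const|apply continuous_id].
    + apply continuous_Rpower; lra.
Qed.

Lemma rgen_Wt (p : R) : -1 < p -> rgen (Wt p) (at_right 0) (Rbar_locally p_infty) (/ (p + 1)).
Proof.
  intros Hp. set (q := p + 1). assert (Hq : 0 < q) by (unfold q; lra).
  replace (/ q) with (1 / q - 0) by (field; lra).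
  apply (rgen_ftc _ _ (fun x => / q * (Rpower x q * Rpower (1 + x) (- q))) _ (fun x => 0 < x)).
  - apply dom_0_infty.
  - intros x Hx. evar_last.
    + apply is_derive_scal. apply Derive.is_derive_mult.
      * apply is_derive_Rpower; auto.
      * apply (is_derive_comp (fun y => Rpower y (- q)) (fun x => 1 + x)).
        apply is_derive_Rpower; lra. auto_derive; auto.
    + unfold scal; simpl; unfold mult; simpl. unfold Wt.
      replace (- q) with (- (p + 2) + 1) by (unfold q; ring).
      replace (- (p + 2) + 1 - 1) with (- (p + 2)) by ring.
      replace (q - 1) with p by (unfold q; ring).
      rewrite (Rpower_plus _ _ (1 + x)), Rpower_1 by lra.
      replace (Rpower x q) with (Rpower x p * x) by (unfold q; rewrite Rpower_plus, Rpower_1; auto).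
      unfold q in *. field. lra.
  - intros x Hx. apply continuous_Wt; auto.
  - apply filterlim_eps; [typeclasses eauto|]. intros eps He.
    destruct (Rpower_small q (eps * q) Hq) as [d [Hd H]]; [apply Rmult_lt_0_compat; auto|].
    generalize (at_right_pos d Hd). apply filter_imp. intros x Hx.
    assert (K : Rpower (1 + x) (- q) <= 1).
    { unfold Rpower. rewrite <- exp_0 at 2. apply exp_le.
      assert (0 <= ln (1 + x)). { rewrite <- ln_1. apply Rcomplements.ln_le; lra. } nra. }
    assert (K0 := Rpower_pos (1 + x) (- q)). assert (K1 := Rpower_pos x q).
    rewrite Rminus_0_r, Rabs_pos_eq.
    + apply (Rmult_lt_reg_l q); auto. rewrite <- Rmult_assoc, Rinv_r by lra. rewrite Rmult_1_l.
      specialize (H x Hx). nra.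
    + apply Rmult_le_pos; [left; apply Rinv_0_lt_compat; auto|]. apply Rmult_le_pos; lra.
  - apply filterlim_eps; [typeclasses eauto|]. intros eps He.
    assert (Hc : continuous (fun y => Rpower y q) 1) by (apply continuous_Rpower; lra).
    assert (Heq : 0 < eps * q) by (apply Rmult_lt_0_compat; auto).
    assert (HB : locally (T := R_UniformSpace) (Rpower 1 q) (ball (Rpower 1 q) (mkposreal _ Heq))) by (exists (mkposreal _ Heq); auto).
    destruct (Hc _ HB) as [d Hd].
    assert (Hd0 := cond_pos d).
    generalize (p_infty_gt (Rmax 1 (1 / d))). apply filter_imp. intros x Hx.
    assert (X1 : 1 < x) by (eapply Rle_lt_trans; [apply Rmax_l|exact Hx]).
    assert (X2 : 1 / d < x) by (eapply Rle_lt_trans; [apply Rmax_r|exact Hx]).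
    assert (B : ball (M := R_UniformSpace) 1 d (x / (1 + x))).
    { change (Rabs (x / (1 + x) - 1) < d).
      replace (x / (1 + x) - 1) with (- (1 / (1 + x))) by (field; lra).
      rewrite Rabs_Ropp, Rabs_pos_eq by (apply Rdiv_le_0_compat; lra).
      apply (Rmult_lt_reg_r (1 + x)); [lra|]. unfold Rdiv. rewrite Rmult_assoc, Rinv_l by lra.
      apply (Rmult_lt_compat_r d) in X2; auto. unfold Rdiv in X2. rewrite Rmult_assoc, Rinv_l in X2 by lra. lra. }
    specialize (Hd _ B). change (Rabs (Rpower (x / (1 + x)) q - Rpower 1 q) < eps * q) in Hd.
    replace (Rpower 1 q) with 1 in Hd by (unfold Rpower; rewrite ln_1, Rmult_0_r, exp_0; auto).
    replace (Rpower (x / (1 + x)) q) with (Rpower x q * Rpower (1 + x) (- q)) in Hd.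
    + replace (/ q * (Rpower x q * Rpower (1 + x) (- q)) - 1 / q) with (/ q * (Rpower x q * Rpower (1 + x) (- q) - 1)) by (field; lra).
      rewrite Rabs_mult, Rabs_pos_eq by (left; apply Rinv_0_lt_compat; auto).
      apply (Rmult_lt_reg_l q); auto. rewrite <- Rmult_assoc, Rinv_r by lra. rewrite Rmult_1_l. lra.
    + unfold Rpower. rewrite <- exp_plus. f_equal. unfold Rdiv. rewrite ln_mult, ln_Rinv; try lra.
      apply Rinv_0_lt_compat; lra.
Qed.

Lemma ln_le_sub1 (y : R) : 0 < y -> ln y <= y - 1.
Proof.
  intros Hy. assert (H := exp_ineq1_le (ln y)). rewrite exp_ln in H by auto. lra.
Qed.

(** The constant comes from the tangent bound ln y <= y - 1 at y = (1 + x) eta / q, which bounds (1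
    + x)^q e^(-eta x). A power with exponential decay is thereby dominated by a function whose
    integral is explicit. *)
Lemma Wt_dominates (p eta : R) : -1 < p -> 0 < eta ->
  exists K, 0 < K /\ forall x, 0 < x -> Rpower x p * exp (- (eta * x)) <= K * Wt p x.
Proof.
  intros Hp He. set (q := p + 2). assert (Hq : 0 < q) by (unfold q; lra).
  exists (exp (eta - q - q * ln (eta / q))). split; [apply exp_pos|].
  intros x Hx. unfold Wt. fold q.
  replace (exp (eta - q - q * ln (eta / q)) * (Rpower x p * Rpower (1 + x) (- q))) with
    (Rpower x p * (exp (eta - q - q * ln (eta / q)) * Rpower (1 + x) (- q))) by ring.
  apply Rmult_le_compat_l; [left; apply Rpower_pos|].
  unfold Rpower. rewrite <- exp_plus. apply exp_le.
  assert (Hc : 0 < eta / q) by (apply Rdiv_lt_0_compat; auto).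
  assert (K := ln_le_sub1 ((1 + x) * (eta / q)) ltac:(apply Rmult_lt_0_compat; lra)).
  rewrite ln_mult in K by lra.
  apply (Rmult_le_compat_l q) in K; [|lra].
  replace (q * ((1 + x) * (eta / q) - 1)) with ((1 + x) * eta - q) in K by (field; lra). lra.
Qed.

Lemma Wt_le (p x : R) : 0 <= p -> 1 <= x -> Wt p x <= Rpower x (- 2).
Proof.
  intros Hp Hx. unfold Wt. replace (- (p + 2)) with (- p + - 2) by ring. rewrite (Rpower_plus (- p)), <- Rmult_assoc.
  assert (L0 : 0 <= ln x) by (rewrite <- ln_1; apply Rcomplements.ln_le; lra).
  assert (L1 : ln x <= ln (1 + x)) by (apply Rcomplements.ln_le; lra).
  rewrite <- (Rmult_1_l (Rpower x (- 2))). apply Rmult_le_compat.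
  - left; apply Rmult_lt_0_compat; apply Rpower_pos.
  - left; apply Rpower_pos.
  - unfold Rpower. rewrite <- exp_plus. apply Rle_trans with (exp 0); [apply exp_le|rewrite exp_0; lra]. nra.
  - unfold Rpower. apply exp_le. nra.
Qed.

Lemma Rpower_infty_small (p eps : R) : 0 < p -> 0 < eps ->
  Rbar_locally p_infty (fun x => 1 < x /\ Rpower x (- p) < eps).
Proof.
  intros Hp He. destruct (Rpower_small p eps Hp He) as [d [Hd H]].
  generalize (p_infty_gt (Rmax 1 (/ d))). apply filter_imp. intros x Hx.
  assert (X1 : 1 < x) by (eapply Rle_lt_trans; [apply Rmax_l|exact Hx]).
  assert (X2 : / d < x) by (eapply Rle_lt_trans; [apply Rmax_r|exact Hx]).
  split; auto.
  replace (Rpower x (- p)) with (Rpower (/ x) p).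
  - apply H. split; [apply Rinv_0_lt_compat; lra|].
    assert (Hid : 0 < / d) by (apply Rinv_0_lt_compat; auto).
    rewrite <- (Rinv_inv d). apply Rinv_lt_contravar; auto. apply Rmult_lt_0_compat; lra.
  - unfold Rpower. rewrite ln_Rinv by lra. f_equal. ring.
Qed.

(** Trades |log x| for two powers, one controlling infinity and one controlling 0. A shift of the
    exponent by [rho] in either direction is then the whole cost of an expansion in s. *)
Lemma exp_rho_ln (rho x : R) : exp (rho * Rabs (ln x)) <= Rpower x rho + Rpower x (- rho).
Proof.
  unfold Rpower. assert (H1 := exp_pos (rho * ln x)). assert (H2 := exp_pos (- rho * ln x)).
  destruct (Rle_dec 0 (ln x)).
  - rewrite Rabs_pos_eq; lra.
  - rewrite Rabs_left by lra. replace (rho * - ln x) with (- rho * ln x) by ring. lra.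
Qed.

Lemma Re_zx (z : C) (x : R) : Re (- (z * RtoC x))%C = - (Re z * x).
Proof. unfold Re; simpl; ring. Qed.

Definition Lk (w z : C) (x : R) : C := (cpw x (w - 1) * Cexp (- (z * RtoC x)))%C.

Lemma Cmod_Lk (w z : C) (x : R) : 0 < x -> Cmod (Lk w z x) = Rpower x (Re w - 1) * exp (- (Re z * x)).
Proof. intros Hx. unfold Lk. rewrite Cmod_mult, Cmod_cpw, Cmod_Cexp, Re_zx; auto. Qed.

Lemma Cder_ezx (z : C) (x : R) : Cder (fun x => Cexp (- (z * RtoC x))) x (- z * Cexp (- (z * RtoC x)))%C.
Proof.
  eapply Cder_eq.
  - apply (Cder_Cexp (fun x => - (z * RtoC x))%C). apply Cder_opp. apply Cder_scal. apply Cder_id.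
  - ring.
Qed.

Lemma Ccont_Lk (w z : C) (x : R) : 0 < x -> Ccont (Lk w z) x.
Proof.
  intros Hx. unfold Lk. apply Ccont_mult; [apply Ccont_cpw; auto|]. eapply Cder_cont. apply Cder_ezx.
Qed.

Lemma Lk_ex (w z : C) : 0 < Re w -> 0 < Re z ->
  exists l, igen (Lk w z) (at_right 0) (Rbar_locally p_infty) l.
Proof.
  intros Hw Hz. destruct (Wt_dominates (Re w - 1) (Re z) ltac:(lra) Hz) as [K [HK H]].
  apply (igen_dominated (at_right 0) (Rbar_locally p_infty) (fun x => 0 < x) _ (fun x => K * Wt (Re w - 1) x) (K * / (Re w - 1 + 1))).
  - apply dom_0_infty.
  - intros x Hx. apply Ccont_Lk; auto.
  - intros x Hx. apply (continuous_mult (K := R_AbsRing) (fun _ => K) (Wt _)); [apply continuous_const|apply continuous_Wt; auto].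
  - intros x Hx. rewrite Cmod_Lk; auto.
  - apply rgen_scal; try typeclasses eauto. apply rgen_Wt; lra.
Qed.

Definition Lint (w z : C) : C :=
  RInt_gen (V := C_R_CompleteNormedModule) (Lk w z) (at_right 0) (Rbar_locally p_infty).

Lemma Lint_correct (w z : C) : 0 < Re w -> 0 < Re z ->
  igen (Lk w z) (at_right 0) (Rbar_locally p_infty) (Lint w z).
Proof.
  intros Hw Hz. destruct (Lk_ex w z Hw Hz) as [l Hl].
  unfold Lint. apply (RInt_gen_correct (V := C_R_CompleteNormedModule)). exists l; exact Hl.
Qed.

Lemma Gamma_Lint (w : C) : 0 < Re w -> Gamma w = Lint w 1.
Proof.
  intros Hw. unfold Gamma.
  apply (is_RInt_gen_unique (V := C_R_CompleteNormedModule)).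
  apply (igen_ext (at_right 0) (Rbar_locally p_infty) (fun x => 0 < x) (Lk w 1)).
  - apply dom_0_infty.
  - intros x Hx. rewrite Cpower_cpw; auto. unfold Lk. f_equal.
    replace (- (1 * RtoC x))%C with (RtoC (- x)) by (rewrite RtoC_opp; ring). apply Cexp_RtoC.
  - apply Lint_correct; simpl; lra.
Qed.

(** The derivative of x^w e^(-zx) is integrated; the boundary values vanish, at 0 because Re w > 0
    and at infinity because Re z > 0. *)
Lemma Lint_rec (w z : C) : 0 < Re w -> 0 < Re z -> (z * Lint (w + 1) z = w * Lint w z)%C.
Proof.
  intros Hw Hz.
  assert (A := igen_minus (at_right 0) (Rbar_locally p_infty) _ _ _ _ (igen_scal (at_right 0) (Rbar_locally p_infty) w _ _ (Lint_correct w z Hw Hz))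
    (igen_scal (at_right 0) (Rbar_locally p_infty) z _ _ (Lint_correct (w + 1) z ltac:(simpl; unfold Re in *; lra) Hz))).
  assert (Z : (w * Lint w z - z * Lint (w + 1) z = 0 - 0)%C).
  { apply (igen_unique (at_right 0) (Rbar_locally p_infty) _ _ _ A).
    apply (igen_ftc (at_right 0) (Rbar_locally p_infty) (fun x => cpw x w * Cexp (- (z * RtoC x)))%C _ (fun x => 0 < x)).
    - apply dom_0_infty.
    - intros x Hx. eapply Cder_eq; [apply Cder_mult; [apply Cder_cpw; auto|apply Cder_ezx]|].
      unfold Lk. replace (w + 1 - 1)%C with w by ring. ring.
    - intros x Hx. apply Ccont_minus; apply Ccont_mult; try apply Ccont_const; apply Ccont_Lk; auto.
    - intros eps He. destruct (Rpower_small (Re w) eps Hw He) as [d [Hd H]].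
      generalize (at_right_pos d Hd). apply filter_imp. intros x Hx.
      replace (cpw x w * Cexp (- (z * RtoC x)) - 0)%C with (cpw x w * Cexp (- (z * RtoC x)))%C by ring.
      rewrite Cmod_mult, Cmod_cpw, Cmod_Cexp, Re_zx by tauto.
      apply Rle_lt_trans with (Rpower x (Re w) * 1); [|rewrite Rmult_1_r; auto].
      apply Rmult_le_compat_l; [left; apply Rpower_pos|]. rewrite <- exp_0. apply exp_le.
      assert (0 < Re z * x) by (apply Rmult_lt_0_compat; tauto). lra.
    - intros eps He. destruct (Wt_dominates (Re w) (Re z) ltac:(lra) Hz) as [K [HK H]].
      generalize (Rpower_infty_small 2 (eps / K) ltac:(lra) ltac:(apply Rdiv_lt_0_compat; auto)).
      apply filter_imp. intros x [X1 X2].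
      replace (cpw x w * Cexp (- (z * RtoC x)) - 0)%C with (cpw x w * Cexp (- (z * RtoC x)))%C by ring.
      rewrite Cmod_mult, Cmod_cpw, Cmod_Cexp, Re_zx by lra.
      eapply Rle_lt_trans; [apply H; lra|].
      assert (Y := Wt_le (Re w) x ltac:(lra) ltac:(lra)).
      apply Rle_lt_trans with (K * Rpower x (- 2)); [apply Rmult_le_compat_l; lra|].
      apply (Rmult_lt_compat_l K) in X2; auto. replace (K * (eps / K)) with eps in X2 by (field; lra). auto. }
  replace (z * Lint (w + 1) z)%C with (w * Lint w z - (w * Lint w z - z * Lint (w + 1) z))%C by ring.
  rewrite Z. ring.
Qed.

(** Differentiability in z under the integral sign, from the second-order Taylor bound for
    e^(-kx). *)
Lemma Lint_quadratic (w z : C) : 0 < Re w -> 0 < Re z ->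
  exists A, forall k, Cmod k < Re z / 2 ->
    Cmod (Lint w (z + k) - Lint w z - k * (- Lint (w + 1) z)) <= A * Cmod k ^ 2.
Proof.
  (* The Taylor remainder contributes x^2, which raises the exponent from Re w - 1 to Re w + 1, and
     a factor e^(|k| x), which costs half of the decay rate when |k| < Re z / 2. *)
  intros Hw Hz. destruct (Wt_dominates (Re w + 1) (Re z / 2) ltac:(lra) ltac:(lra)) as [K [HK H]].
  exists (K * / (Re w + 1 + 1)). intros k Hk.
  assert (Hrk : Rabs (Re k) < Re z / 2) by (eapply Rle_lt_trans; [apply re_le_Cmod|auto]).
  apply Rabs_def2 in Hrk.
  assert (Hzk : 0 < Re (z + k)%C) by (simpl; unfold Re in *; lra).
  assert (I := igen_minus (at_right 0) (Rbar_locally p_infty) _ _ _ _ (igen_minus (at_right 0) (Rbar_locally p_infty) _ _ _ _ (Lint_correct w (z + k) Hw Hzk) (Lint_correct w z Hw Hz))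
    (igen_scal (at_right 0) (Rbar_locally p_infty) (- k)%C _ _ (Lint_correct (w + 1) z ltac:(simpl; unfold Re in *; lra) Hz))).
  replace (k * - Lint (w + 1) z)%C with (- k * Lint (w + 1) z)%C by ring.
  replace (K * / (Re w + 1 + 1) * Cmod k ^ 2) with (Cmod k ^ 2 * (K * / (Re w + 1 + 1))) by ring.
  refine (igen_norm (at_right 0) (Rbar_locally p_infty) (fun x => 0 < x) _ (fun x => Cmod k ^ 2 * (K * Wt (Re w + 1) x)) _ _ dom_0_infty _ I _).
  - intros x Hx. unfold Lk. replace (w + 1 - 1)%C with ((w - 1) + 1)%C by ring. rewrite cpw_S; auto.
    replace (- ((z + k) * RtoC x))%C with (- (z * RtoC x) + - (k * RtoC x))%C by ring. rewrite Cexp_plus.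
    set (u := (- (k * RtoC x))%C).
    replace (cpw x (w - 1) * (Cexp (- (z * RtoC x)) * Cexp u) - cpw x (w - 1) * Cexp (- (z * RtoC x)) - - k * (RtoC x * cpw x (w - 1) * Cexp (- (z * RtoC x))))%C
      with (cpw x (w - 1) * Cexp (- (z * RtoC x)) * (Cexp u - csum (expc u) 2))%C.
    2:{ simpl. unfold expc. simpl. rewrite Rinv_1. unfold u. ring. }
    fold (Lk w z x). rewrite Cmod_mult, Cmod_Lk; auto.
    assert (T := Cexp_taylor 2 u).
    assert (Hu : Cmod u = Cmod k * x). { unfold u. rewrite Cmod_opp, Cmod_mult, Cmod_R, Rabs_pos_eq; lra. }
    rewrite Hu in T. simpl fact in T. simpl INR in T.
    eapply Rle_trans; [apply Rmult_le_compat_l; [|exact T]|].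
    { apply Rmult_le_pos; left; [apply Rpower_pos|apply exp_pos]. }
    specialize (H x Hx).
    assert (E1 : Rpower x (Re w + 1) = Rpower x (Re w - 1) * x ^ 2).
    { replace (Re w + 1) with (Re w - 1 + INR 2) by (simpl; ring). rewrite Rpower_plus, Rpower_pow; auto. }
    assert (E2 : exp (- (Re z * x)) * exp (Cmod k * x) <= exp (- (Re z / 2 * x))).
    { rewrite <- exp_plus. apply exp_le. assert (Cmod k * x <= Re z / 2 * x) by (apply Rmult_le_compat_r; lra). lra. }
    rewrite E1 in H.
    assert (P1 := Rpower_pos x (Re w - 1)). assert (P2 : 0 <= Cmod k ^ 2) by apply pow2_ge_0.
    apply Rle_trans with (Cmod k ^ 2 * (Rpower x (Re w - 1) * x ^ 2 * exp (- (Re z / 2 * x)))).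
    + replace (Rpower x (Re w - 1) * exp (- (Re z * x)) * ((Cmod k * x) ^ 2 / (1 + 1) * exp (Cmod k * x))) with
       ((Cmod k ^ 2 * (Rpower x (Re w - 1) * x ^ 2)) * ((exp (- (Re z * x)) * exp (Cmod k * x)) / 2)) by (field).
      replace (Cmod k ^ 2 * (Rpower x (Re w - 1) * x ^ 2 * exp (- (Re z / 2 * x)))) with
        ((Cmod k ^ 2 * (Rpower x (Re w - 1) * x ^ 2)) * exp (- (Re z / 2 * x))) by ring.
      apply Rmult_le_compat_l.
      * apply Rmult_le_pos; auto. apply Rmult_le_pos; [lra|apply pow2_ge_0].
      * assert (0 < exp (- (Re z * x)) * exp (Cmod k * x)) by (apply Rmult_lt_0_compat; apply exp_pos). lra.
    + apply Rmult_le_compat_l; auto.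
  - apply rgen_scal; try typeclasses eauto. apply rgen_scal; try typeclasses eauto. apply rgen_Wt; lra.
Qed.

Lemma Cder_of_quadratic (F : R -> C) (t : R) (L : C) (A delta : R) : 0 < delta ->
  (forall s, Rabs s < delta -> Cmod (F (t + s) - F t - RtoC s * L) <= A * s ^ 2) -> Cder F t L.
Proof.
  intros Hd H.
  assert (K : forall (f : R -> R) l, (forall s, Rabs s < delta -> Rabs (f (t + s) - f t - s * l) <= A * s ^ 2) -> is_derive f t l).
  { intros f l Hf. apply is_derive_Reals. intros eps He.
    assert (HA := Rabs_pos A).
    assert (Hm : 0 < Rmin delta (eps / (Rabs A + 1))).
    { apply Rmin_pos; auto. apply Rdiv_lt_0_compat; lra. }
    exists (mkposreal _ Hm). intros s Hs0 Hs. simpl in Hs.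
    assert (Hs1 : Rabs s < delta) by (eapply Rlt_le_trans; [exact Hs|apply Rmin_l]).
    assert (Hs2 : Rabs s < eps / (Rabs A + 1)) by (eapply Rlt_le_trans; [exact Hs|apply Rmin_r]).
    replace ((f (t + s) - f t) / s - l) with ((f (t + s) - f t - s * l) / s) by (field; auto).
    unfold Rdiv. rewrite Rabs_mult, Rabs_inv.
    assert (P : 0 < Rabs s) by (apply Rabs_pos_lt; auto).
    apply (Rmult_lt_reg_r (Rabs s)); auto. rewrite Rmult_assoc, Rinv_l, Rmult_1_r by lra.
    eapply Rle_lt_trans; [apply Hf; auto|].
    rewrite <- (pow2_abs s).
    apply (Rmult_lt_compat_r (Rabs A + 1)) in Hs2; [|lra].
    unfold Rdiv in Hs2. rewrite Rmult_assoc, Rinv_l, Rmult_1_r in Hs2 by lra.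
    assert (A * Rabs s ^ 2 <= Rabs A * Rabs s ^ 2).
    { apply Rmult_le_compat_r; [apply pow2_ge_0|apply Rle_abs]. }
    nra. }
  split; apply K; intros s Hs; eapply Rle_trans; try apply (H s Hs).
  - replace (Re (F (t + s)) - Re (F t) - s * Re L) with (Re (F (t + s)%R - F t - RtoC s * L)%C)
      by (unfold Re; simpl; ring). apply re_le_Cmod.
  - replace (Im (F (t + s)) - Im (F t) - s * Im L) with (Im (F (t + s)%R - F t - RtoC s * L)%C)
      by (unfold Im; simpl; ring). apply im_le_Cmod.
Qed.

(* The logarithm on the half-plane 0 < Re z, in a form differentiable by inspection. *)
Definition Lg (z : C) : C := (ln (Re z ^ 2 + Im z ^ 2) / 2, atan (Im z / Re z)).

Lemma Cder_Lg (z d : C) (t : R) : 0 < Re (z + RtoC t * d)%C ->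
  Cder (fun t => Lg (z + RtoC t * d)%C) t (d / (z + RtoC t * d))%C.
Proof.
  intros H.
  assert (Hx : 0 < fst z + (t * fst d - 0 * snd d)) by exact H.
  assert (HN : 0 < (fst z + (t * fst d - 0 * snd d)) ^ 2 + (snd z + (t * snd d + 0 * fst d)) ^ 2).
  { generalize (pow2_ge_0 (snd z + (t * snd d + 0 * fst d))). nra. }
  split; unfold Lg, Re, Im; simpl.
  - auto_derive.
    + nra.
    + field. nra.
  - auto_derive.
    + lra.
    + field. split; [nra|]. lra.
Qed.

Lemma Cder_zero_const (F : R -> C) (a b : R) : a < b ->
  (forall t, a <= t <= b -> Cder F t 0) -> F a = F b.
Proof.
  intros Hab H. apply C_eq.
  - apply (eq_is_derive (V := R_NormedModule) (fun t => Re (F t))); auto. intros t Ht. apply H; auto.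
  - apply (eq_is_derive (V := R_NormedModule) (fun t => Im (F t))); auto. intros t Ht. apply H; auto.
Qed.

(** In place of rotating a contour: on the segment from 1 to z, which stays in the half-plane,
    Lint(w, p) e^(w Lg(p)) has derivative zero by [Lint_rec], and at p = 1 it equals Gamma(w). *)
Lemma Lint_Gamma (w z : C) : 0 < Re w -> 0 < Re z -> Lint w z = (Gamma w * Cexp (- (w * Lg z)))%C.
Proof.
  intros Hw Hz.
  set (d := (z - 1)%C). set (p := fun t => (1 + RtoC t * d)%C).
  assert (Hp : forall t, 0 <= t <= 1 -> 0 < Re (p t)).
  { intros t Ht. unfold p, d. replace (Re (1 + RtoC t * (z - 1))%C) with ((1 - t) + t * Re z) by (unfold Re; simpl; ring).
    destruct (Req_dec t 0) as [->|]; [lra|]. assert (0 < t * Re z) by (apply Rmult_lt_0_compat; lra). lra. }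
  assert (E : (Lint w (p 0) * Cexp (w * Lg (p 0)) = Lint w (p 1) * Cexp (w * Lg (p 1)))%C).
  { apply (Cder_zero_const (fun t => Lint w (p t) * Cexp (w * Lg (p t)))%C 0 1); [lra|].
    intros t Ht. specialize (Hp t Ht).
    assert (D1 : Cder (fun t => Lint w (p t)) t (- d * Lint (w + 1) (p t))%C).
    { destruct (Lint_quadratic w (p t) Hw Hp) as [A HA].
      assert (Ccont_pos := Cmod_ge_0 d).
      apply (Cder_of_quadratic _ _ _ (A * Cmod d ^ 2) (Re (p t) / 2 / (Cmod d + 1))).
      - apply Rdiv_lt_0_compat; lra.
      - intros s Hs. replace (p (t + s)) with (p t + RtoC s * d)%C by (unfold p; rewrite RtoC_plus; ring).
        replace (RtoC s * (- d * Lint (w + 1) (p t)))%C with ((RtoC s * d) * - Lint (w + 1) (p t))%C by ring.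
        replace (A * Cmod d ^ 2 * s ^ 2) with (A * Cmod (RtoC s * d) ^ 2).
        + apply HA. rewrite Cmod_mult, Cmod_R.
          apply (Rmult_lt_compat_r (Cmod d + 1)) in Hs; [|lra].
          unfold Rdiv in Hs at 1. rewrite Rmult_assoc, Rinv_l, Rmult_1_r in Hs by lra.
          assert (0 <= Rabs s) by apply Rabs_pos. nra.
        + rewrite Cmod_mult, Cmod_R, Rpow_mult_distr, pow2_abs. ring. }
    assert (D2 : Cder (fun t => Cexp (w * Lg (p t))) t (w * (d / p t) * Cexp (w * Lg (p t)))%C).
    { apply (Cder_Cexp (fun t => w * Lg (p t))%C). apply Cder_scal. apply Cder_Lg. exact Hp. }
    eapply Cder_eq; [apply (Cder_mult _ _ _ _ _ D1 D2)|]. cbv beta.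
    assert (Hn : p t <> 0). { intros E. rewrite E in Hp. simpl in Hp. lra. }
    assert (R0 := Lint_rec w (p t) Hw Hp).
    replace (- d * Lint (w + 1) (p t) * Cexp (w * Lg (p t)) + Lint w (p t) * (w * (d / p t) * Cexp (w * Lg (p t))))%C
      with ((w * Lint w (p t) - p t * Lint (w + 1) (p t)) * (d / p t * Cexp (w * Lg (p t))))%C by (field; auto).
    rewrite R0. ring. }
  assert (P0 : p 0 = 1%C) by (unfold p; ring).
  assert (P1 : p 1 = z) by (unfold p, d; ring).
  rewrite P0, P1 in E.
  assert (L1 : Lg 1 = 0%C).
  { unfold Lg. simpl. replace (1 * (1 * 1) + 0 * (0 * 1)) with 1 by ring. rewrite ln_1.
    replace (0 / 1) with 0 by field. rewrite atan_0. apply C_eq; simpl; lra. }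
  rewrite L1, Cmult_0_r, Cexp_0, Cmult_1_r in E.
  rewrite Gamma_Lint, E, <- Cmult_assoc, <- Cexp_plus; auto.
  replace (w * Lg z + - (w * Lg z))%C with (RtoC 0) by ring. rewrite Cexp_0. ring.
Qed.

Lemma choice_C (P : nat -> C -> Prop) :
  (forall k, exists l, P k l) -> exists I, forall k, P k (I k).
Proof.
  intros H. exists (fun k => proj1_sig (constructive_indefinite_description _ (H k))).
  intros k. apply (proj2_sig (constructive_indefinite_description _ (H k))).
Qed.

(** Euler's integral is expanded by inserting the Taylor series of x^(w-1) about [w0]. One multiple
    of [Wt] dominates the factor x^rho, a second one the factor x^(-rho). *)
Lemma Gamma_ps (w0 : C) : 0 < Re w0 -> exists a rho, ps a w0 rho Gamma.
Proof.
  (* With this radius the lower exponent p - rho = Re w0 / 2 - 1 stays above -1, so both majorants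
     are integrable at 0. *)
  intros Hw. set (rho := Re w0 / 2).
  assert (Hr : 0 < rho) by (unfold rho; lra).
  set (p := Re w0 - 1).
  destruct (Wt_dominates (p + rho) 1 ltac:(unfold p; lra) ltac:(lra)) as [K1 [HK1 H1]].
  destruct (Wt_dominates (p + - rho) 1 ltac:(unfold p, rho; lra) ltac:(lra)) as [K2 [HK2 H2]].
  set (M := fun x => K1 * Wt (p + rho) x + K2 * Wt (p + - rho) x).
  set (m := K1 * / (p + rho + 1) + K2 * / (p + - rho + 1)).
  assert (HM : rgen M (at_right 0) (Rbar_locally p_infty) m).
  { apply rgen_plus; try typeclasses eauto; apply rgen_scal; try typeclasses eauto; apply rgen_Wt; unfold p, rho; lra. }
  assert (HMc : forall x, 0 < x -> continuous M x).
  { intros x Hx. apply (continuous_plus (V := R_NormedModule) (fun x => K1 * Wt (p + rho) x) (fun x => K2 * Wt (p + - rho) x));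
    apply (continuous_mult (K := R_AbsRing) (fun _ => _) (Wt _)); try apply continuous_const; apply continuous_Wt; auto. }
  set (A := fun k x => (pcoef (w0 - 1) k x * RtoC (exp (- x)))%C).
  assert (HA : forall k x, 0 < x -> Cmod (A k x) * rho ^ k <= M x).
  { intros k x Hx. unfold A. rewrite Cmod_mult, Cmod_R, Rabs_pos_eq by (left; apply exp_pos).
    assert (Q := Cmod_pcoef (w0 - 1) k x rho Hx ltac:(lra)).
    assert (Q2 := exp_rho_ln rho x).
    change (Re (w0 - 1)%C) with p in Q.
    specialize (H1 x Hx). specialize (H2 x Hx). rewrite Rmult_1_l in H1, H2.
    rewrite Rpower_plus in H1, H2.
    assert (P1 := Rpower_pos x p). assert (P2 := exp_pos (- x)).
    apply Rle_trans with (Rpower x p * (Rpower x rho + Rpower x (- rho)) * exp (- x)).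
    - replace (Cmod (pcoef (w0 - 1) k x) * exp (- x) * rho ^ k) with (Cmod (pcoef (w0 - 1) k x) * rho ^ k * exp (- x)) by ring.
      apply Rmult_le_compat_r; [lra|]. eapply Rle_trans; [exact Q|]. apply Rmult_le_compat_l; lra.
    - unfold M. lra. }
  assert (HAc : forall k x, 0 < x -> Ccont (A k) x).
  { intros k x Hx. unfold A. apply Ccont_mult; [apply Ccont_pcoef; auto|]. apply Ccont_RtoC.
    apply (continuous_comp (fun x => - x) exp). apply (continuous_opp (V := R_NormedModule) (fun x => x)); apply continuous_id.
    eapply continuous_of_ex_derive. apply is_derive_exp. }
  assert (HI : exists I, forall k, igen (A k) (at_right 0) (Rbar_locally p_infty) (I k)).
  { apply (choice_C (fun k l => igen (A k) (at_right 0) (Rbar_locally p_infty) l)).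
    intros k. assert (Pr : 0 < rho ^ k) by (apply pow_lt; auto).
    apply (igen_dominated (at_right 0) (Rbar_locally p_infty) (fun x => 0 < x) _ (fun x => / rho ^ k * M x) (/ rho ^ k * m)); auto.
    - apply dom_0_infty.
    - intros x Hx. apply (continuous_mult (K := R_AbsRing) (fun _ => _) M); auto; apply continuous_const.
    - intros x Hx. apply (Rmult_le_reg_l (rho ^ k)); auto. rewrite <- Rmult_assoc, Rinv_r by lra. specialize (HA k x Hx). lra.
    - apply rgen_scal; auto; typeclasses eauto. }
  destruct HI as [I HI].
  exists I, rho. split; auto. split.
  - exists m. intros k. assert (Pr : 0 < rho ^ k) by (apply pow_lt; auto).
    rewrite Rmult_comm. rewrite <- (Rabs_pos_eq (rho ^ k)), <- Cmod_R, <- Cmod_mult by lra.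
    refine (igen_norm (at_right 0) (Rbar_locally p_infty) (fun x => 0 < x) _ M _ _ dom_0_infty _ (igen_scal (at_right 0) (Rbar_locally p_infty) (RtoC (rho ^ k)) _ _ (HI k)) HM).
    intros x Hx. rewrite Cmod_mult, Cmod_R, Rabs_pos_eq by lra. specialize (HA k x Hx). lra.
  - intros h Hh.
    assert (Hwh : 0 < Re (w0 + h)%C).
    { assert (Q := re_le_Cmod h). assert (Q2 : Rabs (Re h) < rho) by lra. apply Rabs_def2 in Q2.
      unfold rho in *. simpl. unfold Re in *. lra. }
    rewrite Gamma_Lint; auto.
    destruct (igen_series (at_right 0) (Rbar_locally p_infty) (fun x => 0 < x) A (Lk (w0 + h) 1) I M m rho h) as [L [HL1 HL2]]; auto.
    + apply dom_0_infty.
    + intros x Hx. apply Ccont_Lk; auto.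
    + intros x Hx. apply (cser_ext (fun k => RtoC (exp (- x)) * (pcoef (w0 - 1) k x * h ^ k))%C).
      { intros k. unfold A. ring. }
      unfold Lk. replace (- (1 * RtoC x))%C with (RtoC (- x)) by (rewrite RtoC_opp; ring). rewrite Cexp_RtoC, Cmult_comm.
      apply cser_scal. replace (w0 + h - 1)%C with (w0 - 1 + h)%C by ring. apply cpw_series.
    + rewrite (igen_unique (at_right 0) (Rbar_locally p_infty) _ _ _ (Lint_correct (w0 + h) 1 Hwh Rlt_0_1) HL1). auto.
Qed.

(** * Continuation of the Hurwitz zeta function *)

Notation pt a := (at_point (T := R_UniformSpace) a).

(** The integral test in telescoping form. After division it reads 1 + p / (x + 1) <= (1 + 1/x)^p,
    which follows from e^t >= 1 + t and ln(1 + 1/x) >= 1 / (x + 1). *)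
Lemma Rpower_telescope (p x : R) : 0 < p -> 0 < x ->
  p * Rpower (x + 1) (- (p + 1)) <= Rpower x (- p) - Rpower (x + 1) (- p).
Proof.
  intros Hp Hx.
  assert (H1 : Rpower (x + 1) (- (p + 1)) = Rpower (x + 1) (- p) * / (x + 1)).
  { replace (- (p + 1)) with (- p + - (1)) by ring. rewrite Rpower_plus, Rpower_Ropp, (Rpower_Ropp (x + 1) 1), Rpower_1; lra. }
  assert (H2 : Rpower x (- p) = Rpower (x + 1) (- p) * Rpower ((x + 1) / x) p).
  { unfold Rpower. rewrite <- exp_plus. f_equal. unfold Rdiv. rewrite ln_mult, ln_Rinv; try lra. apply Rinv_0_lt_compat; lra. }
  rewrite H1, H2.
  assert (H3 : 1 + p * / (x + 1) <= Rpower ((x + 1) / x) p).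
  { unfold Rpower. eapply Rle_trans; [|apply exp_ineq1_le].
    assert (K := ln_le_sub1 (x / (x + 1)) ltac:(apply Rdiv_lt_0_compat; lra)).
    replace (x / (x + 1)) with (/ ((x + 1) / x)) in K at 1 by (field; lra).
    rewrite ln_Rinv in K by (apply Rdiv_lt_0_compat; lra).
    replace (x / (x + 1) - 1) with (- / (x + 1)) in K by (field; lra).
    assert (p * / (x + 1) <= p * ln ((x + 1) / x)) by (apply Rmult_le_compat_l; lra). lra. }
  assert (P := Rpower_pos (x + 1) (- p)). nra.
Qed.

Lemma ex_series_bounded (u : nat -> R) (B : R) :
  (forall n, 0 <= u n) -> (forall n, sum_n u n <= B) -> ex_series u.
Proof.
  intros H HB. destruct (ex_finite_lim_seq_incr (sum_n u) B) as [l Hl]; auto.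
  - intros n. rewrite sum_Sn. pl. specialize (H (S n)). lra.
  - exists l. exact Hl.
Qed.

Lemma ex_series_hurwitz (sg a : R) : 1 < sg -> 0 < a -> ex_series (fun m => Rpower (INR m + a) (- sg)).
Proof.
  intros Hs Ha. set (p := sg - 1). assert (Hp : 0 < p) by (unfold p; lra).
  apply ex_series_incr_1.
  apply ex_series_bounded with (/ p * Rpower a (- p)).
  - intros n. left; apply Rpower_pos.
  - intros n.
    apply Rle_trans with (/ p * (Rpower a (- p) - Rpower (INR (S n) + a) (- p))).
    + induction n as [|n IH].
      * rewrite sum_O. apply (Rmult_le_reg_l p); auto. rewrite <- Rmult_assoc, Rinv_r, Rmult_1_l by lra.
        assert (T := Rpower_telescope p a Hp Ha). simpl INR. rewrite (Rplus_comm 1 a).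
        replace (- sg) with (- (p + 1)) by (unfold p; ring). exact T.
      * rewrite sum_Sn. pl.
        assert (P0 := pos_INR (S n)).
        assert (T := Rpower_telescope p (INR (S n) + a) Hp ltac:(lra)).
        replace (- (p + 1)) with (- sg) in T by (unfold p; ring).
        replace (INR (S n) + a + 1) with (INR (S (S n)) + a) in T by (rewrite (S_INR (S n)); ring).
        assert (T' : Rpower (INR (S (S n)) + a) (- sg) <= / p * (Rpower (INR (S n) + a) (- p) - Rpower (INR (S (S n)) + a) (- p))).
        { apply (Rmult_le_reg_l p); auto. rewrite <- (Rmult_assoc p (/ p)), Rinv_r, Rmult_1_l by lra. exact T. }
        lra.
    + apply Rmult_le_compat_l; [left; apply Rinv_0_lt_compat; auto|].
      assert (P := Rpower_pos (INR (S n) + a) (- p)). lra.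
Qed.

(** Any positive base point would serve integrands singular only at 0; with 1/2, primitives at a >=
    1/2 involve only [1/2, a], where the Taylor coefficients in s are bounded. *)
Definition prim (f : R -> C) (a : R) : C := RInt (V := C_R_CompleteNormedModule) f (1 / 2) a.

Lemma prim_half (f : R -> C) : prim f (1 / 2) = 0.
Proof. unfold prim. apply (RInt_point (V := C_R_CompleteNormedModule)). Qed.

Definition Ccont_pos (f : R -> C) : Prop := forall x, 0 < x -> Ccont f x.

Lemma ex_RInt_Ccont_pos (f : R -> C) (a b : R) : Ccont_pos f -> 0 < a -> 0 < b ->
  ex_RInt (V := C_R_CompleteNormedModule) f a b.
Proof.
  intros Hf Ha Hb. apply (ex_RInt_continuous (V := C_R_CompleteNormedModule)).
  intros x Hx. apply Ccont_continuous, Hf.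
  assert (0 < Rmin a b) by (apply Rmin_pos; auto). lra.
Qed.

Lemma prim_Cder (f : R -> C) (a : R) : Ccont_pos f -> 0 < a -> Cder (prim f) a (f a).
Proof.
  intros Hf Ha.
  assert (HI : forall b, 0 < b -> is_RInt (V := C_R_NormedModule) f (1 / 2) b (prim f b)).
  { intros b Hb. apply (RInt_correct (V := C_R_CompleteNormedModule)). apply ex_RInt_Ccont_pos; auto; lra. }
  assert (L := locally_pos a Ha).
  destruct (Hf a Ha) as [c1 c2].
  split.
  - apply (is_derive_RInt (V := R_NormedModule) (fun t => Re (f t)) (fun b => Re (prim f b)) (1 / 2)); auto.
    revert L. apply filter_imp. intros b Hb.
    apply (is_RInt_fct_extend_fst (U := R_NormedModule) (V := R_NormedModule) f); auto.
  - apply (is_derive_RInt (V := R_NormedModule) (fun t => Im (f t)) (fun b => Im (prim f b)) (1 / 2)); auto.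
    revert L. apply filter_imp. intros b Hb.
    apply (is_RInt_fct_extend_snd (U := R_NormedModule) (V := R_NormedModule) f); auto.
Qed.

Lemma Ccont_pos_prim (f : R -> C) : Ccont_pos f -> Ccont_pos (prim f).
Proof. intros Hf x Hx. eapply Cder_cont. apply prim_Cder; auto. Qed.

Lemma igen_points_ftc (F f : R -> C) (a b : R) : a <= b ->
  (forall x, a <= x <= b -> Cder F x (f x)) -> (forall x, a <= x <= b -> Ccont f x) ->
  igen f (pt a) (pt b) (F b - F a)%C.
Proof.
  intros Hab H1 H2. apply (igen_ftc _ _ F f (fun x => a <= x <= b)); auto.
  - apply dom_points; auto.
  - apply Clim_point.
  - apply Clim_point.
Qed.

Lemma prim_ftc (f F : R -> C) (a b : R) : Ccont_pos f -> 0 < a -> 0 < b ->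
  (forall x, 0 < x -> Cder F x (f x)) -> (prim f b - prim f a = F b - F a)%C.
Proof.
  intros Hf Ha Hb HF.
  assert (W : forall a b, 0 < a -> a < b -> (prim f b - prim f a = F b - F a)%C).
  { clear a b Ha Hb. intros a b Ha Hab.
    apply (igen_unique (pt a) (pt b) f); apply igen_points_ftc; try lra; intros x Hx.
    - apply prim_Cder; auto; lra.
    - apply Hf; lra.
    - apply HF; lra.
    - apply Hf; lra. }
  destruct (Rtotal_order a b) as [H|[->|H]].
  - apply W; auto.
  - ring.
  - replace (prim f b - prim f a)%C with (- (prim f a - prim f b))%C by ring.
    rewrite (W b a); auto. ring.
Qed.

Lemma igen_prim (f : R -> C) (a b : R) : Ccont_pos f -> 0 < a <= b -> igen f (pt a) (pt b) (prim f b - prim f a)%C.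
Proof.
  intros Hf Hab. apply igen_points_ftc; try lra; intros x Hx.
  - apply prim_Cder; auto; lra.
  - apply Hf; lra.
Qed.

Lemma Cder_shift (F : R -> C) (a u : R) (l : C) : Cder F (a + u) l -> Cder (fun t => F (a + t)) u l.
Proof.
  intros H. eapply Cder_eq; [apply (Cder_comp F (fun t => a + t) u l 1); auto|].
  - auto_derive; auto.
  - ring.
Qed.

Lemma Ccont_shift (F : R -> C) (a u : R) : Ccont F (a + u) -> Ccont (fun t => F (a + t)) u.
Proof.
  intros H. apply (Ccont_comp F (fun t => a + t)); auto.
  apply (continuous_plus (V := R_NormedModule) (fun _ => a) (fun t => t)); [apply continuous_const|apply continuous_id].
Qed.

Lemma igen_prim_shift (f : R -> C) (a : R) : Ccont_pos f -> 0 < a ->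
  igen (fun u => f (a + u)) (pt 0) (pt 1) (prim f (a + 1) - prim f a)%C.
Proof.
  intros Hf Ha. replace (prim f a) with (prim f (a + 0)) by (f_equal; ring).
  apply (igen_points_ftc (fun u => prim f (a + u))); try lra; intros x Hx.
  - apply Cder_shift, prim_Cder; auto; lra.
  - apply Ccont_shift, Hf; lra.
Qed.

(** Integration by parts brings int_0^1 (1 - u) y(a + u) du to this form, see [igen_Kw]. It can be
    differentiated in a by the fundamental theorem alone, without differentiating under the integral
    sign. *)
Definition Kw (y : R -> C) (a : R) : C := (prim (prim y) (a + 1) - prim y a - prim (prim y) a)%C.

Lemma igen_Kw (y : R -> C) (a : R) : Ccont_pos y -> 0 < a ->
  igen (fun u => (RtoC (1 - u) * y (a + u)%R)%C) (pt 0) (pt 1) (Kw y a).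
Proof.
  intros Hy Ha.
  set (F := fun u => (RtoC (1 - u) * prim y (a + u)%R + prim (prim y) (a + u))%C).
  replace (Kw y a) with (F 1 - F 0)%C.
  - apply igen_points_ftc; try lra; intros u Hu; unfold F.
    + eapply Cder_eq.
      * apply Cder_plus; [apply Cder_mult|].
        -- apply Cder_one_sub.
        -- apply Cder_shift, prim_Cder; auto; lra.
        -- apply Cder_shift, prim_Cder; [apply Ccont_pos_prim; auto|lra].
      * cbv beta. ring.
    + apply Ccont_mult; [|apply Ccont_shift, Hy; lra].
      apply Ccont_one_sub.
  - unfold F, Kw. rewrite !Rplus_0_r. replace (1 - 1) with 0 by ring. rewrite Rminus_0_r. ring.
Qed.

Lemma Kw_Cder (y : R -> C) (a : R) : Ccont_pos y -> 0 < a ->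
  Cder (Kw y) a (- y a + (prim y (a + 1) - prim y a))%C.
Proof.
  intros Hy Ha. unfold Kw. eapply Cder_eq.
  - apply Cder_minus; [apply Cder_minus|].
    + apply (Cder_ext (fun t => prim (prim y) (1 + t))). intros t; f_equal; ring.
      apply Cder_shift, prim_Cder; [apply Ccont_pos_prim; auto|lra].
    + apply prim_Cder; auto.
    + apply prim_Cder; [apply Ccont_pos_prim; auto|auto].
  - replace (1 + a) with (a + 1) by ring. ring.
Qed.

Lemma Ccont_pos_Kw (y : R -> C) : Ccont_pos y -> Ccont_pos (Kw y).
Proof. intros Hy x Hx. eapply Cder_cont. apply Kw_Cder; auto. Qed.

Lemma Ccont_pos_cpw (s : C) : Ccont_pos (fun x => cpw x s).
Proof. intros x Hx. apply Ccont_cpw; auto. Qed.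

Lemma Kw_scal (c : C) (y : R -> C) (a : R) : Ccont_pos y -> 0 < a -> Kw (fun x => c * y x)%C a = (c * Kw y a)%C.
Proof.
  intros Hy Ha.
  apply (igen_unique (pt 0) (pt 1) (fun u => RtoC (1 - u) * (c * y (a + u)%R))%C).
  - apply (igen_Kw (fun x => c * y x)%C); auto. intros x Hx. apply Ccont_mult; [apply Ccont_const|auto].
  - apply (igen_ext_all (pt 0) (pt 1) (fun u => c * (RtoC (1 - u) * y (a + u)%R))%C). intros; ring.
    apply igen_scal; try typeclasses eauto. apply igen_Kw; auto.
Qed.

Lemma Kw_plus (y z : R -> C) (a : R) : Ccont_pos y -> Ccont_pos z -> 0 < a ->
  Kw (fun x => y x + z x)%C a = (Kw y a + Kw z a)%C.
Proof.
  intros Hy Hz Ha.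
  apply (igen_unique (pt 0) (pt 1) (fun u => RtoC (1 - u) * (y (a + u)%R + z (a + u)%R))%C).
  - apply (igen_Kw (fun x => y x + z x)%C); auto. intros x Hx. apply Ccont_plus; auto.
  - apply (igen_ext_all (pt 0) (pt 1) (fun u => RtoC (1 - u) * y (a + u)%R + RtoC (1 - u) * z (a + u)%R)%C). intros; ring.
    apply igen_plus; try typeclasses eauto; apply igen_Kw; auto.
Qed.

Lemma igen_one (c : C) : igen (fun _ => c) (pt 0) (pt 1) c.
Proof.
  eapply igen_eq.
  - apply (igen_points_ftc (fun u => RtoC u * c)%C (fun _ => c)); [lra| |].
    + intros x _. apply Cder_tz.
    + intros x _. apply Ccont_const.
  - ring.
Qed.

Lemma rgen_one : rgen (fun _ => 1) (pt 0) (pt 1) 1.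
Proof. apply (igen_Re (fun _ => 1%C) (pt 0) (pt 1) 1%C); try typeclasses eauto. apply igen_one. Qed.

Lemma Kw_const (c : C) (a : R) : 0 < a -> Kw (fun _ => c) a = (c / 2)%C.
Proof.
  intros Ha.
  apply (igen_unique (pt 0) (pt 1) (fun u => RtoC (1 - u) * c)%C).
  - apply (igen_Kw (fun _ => c)); auto. intros x _; apply Ccont_const.
  - eapply igen_eq.
    + apply (igen_points_ftc (fun u => RtoC (u - u ^ 2 / 2) * c)%C); [lra| |].
      * intros x _. eapply Cder_eq; [apply Cder_mult; [|apply Cder_const]|].
        -- apply (Cder_RtoC _ _ (1 - x)). auto_derive; auto; field.
        -- cbv beta. ring.
      * intros x _. apply Ccont_mult; [|apply Ccont_const].
        apply Ccont_one_sub.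
    + cbv beta. replace (1 - 1 ^ 2 / 2) with (/ 2) by field. replace (0 - 0 ^ 2 / 2) with 0 by field.
      rewrite RtoC_inv by lra. unfold Cdiv. ring.
Qed.

(** Kept as the integral of x^(-s) from 1 to a, since the closed form (a^(1-s) - 1) / (1 - s) breaks
    down at s = 1; [Epw_mult] is the closed form cleared of its denominator. *)
Definition Epw (s : C) (a : R) : C := (prim (fun x => cpw x (- s)) a - prim (fun x => cpw x (- s)) 1)%C.

Lemma Epw_Cder (s : C) (a : R) : 0 < a -> Cder (Epw s) a (cpw a (- s)).
Proof.
  intros Ha. unfold Epw. eapply Cder_eq.
  - apply Cder_minus; [apply prim_Cder; [apply Ccont_pos_cpw|auto]|apply Cder_const].
  - ring.
Qed.

Lemma Epw_mult (s : C) (a : R) : 0 < a -> ((1 - s) * Epw s a = cpw a (1 - s) - 1)%C.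
Proof.
  intros Ha.
  assert (HCf : Ccont_pos (fun x => (1 - s) * cpw x (- s))%C).
  { intros x Hx; apply Ccont_mult; [apply Ccont_const|apply Ccont_cpw; auto]. }
  assert (E := prim_ftc (fun x => cpw x (- s)) (fun x => Epw s x) 1 a (Ccont_pos_cpw _) ltac:(lra) Ha (fun x Hx => Epw_Cder s x Hx)).
  assert (E2 := prim_ftc _ (fun x => (1 - s) * Epw s x)%C 1 a HCf ltac:(lra) Ha).
  assert (E3 := prim_ftc _ (fun x => cpw x (1 - s)) 1 a HCf ltac:(lra) Ha).
  rewrite E2 in E3.
  - cbv beta in E3. rewrite cpw_one in E3.
    replace (Epw s 1) with (RtoC 0) in E3 by (unfold Epw; ring).
    rewrite <- E3; [ring|]. intros x Hx. eapply Cder_eq; [apply Cder_cpw; auto|]. f_equal. f_equal. ring.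
  - intros x Hx. apply Cder_scal, Epw_Cder; auto.
Qed.

Opaque prim Kw.

Lemma Rpower_neg_le (p x y : R) : 0 <= p -> 0 < x <= y -> Rpower y (- p) <= Rpower x (- p).
Proof.
  intros Hp H. rewrite !Rpower_Ropp. apply Rinv_le_contravar; [apply Rpower_pos|].
  apply Rpower_base_le; auto.
Qed.

Lemma is_lim_seq_Rpower_neg (p a : R) : 0 < p -> 0 < a -> is_lim_seq (fun m => Rpower (INR m + a) (- p)) 0.
Proof.
  intros Hp Ha. apply is_lim_seq_spec. intros eps.
  destruct (Rpower_small p eps Hp (cond_pos eps)) as [d [Hd H]].
  destruct (INR_unbounded (/ d)) as [N HN].
  exists N. intros n Hn. rewrite Rminus_0_r, Rabs_pos_eq by (left; apply Rpower_pos).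
  apply le_INR in Hn. assert (Hid : 0 < / d) by (apply Rinv_0_lt_compat; auto).
  replace (Rpower (INR n + a) (- p)) with (Rpower (/ (INR n + a)) p).
  - apply H. split; [apply Rinv_0_lt_compat; lra|].
    rewrite <- (Rinv_inv d). apply Rinv_lt_contravar; [apply Rmult_lt_0_compat; lra|lra].
  - unfold Rpower. rewrite ln_Rinv by lra. f_equal. ring.
Qed.

Lemma cser_telescope (g : nat -> C) (e : nat -> R) :
  (forall m, Cmod (g m) <= e m) -> is_lim_seq e 0 -> cser (fun m => (g m - g (S m))%C) (g O).
Proof.
  intros H He. apply (cser_of_csum _ _ e); auto. intros N.
  replace (g O - csum (fun m => g m - g (S m))%C N)%C with (g N); auto.
  induction N as [|N IH]; simpl; [ring|].
  replace (g O - (csum (fun m => g m - g (S m))%C N + (g N - g (S N))))%C with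
    ((g O - csum (fun m => g m - g (S m))%C N) - g N + g (S N))%C by ring.
  rewrite <- IH. ring.
Qed.

Lemma INR_add_pos (m : nat) (a : R) : 0 < a -> 0 < INR m + a.
Proof. generalize (pos_INR m). lra. Qed.

(** * The series in the half-plane Re s > 1 *)

Definition hz (s : C) (m : nat) (a : R) : C := cpw (INR m + a) (- s).

Definition Sf (s : C) (a : R) : C :=
  (Series (fun m => Re (hz s m a)), Series (fun m => Im (hz s m a))).

Lemma Re_opp (s : C) : Re (- s)%C = - Re s.
Proof. reflexivity. Qed.

Lemma hz_bound (s : C) (m : nat) (a b : R) : 0 <= Re s -> 0 < a <= b -> Cmod (hz s m b) <= Rpower (INR m + a) (- Re s).
Proof.
  intros Hs H. unfold hz. assert (P := pos_INR m).
  rewrite Cmod_cpw, Re_opp by lra. apply Rpower_neg_le; lra.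
Qed.

Lemma Sf_correct (s : C) (a : R) : 1 < Re s -> 0 < a -> cser (fun m => hz s m a) (Sf s a).
Proof.
  intros Hs Ha.
  destruct (cser_ex (fun m => hz s m a) (fun m => Rpower (INR m + a) (- Re s))) as [l [H1 H2]].
  - intros n. apply hz_bound; lra.
  - apply ex_series_hurwitz; auto.
  - unfold Sf. split; simpl; apply Series_correct; eexists; eauto.
Qed.

Lemma Ccont_pos_hz (s : C) (m : nat) : Ccont_pos (hz s m).
Proof.
  intros x Hx. unfold hz. apply (Ccont_shift (fun y => cpw y (- s))). apply Ccont_cpw.
  apply INR_add_pos; auto.
Qed.

Lemma Ccont_pos_Sf (s : C) : 1 < Re s -> Ccont_pos (Sf s).
Proof.
  intros Hs x Hx.
  apply (Ccont_Mtest (fun m => hz s m) _ (fun m => Rpower (INR m + x / 2) (- Re s))).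
  - apply ex_series_hurwitz; lra.
  - intros m. apply Ccont_pos_hz; auto.
  - generalize (locally_half x Hx). apply filter_imp. intros y Hy. split.
    + intros m. apply hz_bound; lra.
    + apply Sf_correct; lra.
Qed.

Lemma Cder_hz (s : C) (m : nat) (a : R) : 0 < a -> Cder (hz s m) a (- s * hz (s + 1) m a)%C.
Proof.
  intros Ha. unfold hz. eapply Cder_eq.
  - apply (Cder_shift (fun y => cpw y (- s))). apply Cder_cpw. apply INR_add_pos; auto.
  - replace (- (s + 1))%C with (- s - 1)%C by ring. reflexivity.
Qed.

Lemma hz_shift (s : C) (m : nat) (a : R) : hz s m (a + 1) = hz s (S m) a.
Proof. unfold hz. rewrite S_INR. f_equal. ring. Qed.

Lemma cser_hz_telescope (s : C) (a : R) : 1 < Re s -> 0 < a ->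
  cser (fun m => (hz (s - 1) m a - hz (s - 1) (S m) a) / (s - 1))%C (cpw a (1 - s) / (s - 1))%C.
Proof.
  intros Hs Ha.
  apply (cser_ext (fun m => / (s - 1) * (hz (s - 1) m a - hz (s - 1) (S m) a))%C). { intros; unfold Cdiv; ring. }
  apply (cser_eq _ (/ (s - 1) * hz (s - 1) 0 a)%C).
  - apply cser_scal. apply (cser_telescope (fun m => hz (s - 1) m a) (fun m => Rpower (INR m + a) (- (Re s - 1)))).
    + intros m. apply (hz_bound (s - 1)%C m a a); [simpl; unfold Re in *; lra|lra].
    + apply is_lim_seq_Rpower_neg; lra.
  - unfold hz. simpl INR. rewrite Rplus_0_l. replace (- (s - 1))%C with (1 - s)%C by ring. unfold Cdiv; ring.
Qed.

Lemma C_neq_Re (s : C) (x : R) : Re s <> x -> (s - RtoC x)%C <> 0.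
Proof.
  intros H E. apply H. replace s with (s - RtoC x + RtoC x)%C by ring. rewrite E. simpl; ring.
Qed.

(** The m-th term integrates over a unit interval to a difference of x^(1-s) / (1-s) between m + a
    and m + a + 1, and the sum telescopes. *)
Lemma Sf_mean (s : C) (a : R) : 1 < Re s -> 0 < a ->
  (prim (Sf s) (a + 1) - prim (Sf s) a = cpw a (1 - s) / (s - 1))%C.
Proof.
  intros Hs Ha. assert (Hn : (s - 1)%C <> 0) by (apply C_neq_Re; lra).
  destruct (igen_Mtest (pt 0) (pt 1) (fun u => 0 <= u <= 1) (fun m u => hz s m (a + u)) (fun u => Sf s (a + u))
    (fun m => (hz (s - 1) m a - hz (s - 1) (S m) a) / (s - 1))%C (fun _ => 1) 1 (fun m => Rpower (INR m + a) (- Re s)))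
    as [L [HL1 HL2]].
  - apply dom_points; auto; lra.
  - intros; apply continuous_const.
  - apply rgen_one.
  - intros m u Hu. rewrite Rmult_1_r. apply hz_bound; lra.
  - apply ex_series_hurwitz; auto.
  - intros u Hu. apply Ccont_shift, Ccont_pos_Sf; auto; lra.
  - intros u Hu. apply Sf_correct; auto; lra.
  - intros m.
    replace ((hz (s - 1) m a - hz (s - 1) (S m) a) / (s - 1))%C with
      (- / (s - 1) * hz (s - 1) m (a + 1) - - / (s - 1) * hz (s - 1) m (a + 0))%C.
    + apply (igen_points_ftc (fun u => - / (s - 1) * hz (s - 1) m (a + u))%C); [lra| |]; intros u Hu.
      * eapply Cder_eq; [apply Cder_scal, Cder_shift, Cder_hz; lra|].
        replace (s - 1 + 1)%C with s by ring. field; auto.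
      * apply Ccont_shift, Ccont_pos_hz; lra.
    + rewrite hz_shift, Rplus_0_r. unfold Cdiv. ring.
  - rewrite (cser_unique _ _ _ (cser_hz_telescope s a Hs Ha) HL2).
    apply (igen_unique (pt 0) (pt 1) (fun u => Sf s (a + u))); auto.
    apply igen_prim_shift; auto. apply Ccont_pos_Sf; auto.
Qed.

(** Euler-Maclaurin term by term: integration by parts turns s int_0^1 (1 - u) (m + a + u)^(-s-1) du
    into (m + a)^(-s) minus the integral of (m + a + u)^(-s), and these integrals telescope. *)
Lemma Sf_Kw (s : C) (a : R) : 1 < Re s -> 0 < a ->
  (s * Kw (Sf (s + 1)) a = Sf s a - cpw a (1 - s) / (s - 1))%C.
Proof.
  intros Hs Ha. assert (Hn : (s - 1)%C <> 0) by (apply C_neq_Re; lra).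
  assert (Hs1 : 1 < Re (s + 1)%C) by (simpl; unfold Re in *; lra).
  set (I := fun m => (hz s m a - (hz (s - 1) m a - hz (s - 1) (S m) a) / (s - 1))%C).
  destruct (igen_Mtest (pt 0) (pt 1) (fun u => 0 <= u <= 1) (fun m u => s * (RtoC (1 - u) * hz (s + 1) m (a + u)))%C
    (fun u => s * (RtoC (1 - u) * Sf (s + 1) (a + u)))%C I
    (fun _ => 1) 1 (fun m => Cmod s * Rpower (INR m + a) (- Re (s + 1)%C))) as [L [HL1 HL2]].
  - apply dom_points; auto; lra.
  - intros; apply continuous_const.
  - apply rgen_one.
  - intros m u Hu. rewrite Rmult_1_r, !Cmod_mult, Cmod_R, Rabs_pos_eq by lra.
    apply Rmult_le_compat_l; [apply Cmod_ge_0|].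
    apply Rle_trans with (1 * Cmod (hz (s + 1) m (a + u))).
    + apply Rmult_le_compat_r; [apply Cmod_ge_0|lra].
    + rewrite Rmult_1_l. apply hz_bound; lra.
  - apply (ex_series_scal (K := R_AbsRing) (V := R_NormedModule)). apply ex_series_hurwitz; auto.
  - intros u Hu. apply Ccont_mult; [apply Ccont_const|]. apply Ccont_mult.
    + apply Ccont_one_sub.
    + apply Ccont_shift, Ccont_pos_Sf; auto; lra.
  - intros u Hu. apply cser_scal, cser_scal. apply Sf_correct; auto; lra.
  - intros m.
    set (F := fun u => (/ (s - 1) * hz (s - 1) m (a + u) - RtoC (1 - u) * hz s m (a + u))%C).
    replace (I m) with (F 1 - F 0)%C.
    + apply igen_points_ftc; [lra| |]; intros u Hu; unfold F.
      * eapply Cder_eq.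
        -- apply Cder_minus; [apply Cder_scal, Cder_shift, Cder_hz; lra|].
           apply (Cder_mult (fun u => RtoC (1 - u)) (fun u => hz s m (a + u))).
           ++ apply Cder_one_sub.
           ++ apply Cder_shift, Cder_hz; lra.
        -- cbv beta. replace (s - 1 + 1)%C with s by ring. field; auto.
      * apply Ccont_mult; [apply Ccont_const|]. apply Ccont_mult.
        -- apply Ccont_one_sub.
        -- apply Ccont_shift, Ccont_pos_hz; lra.
    + unfold F, I. rewrite !hz_shift, !Rplus_0_r. replace (1 - 1) with 0 by ring. rewrite Rminus_0_r. unfold Cdiv. ring.
  - assert (E := cser_minus _ _ _ _ (Sf_correct s a Hs Ha) (cser_hz_telescope s a Hs Ha)).
    rewrite (cser_unique _ _ _ E HL2).
    apply (igen_unique (pt 0) (pt 1) (fun u => s * (RtoC (1 - u) * Sf (s + 1) (a + u)))%C); auto.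
    apply igen_scal; try typeclasses eauto. apply igen_Kw; auto. apply Ccont_pos_Sf; auto.
Qed.

(* [Yz s a] is [zeta(s, a) - 1/(s - 1)]. *)
Fixpoint YK (n : nat) (s : C) (a : R) : C :=
  match n with
  | O => (Sf s a - / (s - 1))%C
  | S k => (/ 2 - Epw s a + s * Kw (YK k (s + 1)%C) a)%C
  end.

(** [up x] is the integer in (x, x + 1], so the recursion is unfolded just often enough to reach a
    real part above 1, and not at all when Re s > 1 already. *)
Definition Yz (s : C) (a : R) : C := YK (Z.to_nat (up (1 - Re s))) s a.

Lemma Yz_big (s : C) (a : R) : 1 < Re s -> Yz s a = (Sf s a - / (s - 1))%C.
Proof.
  intros Hs. unfold Yz.
  replace (Z.to_nat (up (1 - Re s))) with O; auto.
  assert (K := archimed (1 - Re s)).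
  assert (up (1 - Re s) < 1)%Z by (apply lt_IZR; lra).
  destruct (up (1 - Re s)); simpl; auto; lia.
Qed.

Lemma Yz_big_fun (s : C) : 1 < Re s -> Yz s = (fun a => Sf s a - / (s - 1))%C.
Proof. intros Hs. apply functional_extensionality. intros a; apply Yz_big; auto. Qed.

(** Descent by unit steps from the half-plane of convergence; the number of steps is any integer
    exceeding 1 - Re s. *)
Lemma C_ind_down (P : C -> Prop) :
  (forall s, 1 < Re s -> P s) -> (forall s, P (s + 1)%C -> P s) -> forall s, P s.
Proof.
  intros H1 H2.
  assert (K : forall n s, 1 < Re s + INR n -> P s).
  { induction n as [|n IH]; intros s Hs.
    - apply H1. simpl in Hs. lra.
    - apply H2, IH. rewrite S_INR in Hs. simpl. unfold Re in *. lra. }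
  intros s. destruct (INR_unbounded (1 - Re s)) as [n Hn]. apply (K n). lra.
Qed.

Lemma Yz_step (s : C) (a : R) : Re s <= 1 -> Yz s a = (/ 2 - Epw s a + s * Kw (Yz (s + 1)%C) a)%C.
Proof.
  intros Hs. unfold Yz at 1.
  assert (K := archimed (1 - Re s)).
  assert (E : up (1 - Re (s + 1)%C) = (up (1 - Re s) - 1)%Z).
  { symmetry. apply tech_up; rewrite minus_IZR; simpl; unfold Re in *; lra. }
  assert (0 < up (1 - Re s))%Z by (apply lt_IZR; lra).
  replace (Z.to_nat (up (1 - Re s))) with (S (Z.to_nat (up (1 - Re (s + 1)%C)))) by (rewrite E; lia).
  reflexivity.
Qed.

Lemma Ccont_pos_Epw (s : C) : Ccont_pos (Epw s).
Proof. intros x Hx. eapply Cder_cont, Epw_Cder; auto. Qed.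

Lemma Ccont_pos_Yz (s : C) : Ccont_pos (Yz s).
Proof.
  assert (B : forall s, 1 < Re s -> Ccont_pos (Yz s)).
  { intros z Hz. rewrite Yz_big_fun; auto. intros x Hx. apply Ccont_minus; [apply Ccont_pos_Sf; auto|apply Ccont_const]. }
  revert s. apply C_ind_down; auto.
  intros s IH. destruct (Rlt_dec 1 (Re s)); auto.
  intros x Hx. apply (Ccont_ext (fun a => / 2 - Epw s a + s * Kw (Yz (s + 1)%C) a)%C).
  { intros t. rewrite Yz_step; auto; lra. }
  apply Ccont_plus; [apply Ccont_minus; [apply Ccont_const|apply Ccont_pos_Epw; auto]|].
  apply Ccont_mult; [apply Ccont_const|]. apply Ccont_pos_Kw; auto.
Qed.

(** For Re s <= 1 this is the definition. For Re s > 1 it is [Sf_Kw]: the 1/s subtracted at s + 1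
    contributes -1/2, which cancels the leading 1/2, and [Epw] replaces a^(1-s) / (s - 1) by 1 / (s
    - 1). Holding for all s, it lets the descent treat both ranges alike. *)
Lemma Yz_rec (s : C) (a : R) : 0 < a -> Yz s a = (/ 2 - Epw s a + s * Kw (Yz (s + 1)%C) a)%C.
Proof.
  intros Ha. destruct (Rle_dec (Re s) 1) as [H|H]; [apply Yz_step; auto|].
  assert (Hs : 1 < Re s) by lra. assert (Hs1 : 1 < Re (s + 1)%C) by (simpl; unfold Re in *; lra).
  rewrite Yz_big, (Yz_big_fun (s + 1)); auto.
  assert (Hn : (s - 1)%C <> 0) by (apply C_neq_Re; lra).
  assert (Hn0 : s <> 0). { intros E; rewrite E in Hs; simpl in Hs; lra. }
  assert (EK : Kw (fun a0 => Sf (s + 1) a0 - / (s + 1 - 1))%C a = (Kw (Sf (s + 1)) a + (- / s) / 2)%C).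
  { transitivity (Kw (fun x => Sf (s + 1) x + - / s)%C a).
    - f_equal. apply functional_extensionality. intros x. replace (s + 1 - 1)%C with s by ring. ring.
    - refine (eq_trans (Kw_plus (Sf (s + 1)) (fun _ => (- / s)%C) a (Ccont_pos_Sf _ Hs1) (fun x _ => Ccont_const _ x) Ha) _).
      apply f_equal. apply Kw_const; auto. }
  rewrite EK, Cmult_plus_distr_l, Sf_Kw; auto.
  assert (E := Epw_mult s a Ha).
    replace (Epw s a) with ((1 - s) * Epw s a / (1 - s))%C.
    + rewrite E. field. repeat split; auto. intros E'. apply Hn.
      replace (s - 1)%C with (- (1 - s))%C by ring. rewrite E'. ring.
      all: try (intros E2; apply RtoC_inj in E2; lra).
    + field. apply Cminus_sym_neq_0; auto.
Qed.

Lemma Epw_shift_mult (s : C) (a : R) : 0 < a -> (s * Epw (s + 1) a = 1 - cpw a (- s))%C.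
Proof.
  intros Ha. assert (E := Epw_mult (s + 1) a Ha).
  replace (1 - (s + 1))%C with (- s)%C in E by ring.
  replace (s * Epw (s + 1) a)%C with (- (- s * Epw (s + 1) a))%C by ring. rewrite E. ring.
Qed.

(** The derivative of [Kw] contains a difference of primitives over a unit interval, so this
    identity at s + 1 is what determines dY/da at s; dY/da at s in turn gives the identity at s,
    which closes the descent. *)
Definition mean_ok (s : C) : Prop := forall a, 0 < a -> (prim (Yz s) (a + 1) - prim (Yz s) a = - Epw s a)%C.

Lemma Yz_der_aux (s : C) (a : R) : mean_ok (s + 1)%C -> 0 < a -> Cder (Yz s) a (- (1) - s * Yz (s + 1) a)%C.
Proof.
  intros HM Ha.
  apply (Cder_ext_loc (fun a => / 2 - Epw s a + s * Kw (Yz (s + 1)%C) a)%C).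
  { generalize (locally_pos a Ha). apply filter_imp. intros t Ht. symmetry. apply Yz_rec; auto. }
  eapply Cder_eq.
  - apply Cder_plus; [apply Cder_minus; [apply Cder_const|apply Epw_Cder; auto]|].
    apply Cder_scal, Kw_Cder; auto. apply Ccont_pos_Yz.
  - rewrite HM; auto.
    replace (s * (- Yz (s + 1) a + - Epw (s + 1) a))%C with (- s * Yz (s + 1) a - s * Epw (s + 1) a)%C by ring.
    rewrite Epw_shift_mult; auto. ring.
Qed.

Lemma Yz_mean (s : C) : mean_ok s.
Proof.
  revert s. apply C_ind_down.
  - intros s Hs a Ha. rewrite Yz_big_fun; auto.
    assert (Hn : (s - 1)%C <> 0) by (apply C_neq_Re; lra).
    apply (igen_unique (pt 0) (pt 1) (fun u => Sf s (a + u) - / (s - 1))%C).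
    + apply (igen_prim_shift (fun x => Sf s x - / (s - 1))%C); auto.
      intros x Hx. apply Ccont_minus; [apply Ccont_pos_Sf; auto|apply Ccont_const].
    + eapply igen_eq.
      * apply igen_minus; try typeclasses eauto; [apply igen_prim_shift; [apply Ccont_pos_Sf; auto|auto]|apply igen_one].
      * rewrite Sf_mean; auto. assert (E := Epw_mult s a Ha).
        assert (Hn2 : (1 - s)%C <> 0). { apply Cminus_sym_neq_0; auto. }
        replace (Epw s a) with ((1 - s) * Epw s a / (1 - s))%C by (field; auto).
        rewrite E. field; auto.
  - intros s IH a Ha.
    assert (D := fun x (Hx : 0 < x) => Yz_der_aux s x IH Hx).
    (* integrate (1 - u) d/du Yz(s, a + u) by parts *)
    assert (E : (Yz s (a + 1)%R * 0 - Yz s a + (prim (Yz s) (a + 1) - prim (Yz s) a) = Kw (fun x => - (1) - s * Yz (s + 1) x) a)%C).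
    { set (G := fun u => (RtoC (1 - u) * Yz s (a + u) + prim (Yz s) (a + u))%C).
      apply (igen_unique (pt 0) (pt 1) (fun u => RtoC (1 - u) * (- (1) - s * Yz (s + 1) (a + u)))%C).
      - replace (Yz s (a + 1)%R * 0 - Yz s a + (prim (Yz s) (a + 1) - prim (Yz s) a))%C with (G 1 - G 0)%C.
        + apply igen_points_ftc; [lra| |]; intros u Hu; unfold G.
          * eapply Cder_eq.
            -- apply Cder_plus; [apply Cder_mult|].
               ++ apply Cder_one_sub.
               ++ apply Cder_shift, D; lra.
               ++ apply Cder_shift, prim_Cder; [apply Ccont_pos_Yz|lra].
            -- cbv beta. ring.
          * apply Ccont_mult.
            -- apply Ccont_one_sub.
            -- apply Ccont_minus; [apply Ccont_const|]. apply Ccont_mult; [apply Ccont_const|].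
               apply Ccont_shift, Ccont_pos_Yz; lra.
        + unfold G. rewrite !Rplus_0_r. replace (1 - 1) with 0 by ring. rewrite Rminus_0_r. ring.
      - apply (igen_Kw (fun x => - (1) - s * Yz (s + 1) x)%C); auto.
        intros x Hx. apply Ccont_minus; [apply Ccont_const|]. apply Ccont_mult; [apply Ccont_const|]. apply Ccont_pos_Yz; auto. }
    assert (E2 : Kw (fun x => - (1) - s * Yz (s + 1) x)%C a = (- (1) / 2 - s * Kw (Yz (s + 1)%C) a)%C).
    { rewrite <- (Kw_const (- (1)) a Ha).
      replace (Kw (fun _ => (- (1))%C) a - s * Kw (Yz (s + 1)%C) a)%C with (Kw (fun _ => (- (1))%C) a + (- s) * Kw (Yz (s + 1)%C) a)%C by ring.
      assert (HCs : Ccont_pos (fun x => (- s) * Yz (s + 1) x)%C).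
      { intros x Hx. apply Ccont_mult; [apply Ccont_const|]. apply Ccont_pos_Yz; auto. }
      transitivity (Kw (fun x => - (1) + (- s) * Yz (s + 1) x)%C a).
      { f_equal. apply functional_extensionality; intros x. ring. }
      refine (eq_trans (Kw_plus (fun _ => (- (1))%C) (fun x => (- s) * Yz (s + 1) x)%C a (fun x _ => Ccont_const _ x) HCs Ha) _).
      apply f_equal. apply (Kw_scal (- s) (Yz (s + 1)) a (Ccont_pos_Yz _) Ha). }
    rewrite E2 in E. assert (R0 := Yz_rec s a Ha).
    replace (prim (Yz s) (a + 1) - prim (Yz s) a)%C with
      ((Yz s (a + 1)%R * 0 - Yz s a + (prim (Yz s) (a + 1) - prim (Yz s) a)) + Yz s a)%C by ring.
    rewrite E, R0. unfold Cdiv. ring.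
Qed.

Lemma Yz_Cder (s : C) (a : R) : 0 < a -> Cder (Yz s) a (- (1) - s * Yz (s + 1) a)%C.
Proof. apply Yz_der_aux, Yz_mean. Qed.

(** Both sides of [Yz_mean] are differentiated in a, and the two derivatives are compared. *)
Lemma Yz_shift (s : C) (a : R) : 0 < a -> Yz s (a + 1) = (Yz s a - cpw a (- s))%C.
Proof.
  intros Ha.
  assert (D1 : Cder (fun a => prim (Yz s) (1 + a) - prim (Yz s) a)%C a (Yz s (1 + a) - Yz s a)%C).
  { apply Cder_minus; [apply Cder_shift|]; apply prim_Cder; try apply Ccont_pos_Yz; lra. }
  assert (D2 : Cder (fun a => prim (Yz s) (1 + a) - prim (Yz s) a)%C a (- cpw a (- s))%C).
  { apply (Cder_ext_loc (fun a => - Epw s a)%C).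
    - generalize (locally_pos a Ha). apply filter_imp. intros t Ht.
      rewrite Rplus_comm. symmetry. apply Yz_mean; auto.
    - apply Cder_opp, Epw_Cder; auto. }
  assert (E : (Yz s (1 + a) - Yz s a = - cpw a (- s))%C).
  { destruct D1 as [a1 a2], D2 as [b1 b2]. apply C_eq.
    - rewrite <- (is_derive_unique _ _ _ a1). apply (is_derive_unique _ _ _ b1).
    - rewrite <- (is_derive_unique _ _ _ a2). apply (is_derive_unique _ _ _ b2). }
  rewrite Rplus_comm. replace (Yz s (1 + a)) with (Yz s (1 + a) - Yz s a + Yz s a)%C by ring. rewrite E. ring.
Qed.

(** * Taylor expansion in s *)

(** Interchange of a double sum: for each m the tail beyond N is at most b_m q^N / (1 - q), and
    summing over m leaves an error that tends to 0 with N. *)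
Lemma cser_swap (c : nat -> nat -> C) (f g : nat -> C) (F : C) (b : nat -> R) (q : R) :
  0 <= q < 1 -> (forall m k, Cmod (c m k) <= b m * q ^ k) -> ex_series b ->
  (forall m, cser (c m) (f m)) -> (forall k, cser (fun m => c m k) (g k)) -> cser f F -> cser g F.
Proof.
  intros Hq Hc [B HB] Hf Hg HF.
  apply (cser_of_csum _ _ (fun N => B * (q ^ N * / (1 - q)))).
  - intros N.
    assert (S1 : cser (fun m => csum (c m) N) (csum g N)).
    { induction N as [|N IH]; simpl; [apply cser_zero|]. apply cser_plus; auto. }
    apply (cser_bound _ _ (fun m => b m * (q ^ N * / (1 - q))) _ (cser_minus _ _ _ _ HF S1)).
    + intros m. apply (cser_bound _ _ (fun k => b m * q ^ N * q ^ k) _ (cser_tail _ _ N (Hf m))).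
      * intros k. rewrite Rmult_assoc, <- pow_add. apply Hc.
      * rewrite <- Rmult_assoc. apply (is_series_scal (K := R_AbsRing) (V := R_NormedModule)), geom_series; auto.
    + apply is_series_scal_r; auto.
  - replace (Finite 0) with (Rbar_mult B (0 * / (1 - q))) by (simpl; f_equal; ring).
    apply is_lim_seq_mult'; [apply is_lim_seq_const|]. apply is_lim_seq_mult'; [|apply is_lim_seq_const].
    apply is_lim_seq_geom. rewrite Rabs_pos_eq; lra.
Qed.

Definition Cseries (a : nat -> C) : C := (Series (fun n => Re (a n)), Series (fun n => Im (a n))).

Lemma Cseries_correct (a : nat -> C) (b : nat -> R) :
  (forall n, Cmod (a n) <= b n) -> ex_series b -> cser a (Cseries a).
Proof.
  intros H Hb. destruct (cser_ex a b H Hb) as [l [H1 H2]].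
  split; simpl; apply Series_correct; eexists; eauto.
Qed.

(** The coefficient of h^k in 1 / (v + h). *)
Definition geo (v : C) (k : nat) : C := (/ v * (- / v) ^ k)%C.

Lemma geo_series (v h : C) : Cmod h < Cmod v -> cser (fun k => geo v k * h ^ k)%C (/ (v + h))%C.
Proof.
  intros H.
  assert (Hv0 : 0 < Cmod v) by (generalize (Cmod_ge_0 h); lra).
  assert (Hv : v <> 0) by (apply Cmod_gt_0; auto).
  assert (Hvh : (v + h)%C <> 0).
  { intros E. assert (E2 : h = (- v)%C) by (replace h with (v + h - v)%C by ring; rewrite E; ring).
    rewrite E2, Cmod_opp in H. lra. }
  apply (cser_eq _ (/ v * / (1 - - / v * h))%C).
  - apply (cser_ext (fun k => / v * (- / v * h) ^ k)%C). { intros k. unfold geo. rewrite Cpow_mult_l. ring. }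
    apply cser_scal, cgeom. rewrite Cmod_mult, Cmod_opp, Cmod_inv; auto.
    apply (Rmult_lt_reg_l (Cmod v)); auto. rewrite <- Rmult_assoc, Rinv_r; lra.
  - field. repeat split; auto.
Qed.

Lemma Cmod_geo (v : C) (k : nat) (rho : R) : v <> 0 -> 0 <= rho <= Cmod v -> Cmod (geo v k) * rho ^ k <= / Cmod v.
Proof.
  intros Hv H. assert (Hv0 : 0 < Cmod v) by (apply Cmod_gt_0; auto).
  unfold geo. rewrite Cmod_mult, Cmod_pow, Cmod_opp, Cmod_inv, Rmult_assoc, <- Rpow_mult_distr; auto.
  apply Rle_trans with (/ Cmod v * 1); [|lra]. apply Rmult_le_compat_l; [left; apply Rinv_0_lt_compat; auto|].
  rewrite <- (pow1 k). apply pow_incr. split.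
  - apply Rmult_le_pos; [left; apply Rinv_0_lt_compat; auto|lra].
  - apply (Rmult_le_reg_l (Cmod v)); auto. rewrite <- Rmult_assoc, Rinv_r; lra.
Qed.

Lemma ps_of_cser (a : nat -> C) (z0 : C) (rho rho0 : R) (f : C -> C) : 0 < rho < rho0 ->
  (forall h, Cmod h < rho0 -> cser (fun k => a k * h ^ k)%C (f (z0 + h)%C)) -> ps a z0 rho f.
Proof.
  intros Hr H. split; [lra|split].
  - assert (Q := H (RtoC rho)). rewrite Cmod_R, Rabs_pos_eq in Q by lra.
    destruct (cser_terms_bounded _ _ (Q ltac:(lra))) as [M HM]. exists M. intros k.
    specialize (HM k). rewrite Cmod_mult, Cmod_pow, Cmod_R, Rabs_pos_eq in HM by lra. auto.
  - intros h Hh. apply H; lra.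
Qed.

(* The k-th Taylor coefficient in s of x^(-s). *)
Definition ncoef (s : C) (k : nat) (x : R) : C := (pcoef (- s) k x * RtoC ((-1) ^ k))%C.

Lemma ncoef_series (s h : C) (x : R) : cser (fun k => ncoef s k x * h ^ k)%C (cpw x (- (s + h))).
Proof.
  replace (- (s + h))%C with (- s + - h)%C by ring.
  eapply cser_ext; [|apply cpw_series]. intros k. unfold ncoef.
  replace (- h)%C with (RtoC (-1) * h)%C.
  - rewrite Cpow_mult_l, <- RtoC_pow. ring.
  - replace (-1) with (- (1)) by ring. rewrite RtoC_opp. ring.
Qed.

Lemma Cmod_ncoef (s : C) (k : nat) (x rho : R) : 0 < x -> 0 <= rho ->
  Cmod (ncoef s k x) * rho ^ k <= Rpower x (- Re s) * exp (rho * Rabs (ln x)).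
Proof.
  intros Hx Hr. unfold ncoef. rewrite Cmod_mult, Cmod_R, pow_1_abs, Rmult_1_r. apply (Cmod_pcoef (- s)%C); auto.
Qed.

Lemma Ccont_pos_ncoef (s : C) (k : nat) : Ccont_pos (ncoef s k).
Proof. intros x Hx. unfold ncoef. apply Ccont_mult; [apply Ccont_pcoef; auto|apply Ccont_const]. Qed.

Lemma ncoef_bounded (s : C) (B : R) : exists M, forall k x, 1 / 2 <= x <= B -> Cmod (ncoef s k x) <= M.
Proof.
  set (L := ln 2 + Rabs (ln B)).
  exists (exp (Rabs (Re s) * L) * exp (1 * L)). intros k x Hx.
  assert (HL : Rabs (ln x) <= L).
  { assert (H1 : ln (1 / 2) <= ln x) by (apply Rcomplements.ln_le; lra).
    assert (H2 : ln x <= ln B) by (apply Rcomplements.ln_le; lra).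
    assert (H3 : ln (1 / 2) = - ln 2). { unfold Rdiv. rewrite Rmult_1_l, ln_Rinv; lra. }
    assert (H4 := Rle_abs (ln B)). assert (H5 : 0 < ln 2) by (rewrite <- ln_1; apply ln_increasing; lra).
    assert (H6 := Rabs_pos (ln B)).
    unfold L. apply Rabs_le. lra. }
  assert (K := Cmod_ncoef s k x 1 ltac:(lra) ltac:(lra)). rewrite pow1, Rmult_1_r in K.
  eapply Rle_trans; [exact K|]. apply Rmult_le_compat; try (left; apply exp_pos).
  - unfold Rpower. apply exp_le.
    eapply Rle_trans; [apply Rle_abs|]. rewrite Rabs_mult, Rabs_Ropp.
    apply Rmult_le_compat_l; auto. apply Rabs_pos.
  - apply exp_le. lra.
Qed.

Lemma rgen_const (a b c : R) : a <= b -> rgen (fun _ => c) (pt a) (pt b) (c * (b - a)).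
Proof.
  intros Hab.
  assert (H := igen_points_ftc (fun u => RtoC u * RtoC c)%C (fun _ => RtoC c) a b Hab
    (fun x _ => Cder_tz (RtoC c) x) (fun x _ => Ccont_const (RtoC c) x)).
  apply igen_Re in H; try typeclasses eauto. simpl in H.
  replace (c * (b - a)) with (b * c - 0 * 0 + - (a * c - 0 * 0)) by ring. exact H.
Qed.

Lemma prim_series (A : nat -> R -> C) (F : R -> C) (a M : R) (h : C) :
  (forall k, Ccont_pos (A k)) -> Ccont_pos F -> 1 / 2 <= a -> Cmod h < 1 ->
  (forall k x, 1 / 2 <= x <= a -> Cmod (A k x) <= M) ->
  (forall x, 1 / 2 <= x <= a -> cser (fun k => A k x * h ^ k)%C (F x)) ->
  cser (fun k => prim (A k) a * h ^ k)%C (prim F a).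
Proof.
  intros HA HF Ha Hh HM HS.
  assert (P : forall f, Ccont_pos f -> igen f (pt (1 / 2)) (pt a) (prim f a)).
  { intros f Hf. assert (K := igen_prim f (1 / 2) a Hf ltac:(lra)). rewrite prim_half in K.
    replace (prim f a) with (prim f a - 0)%C by ring. auto. }
  destruct (igen_series (pt (1 / 2)) (pt a) (fun x => 1 / 2 <= x <= a) A F (fun k => prim (A k) a)
     (fun _ => M) (M * (a - 1 / 2)) 1 h) as [L [L1 L2]]; auto.
  - apply dom_points; auto.
  - lra.
  - intros; apply continuous_const.
  - apply rgen_const; auto.
  - intros k x Hx. rewrite pow1, Rmult_1_r; auto.
  - intros x Hx. apply HF; lra.
  - rewrite (igen_unique _ _ _ _ _ (P F HF) L1). auto.
Qed.

Lemma Kw_series (A : nat -> R -> C) (F : R -> C) (a M : R) (h : C) :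
  (forall k, Ccont_pos (A k)) -> Ccont_pos F -> 1 / 2 <= a -> Cmod h < 1 ->
  (forall k x, 1 / 2 <= x <= a + 1 -> Cmod (A k x) <= M) ->
  (forall x, 1 / 2 <= x <= a + 1 -> cser (fun k => A k x * h ^ k)%C (F x)) ->
  cser (fun k => Kw (A k) a * h ^ k)%C (Kw F a).
Proof.
  intros HA HF Ha Hh HM HS.
  destruct (igen_series (pt 0) (pt 1) (fun u => 0 <= u <= 1) (fun k u => RtoC (1 - u) * A k (a + u)%R)%C
     (fun u => RtoC (1 - u) * F (a + u)%R)%C (fun k => Kw (A k) a)
     (fun _ => M) M 1 h) as [L [L1 L2]]; auto.
  - apply dom_points; auto; lra.
  - lra.
  - intros; apply continuous_const.
  - assert (K := rgen_scal (pt 0) (pt 1) M _ _ rgen_one). rewrite Rmult_1_r in K.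
    apply (rgen_ext_all (pt 0) (pt 1) (fun _ => M * 1)); auto. intros; ring.
  - intros k x Hx. rewrite pow1, Rmult_1_r, Cmod_mult, Cmod_R, Rabs_pos_eq by lra.
    apply Rle_trans with (1 * Cmod (A k (a + x))).
    + apply Rmult_le_compat_r; [apply Cmod_ge_0|lra].
    + rewrite Rmult_1_l. apply HM; lra.
  - intros x Hx. apply Ccont_mult.
    + apply Ccont_one_sub.
    + apply Ccont_shift, HF; lra.
  - intros x Hx. apply (cser_ext (fun k => RtoC (1 - x) * (A k (a + x)%R * h ^ k))%C). intros; ring.
    apply cser_scal, HS; lra.
  - intros k. apply igen_Kw; auto; lra.
  - rewrite (igen_unique (pt 0) (pt 1) _ _ _ (igen_Kw F a HF ltac:(lra)) L1). auto.
Qed.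

Lemma Kw_bound (y : R -> C) (a M : R) : Ccont_pos y -> 0 < a ->
  (forall x, a <= x <= a + 1 -> Cmod (y x) <= M) -> Cmod (Kw y a) <= M.
Proof.
  intros Hy Ha H.
  assert (K := rgen_scal (pt 0) (pt 1) M _ _ rgen_one). rewrite Rmult_1_r in K.
  refine (igen_norm (pt 0) (pt 1) (fun u => 0 <= u <= 1) _ _ _ _ (dom_points 0 1 _ Rle_0_1 (fun x H => H)) _ (igen_Kw y a Hy Ha) K).
  intros u Hu. rewrite Cmod_mult, Cmod_R, Rabs_pos_eq by lra.
  assert (Cmod (y (a + u)) <= M) by (apply H; lra). assert (P := Cmod_ge_0 (y (a + u))). nra.
Qed.

Lemma prim_bound (y : R -> C) (a M : R) : Ccont_pos y -> 1 / 2 <= a ->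
  (forall x, 1 / 2 <= x <= a -> Cmod (y x) <= M) -> Cmod (prim y a) <= M * (a - 1 / 2).
Proof.
  intros Hy Ha H.
  assert (K := igen_prim y (1 / 2) a Hy ltac:(lra)). rewrite prim_half in K.
  replace (prim y a) with (prim y a - 0)%C by ring.
  refine (igen_norm (pt (1 / 2)) (pt a) (fun u => 1 / 2 <= u <= a) _ _ _ _ (dom_points (1 / 2) a _ Ha (fun x H => H)) _ K (rgen_const _ _ M Ha)).
  exact H.
Qed.

(** Radius 1 at every centre is available because the pole has been removed. The coefficient bound
    is uniform in k and on compact ranges of a, since the recursion integrates the expansion over
    [a, a + 1] and between 1 and a. The range starts at 1/2 to stay off the singularity at a = 0. *)
Definition taylor_ok (s0 : C) : Prop := exists A : nat -> R -> C,
  (forall k, Ccont_pos (A k)) /\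
  (forall B, exists M, forall k a, 1 / 2 <= a <= B -> Cmod (A k a) <= M) /\
  forall h a, Cmod h < 1 -> 1 / 2 <= a -> cser (fun k => A k a * h ^ k)%C (Yz (s0 + h) a).

(** Expanding with radius 1 shifts the exponent by one in either direction. The term with Re s - 1
    is summable for Re s > 2, which is why the descent of Taylor expansions starts there. *)
Lemma ncoef_hz_bound (s : C) (k m : nat) (a b : R) : 1 < Re s -> 0 < a <= b ->
  Cmod (ncoef s k (INR m + b)) <= Rpower (INR m + a) (- (Re s - 1)) + Rpower (INR m + a) (- (Re s + 1)).
Proof.
  intros Hs H. assert (P := pos_INR m).
  assert (K := Cmod_ncoef s k (INR m + b) 1 ltac:(lra) ltac:(lra)). rewrite pow1, Rmult_1_r in K.
  eapply Rle_trans; [exact K|].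
  assert (K2 := exp_rho_ln 1 (INR m + b)). assert (P1 := Rpower_pos (INR m + b) (- Re s)).
  apply Rle_trans with (Rpower (INR m + b) (- Re s) * (Rpower (INR m + b) 1 + Rpower (INR m + b) (- (1)))).
  { apply Rmult_le_compat_l; lra. }
  rewrite Rmult_plus_distr_l, <- !Rpower_plus.
  replace (- Re s + 1) with (- (Re s - 1)) by ring. replace (- Re s + - (1)) with (- (Re s + 1)) by ring.
  apply Rplus_le_compat; apply Rpower_neg_le; lra.
Qed.

Lemma taylor_base (s0 : C) : 2 < Re s0 -> taylor_ok s0.
Proof.
  intros Hs.
  set (bb := fun a m => Rpower (INR m + a) (- (Re s0 - 1)) + Rpower (INR m + a) (- (Re s0 + 1))).
  assert (Hbb : forall a, 0 < a -> ex_series (bb a)).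
  { intros a Ha. apply (ex_series_plus (V := R_NormedModule)); apply ex_series_hurwitz; lra. }
  assert (Hv : (s0 - 1)%C <> 0) by (apply C_neq_Re; lra).
  assert (Hv1 : 1 < Cmod (s0 - 1)).
  { eapply Rlt_le_trans; [|apply re_le_Cmod]. eapply Rlt_le_trans; [|apply Rle_abs]. simpl. unfold Re in *. lra. }
  exists (fun k a => Cseries (fun m => ncoef s0 k (INR m + a)) - geo (s0 - 1) k)%C.
  assert (HS : forall k a, 0 < a -> cser (fun m => ncoef s0 k (INR m + a)) (Cseries (fun m => ncoef s0 k (INR m + a)))).
  { intros k a Ha. apply (Cseries_correct _ (bb a)); auto. intros m. apply ncoef_hz_bound; lra. }
  split; [|split].
  - intros k x Hx. apply Ccont_minus; [|apply Ccont_const].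
    apply (Ccont_Mtest (fun m a => ncoef s0 k (INR m + a)) _ (bb (x / 2))).
    + apply Hbb; lra.
    + intros m. apply (Ccont_shift (ncoef s0 k)). apply Ccont_pos_ncoef. apply INR_add_pos; auto.
    + generalize (locally_half x Hx). apply filter_imp. intros y Hy. split.
      * intros m. apply ncoef_hz_bound; lra.
      * apply HS; lra.
  - intros B. destruct (Hbb (1 / 2) ltac:(lra)) as [b Hb]. exists (b + / Cmod (s0 - 1)).
    intros k a Ha. eapply Rle_trans; [apply Cmod_triangle|]. rewrite Cmod_opp. apply Rplus_le_compat.
    + apply (cser_bound _ _ (bb (1 / 2)) _ (HS k a ltac:(lra))); auto. intros m. apply ncoef_hz_bound; lra.
    + assert (K := Cmod_geo (s0 - 1) k 1 Hv ltac:(lra)). rewrite pow1, Rmult_1_r in K. auto.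
  - intros h a Hh Ha.
    assert (Hsh : 1 < Re (s0 + h)%C).
    { assert (Q := re_le_Cmod h). assert (Q2 : Rabs (Re h) < 1) by lra. apply Rabs_def2 in Q2. simpl; unfold Re in *; lra. }
    rewrite Yz_big; auto.
    apply (cser_ext (fun k => Cseries (fun m => ncoef s0 k (INR m + a)) * h ^ k - geo (s0 - 1) k * h ^ k)%C). intros; ring.
    apply cser_minus.
    + assert (Hq := Cmod_ge_0 h).
      apply (cser_swap (fun m k => ncoef s0 k (INR m + a) * h ^ k)%C (fun m => hz (s0 + h) m a) _ _ (bb a) (Cmod h)); auto; try lra.
      * intros m k. rewrite Cmod_mult, Cmod_pow. apply Rmult_le_compat_r; [apply pow_le; auto|]. apply ncoef_hz_bound; lra.
      * apply Hbb; lra.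
      * intros m. apply ncoef_series.
      * intros k. apply (cser_ext (fun m => h ^ k * ncoef s0 k (INR m + a))%C). intros; ring.
        rewrite Cmult_comm. apply cser_scal, HS; lra.
      * apply Sf_correct; lra.
    + replace (s0 + h - 1)%C with (s0 - 1 + h)%C by ring. apply geo_series. lra.
Qed.

Lemma taylor_all (s0 : C) : taylor_ok s0.
Proof.
  assert (K : forall n s, 2 < Re s + INR n -> taylor_ok s).
  2:{ destruct (INR_unbounded (2 - Re s0)) as [n Hn]. apply (K n). lra. }
  clear s0. induction n as [|n IH]; intros s Hs.
  { apply taylor_base. simpl in Hs; lra. }
  destruct (IH (s + 1)%C) as [B [B1 [B2 B3]]].
  { rewrite S_INR in Hs. simpl. unfold Re in *. lra. }
  (* At s + h the recursion carries the factor s + h: the summand with h shifts the coefficients by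
     one index, which is [Bp], and [d0] holds the constant 1/2. *)
  set (Bp := fun k => match k with O => fun _ : R => RtoC 0 | S j => Kw (B j) end).
  set (d0 := fun k => match k with O => (/ 2)%C | S _ => RtoC 0 end).
  assert (HBp : forall k, Ccont_pos (Bp k)).
  { intros [|k]; simpl; [intros x _; apply Ccont_const|apply Ccont_pos_Kw; auto]. }
  exists (fun k a => d0 k - (prim (ncoef s k) a - prim (ncoef s k) 1) + s * Kw (B k) a + Bp k a)%C.
  split; [|split].
  - intros k x Hx. repeat apply Ccont_plus; try apply Ccont_const; auto.
    + apply Ccont_opp, Ccont_minus; [apply Ccont_pos_prim; auto; apply Ccont_pos_ncoef|apply Ccont_const].
    + apply Ccont_mult; [apply Ccont_const|apply Ccont_pos_Kw; auto].
    + apply HBp; auto.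
  - intros Bd. destruct (ncoef_bounded s (Rmax Bd 1)) as [M1 HM1]. destruct (B2 (Bd + 1)) as [M2 HM2].
    exists (1 + M1 * (Rabs Bd + 1) + M1 + Cmod s * M2 + Rabs M2). intros k a Ha.
    assert (Hm1 := Rmax_l Bd 1). assert (Hm2 := Rmax_r Bd 1).
    assert (PM1 : 0 <= M1). { eapply Rle_trans; [apply Cmod_ge_0|apply (HM1 O 1); lra]. }
    assert (HK : forall j, Cmod (Kw (B j) a) <= M2).
    { intros j. apply Kw_bound; auto; [lra|]. intros x Hx. apply HM2; lra. }
    assert (T1 : Cmod (prim (ncoef s k) a) <= M1 * (Rabs Bd + 1)).
    { eapply Rle_trans; [apply (prim_bound _ _ M1); [apply Ccont_pos_ncoef|lra|]|].
      - intros x Hx. apply HM1; lra.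
      - apply Rmult_le_compat_l; auto. generalize (Rle_abs Bd). lra. }
    assert (T2 : Cmod (prim (ncoef s k) 1) <= M1).
    { eapply Rle_trans; [apply (prim_bound _ _ M1); [apply Ccont_pos_ncoef|lra|]|].
      - intros x Hx. apply HM1; lra.
      - lra. }
    assert (T3 : Cmod (s * Kw (B k) a) <= Cmod s * M2).
    { rewrite Cmod_mult. apply Rmult_le_compat_l; auto. apply Cmod_ge_0. }
    assert (T4 : Cmod (Bp k a) <= Rabs M2).
    { destruct k; simpl; [rewrite Cmod_0; apply Rabs_pos|]. eapply Rle_trans; [apply HK|apply Rle_abs]. }
    assert (T5 : Cmod (d0 k) <= 1).
    { destruct k; simpl; [|rewrite Cmod_0; lra]. rewrite Cmod_inv, Cmod_R, Rabs_pos_eq; try lra. intros E; apply RtoC_inj in E; lra. }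
    eapply Rle_trans; [apply Cmod_triangle|]. apply Rplus_le_compat; auto.
    eapply Rle_trans; [apply Cmod_triangle|]. apply Rplus_le_compat; auto.
    eapply Rle_trans; [apply Cmod_triangle|]. rewrite Rplus_assoc. apply Rplus_le_compat; auto.
    rewrite Cmod_opp. eapply Rle_trans; [apply Cmod_triangle|]. rewrite Cmod_opp. lra.
  - intros h a Hh Ha. rewrite Yz_rec by lra.
    destruct (ncoef_bounded s (Rmax a 1)) as [M1 HM1]. destruct (B2 (a + 1)) as [M2 HM2].
    assert (Hm1 := Rmax_l a 1). assert (Hm2 := Rmax_r a 1).
    assert (SK : cser (fun k => Kw (B k) a * h ^ k)%C (Kw (Yz (s + h + 1)%C) a)).
    { apply (Kw_series _ _ _ M2); auto; [apply Ccont_pos_Yz|]. intros x Hx.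
      replace (s + h + 1)%C with (s + 1 + h)%C by ring. apply B3; auto. lra. }
    assert (SP : forall b, 1 / 2 <= b <= Rmax a 1 -> cser (fun k => prim (ncoef s k) b * h ^ k)%C (prim (fun x => cpw x (- (s + h))) b)).
    { intros b Hb. apply (prim_series _ _ _ M1); auto; try lra.
      - intros k; apply Ccont_pos_ncoef.
      - apply Ccont_pos_cpw.
      - intros k x Hx. apply HM1; lra.
      - intros x Hx. apply ncoef_series. }
    apply (cser_ext (fun k => d0 k * h ^ k - (prim (ncoef s k) a * h ^ k - prim (ncoef s k) 1 * h ^ k)
       + s * (Kw (B k) a * h ^ k) + Bp k a * h ^ k)%C). { intros; ring. }
    replace (/ 2 - Epw (s + h) a + (s + h) * Kw (Yz (s + h + 1)%C) a)%C with
      (/ 2 - Epw (s + h) a + s * Kw (Yz (s + h + 1)%C) a + (0 + h * Kw (Yz (s + h + 1)%C) a))%C by ring.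
    apply cser_plus; [apply cser_plus; [apply cser_minus|]|].
    + apply (cser_ext d0); [|apply cser_0_only]. intros [|k]; simpl; ring.
    + apply cser_minus; apply SP; lra.
    + apply cser_scal; auto.
    + replace (RtoC 0) with (Bp O a * h ^ 0)%C by (simpl; ring).
      apply (cser_incr (fun k => Bp k a * h ^ k)%C). simpl.
      apply (cser_ext (fun k => h * (Kw (B k) a * h ^ k))%C). intros; ring. apply cser_scal; auto.
Qed.

(** * Zeta with its pole restored, and its identification with [hurwitz_zeta] *)

Definition Zt (s : C) (a : R) : C := (Yz s a + / (s - 1))%C.

(** The coefficients are those of a^(-s), Y(s, a + 1) and 1 / (s - 1). Only the first is singular at
    a = 0, and it is bounded explicitly; for a <= 1 the second is taken in [1, 2]; the third limits
    the radius to |s0 - 1|. *)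
Lemma zeta_taylor (s0 : C) : s0 <> 1%C -> exists A : nat -> R -> C,
  (forall k, Ccont_pos (A k)) /\
  (forall rho, 0 < rho <= Rmin (1 / 2) (Cmod (s0 - 1)) -> exists M, 0 <= M /\ forall k a, 0 < a ->
     a <= 1 -> Cmod (A k a) * rho ^ k <= Rpower a (- Re s0) * (Rpower a rho + Rpower a (- rho)) + M) /\
  (forall h a, Cmod h < Rmin 1 (Cmod (s0 - 1)) -> 0 < a -> cser (fun k => A k a * h ^ k)%C (Zt (s0 + h) a)).
Proof.
  intros Hs0.
  assert (Hv := Cminus_neq_0 s0 1 Hs0).
  assert (Hv0 : 0 < Cmod (s0 - 1)) by (apply Cmod_gt_0; auto).
  destruct (taylor_all s0) as [B [B1 [B2 B3]]].
  exists (fun k a => ncoef s0 k a + B k (a + 1)%R + geo (s0 - 1) k)%C. split; [|split].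
  - intros k x Hx. apply Ccont_plus; [|apply Ccont_const]. apply Ccont_plus; [apply Ccont_pos_ncoef; auto|].
    apply (Ccont_ext (fun t => B k (1 + t))). intros t; f_equal; ring.
    apply Ccont_shift, B1. lra.
  - intros rho Hr. destruct (B2 2) as [M HM].
    assert (Hr1 := Rmin_l (1 / 2) (Cmod (s0 - 1))). assert (Hr2 := Rmin_r (1 / 2) (Cmod (s0 - 1))).
    exists (Rabs M + / Cmod (s0 - 1)). split.
    { apply Rplus_le_le_0_compat; [apply Rabs_pos|left; apply Rinv_0_lt_compat; auto]. }
    intros k a Ha Ha1.
    assert (Pr : 0 < rho ^ k) by (apply pow_lt; lra).
    assert (Pr1 : rho ^ k <= 1). { rewrite <- (pow1 k). apply pow_incr; lra. }
    assert (T1 := Cmod_ncoef s0 k a rho Ha ltac:(lra)).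
    assert (T2 : Cmod (B k (a + 1)) * rho ^ k <= Rabs M).
    { specialize (HM k (a + 1) ltac:(lra)). assert (P := Cmod_ge_0 (B k (a + 1))).
      assert (PM := Rle_abs M). nra. }
    assert (T3 := Cmod_geo (s0 - 1) k rho Hv ltac:(lra)).
    assert (T4 := exp_rho_ln rho a). assert (T5 := Rpower_pos a (- Re s0)).
    apply Rle_trans with ((Cmod (ncoef s0 k a) + Cmod (B k (a + 1)) + Cmod (geo (s0 - 1) k)) * rho ^ k).
    + apply Rmult_le_compat_r; [lra|]. eapply Rle_trans; [apply Cmod_triangle|].
      apply Rplus_le_compat_r. apply Cmod_triangle.
    + assert (Rpower a (- Re s0) * exp (rho * Rabs (ln a)) <= Rpower a (- Re s0) * (Rpower a rho + Rpower a (- rho))).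
      { apply Rmult_le_compat_l; lra. }
      lra.
  - intros h a Hh Ha.
    assert (Hr1 := Rmin_l 1 (Cmod (s0 - 1))). assert (Hr2 := Rmin_r 1 (Cmod (s0 - 1))).
    unfold Zt.
    replace (Yz (s0 + h) a) with (cpw a (- (s0 + h)) + Yz (s0 + h) (a + 1))%C by (rewrite Yz_shift; auto; ring).
    apply (cser_ext (fun k => ncoef s0 k a * h ^ k + B k (a + 1)%R * h ^ k + geo (s0 - 1) k * h ^ k)%C). intros; ring.
    apply cser_plus; [apply cser_plus|].
    + apply ncoef_series.
    + apply B3; lra.
    + replace (s0 + h - 1)%C with (s0 - 1 + h)%C by ring. apply geo_series. lra.
Qed.

Lemma Zt_continuation (a : R) : 0 < a -> is_hurwitz_continuation a (fun s => Zt s a).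
Proof.
  intros Ha. split.
  - intros s Hs. apply cser_is_series.
    apply (cser_eq _ (Sf s a)).
    + apply (cser_ext (fun m => hz s m a)); [|apply Sf_correct; auto].
      intros m. unfold hz. rewrite Cpower_cpw; auto. apply INR_add_pos; auto.
    + cbv beta. unfold Zt. rewrite Yz_big; auto. ring.
  - intros s Hs. destruct (zeta_taylor s Hs) as [A [_ [_ H]]].
    assert (Hv0 := Cmod_minus_pos s 1 Hs).
    assert (Hm : 0 < Rmin 1 (Cmod (s - 1))) by (apply Rmin_pos; lra).
    apply (ps_analytic (fun k => A k a) s (Rmin 1 (Cmod (s - 1)) / 2)).
    apply (ps_of_cser _ _ _ (Rmin 1 (Cmod (s - 1)))); [lra|]. intros h Hh. apply H; auto.
Qed.

Lemma hurwitz_continuation_unique (a : R) (f g : C -> C) (s : C) :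
  is_hurwitz_continuation a f -> is_hurwitz_continuation a g -> s <> 1%C -> f s = g s.
Proof.
  intros [F1 F2] [G1 G2] Hs.
  (* a ray from s to the right that avoids the pole *)
  assert (Hd : exists d : C, Re d = 1 /\ forall t, 0 <= t -> (s + RtoC t * d)%C <> 1%C).
  { destruct (Rle_dec 0 (Im s)) as [H|H].
    - exists (1, 1). split; auto. intros t Ht E.
      destruct (Req_dec t 0) as [->|Hn].
      + apply Hs. rewrite <- E. ring.
      + apply (f_equal snd) in E. simpl in E. unfold Im in *. lra.
    - exists (1, -1). split; auto. intros t Ht E.
      apply (f_equal snd) in E. simpl in E. unfold Im in *. lra. }
  destruct Hd as [d [Hd1 Hd]].
  destruct (identity_ray f g s d) as [eps [He K]].
  - intros E. rewrite E in Hd1. simpl in Hd1. lra.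
  - intros t Ht. apply F2, Hd; auto.
  - intros t Ht. apply G2, Hd; auto.
  - exists (Rmax 0 (1 - Re s)). split; [apply Rmax_l|]. intros t Ht.
    assert (H1 := Rmax_r 0 (1 - Re s)).
    assert (HR : 1 < Re (s + RtoC t * d)%C).
    { replace (Re (s + RtoC t * d)%C) with (Re s + t * Re d) by (unfold Re; simpl; ring). rewrite Hd1. lra. }
    eapply cser_unique; apply cser_is_series; [apply F1|apply G1]; auto.
  - replace s with (s + 0)%C by ring. apply K. rewrite Cmod_0; auto.
Qed.

(** [Zt] witnesses the existence that [epsilon_spec] requires, and uniqueness makes the choice
    immaterial away from s = 1. *)
Lemma hurwitz_zeta_eq (s : C) (a : R) : s <> 1%C -> 0 < a -> hurwitz_zeta s a = Zt s a.
Proof.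
  intros Hs Ha. unfold hurwitz_zeta.
  apply (hurwitz_continuation_unique a _ (fun s => Zt s a)); auto; [|apply Zt_continuation; auto].
  apply epsilon_spec. exists (fun s => Zt s a). apply Zt_continuation; auto.
Qed.

(** The expansion is used on a disc that misses s = 1, the one point where the chosen continuation
    is unspecified, so the iterated derivative at the centre sees only values known from [Zt]. *)
Lemma hurwitz_zeta_derive_eq (s0 : C) (A : nat -> R -> C) (r : nat) (a : R) : s0 <> 1%C -> 0 < a ->
  (forall h, Cmod h < Rmin 1 (Cmod (s0 - 1)) -> cser (fun k => A k a * h ^ k)%C (Zt (s0 + h) a)) ->
  hurwitz_zeta_derive r s0 a = (RtoC (INR (fact r)) * A r a)%C.
Proof.
  intros Hs Ha H. unfold hurwitz_zeta_derive.
  assert (Hv0 := Cmod_minus_pos s0 1 Hs).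
  assert (Hm : 0 < Rmin 1 (Cmod (s0 - 1))) by (apply Rmin_pos; lra).
  apply (C_derive_n_ps r (fun k => A k a) s0 (Rmin 1 (Cmod (s0 - 1)) / 2)).
  apply (ps_of_cser _ _ _ (Rmin 1 (Cmod (s0 - 1)))); [lra|].
  intros h Hh. rewrite hurwitz_zeta_eq; auto.
  intros E. assert (Hr2 := Rmin_r 1 (Cmod (s0 - 1))).
  replace (s0 - 1)%C with (- h)%C in Hr2; [rewrite Cmod_opp in Hr2|rewrite <- E; ring].
  replace (s0 - 1)%C with (- h)%C in Hh; [rewrite Cmod_opp in Hh; lra|rewrite <- E; ring].
Qed.

(** The character carries the sign of the Fourier kernel: a coefficient is an integral against
    [e2 n], while the Fourier series itself is written with [e2 (- n)]. *)
Definition e2 (n : Z) (a : R) : C := Cexp (- (two_pi_i n * RtoC a)).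

Lemma Cder_e2 (n : Z) (a : R) : Cder (e2 n) a (- two_pi_i n * e2 n a)%C.
Proof. apply Cder_ezx. Qed.

Lemma Ccont_e2 (n : Z) (a : R) : Ccont (e2 n) a.
Proof. eapply Cder_cont, Cder_e2. Qed.

Lemma Re_two_pi_i (n : Z) : Re (two_pi_i n) = 0.
Proof. unfold two_pi_i; simpl; ring. Qed.

Lemma Im_two_pi_i (n : Z) : Im (two_pi_i n) = 2 * PI * IZR n.
Proof. unfold two_pi_i; simpl; ring. Qed.

Lemma Cmod_e2 (n : Z) (a : R) : Cmod (e2 n a) = 1.
Proof. unfold e2. rewrite Cmod_Cexp, Re_zx, Re_two_pi_i, Rmult_0_l, Ropp_0. apply exp_0. Qed.

Lemma e2_0 (n : Z) : e2 n 0 = 1%C.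
Proof. unfold e2. rewrite Cmult_0_r. replace (- 0)%C with (RtoC 0) by ring. apply Cexp_0. Qed.

Lemma e2_zero (a : R) : e2 0 a = 1%C.
Proof.
  unfold e2, two_pi_i. rewrite Rmult_0_r, !Cmult_0_l. replace (- 0)%C with (RtoC 0) by ring. apply Cexp_0.
Qed.

Lemma e2_1 (n : Z) : e2 n 1 = 1%C.
Proof.
  assert (K : forall k, cos (2 * PI * INR k) = 1 /\ sin (2 * PI * INR k) = 0).
  { intros k. replace (2 * PI * INR k) with (0 + 2 * INR k * PI) by ring.
    rewrite cos_period, sin_period, cos_0, sin_0; auto. }
  assert (K2 : cos (2 * PI * IZR n) = 1 /\ sin (2 * PI * IZR n) = 0).
  { destruct (Z.le_gt_cases 0 n).
    - rewrite <- (Z2Nat.id n), <- INR_IZR_INZ by lia. apply K.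
    - replace n with (- Z.of_nat (Z.to_nat (- n)))%Z by lia. rewrite opp_IZR, <- INR_IZR_INZ.
      replace (2 * PI * - INR (Z.to_nat (- n))) with (- (2 * PI * INR (Z.to_nat (- n)))) by ring.
      destruct (K (Z.to_nat (- n))) as [K1 K2]. rewrite cos_neg, sin_neg, K1, K2. split; ring. }
  destruct K2 as [K1 K2].
  unfold e2, Cexp. rewrite Re_zx, Re_two_pi_i.
  replace (Im (- (two_pi_i n * RtoC 1))%C) with (- (2 * PI * IZR n)) by (rewrite <- Im_two_pi_i; unfold Im; simpl; ring).
  rewrite cos_neg, sin_neg, K1, K2, Rmult_0_l, Ropp_0, exp_0. apply C_eq; simpl; ring.
Qed.

Lemma e2_S (n : Z) (a : R) : e2 n (a + 1) = e2 n a.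
Proof.
  unfold e2. rewrite RtoC_plus. replace (- (two_pi_i n * (RtoC a + 1)))%C with (- (two_pi_i n * RtoC a) + - (two_pi_i n * RtoC 1))%C by ring.
  rewrite Cexp_plus. fold (e2 n 1). rewrite e2_1. ring.
Qed.

Lemma e2_plus (m n : Z) (a : R) : (e2 m a * e2 n a)%C = e2 (m + n) a.
Proof.
  unfold e2. rewrite <- Cexp_plus. f_equal. unfold two_pi_i. rewrite plus_IZR.
  rewrite Rmult_plus_distr_l, RtoC_plus. ring.
Qed.

Lemma two_pi_i_neq_0 (n : Z) : n <> 0%Z -> two_pi_i n <> 0.
Proof.
  intros Hn E. apply (f_equal Im) in E. rewrite Im_two_pi_i in E. simpl in E.
  assert (P := PI_RGT_0). apply not_0_IZR in Hn. apply Rmult_integral in E. destruct E; [lra|auto].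
Qed.

Lemma igen_e2 (n : Z) : igen (e2 n) (pt 0) (pt 1) (if Z.eq_dec n 0 then RtoC 1 else RtoC 0).
Proof.
  destruct (Z.eq_dec n 0) as [->|Hn].
  - apply (igen_ext_all (pt 0) (pt 1) (fun _ => RtoC 1)); [|apply igen_one].
    intros x. rewrite e2_zero; auto.
  - assert (Hz := two_pi_i_neq_0 n Hn).
    eapply igen_eq.
    + apply (igen_points_ftc (fun x => - / two_pi_i n * e2 n x)%C); [lra| |]; intros x _.
      * eapply Cder_eq; [apply Cder_scal, Cder_e2|]. field; auto.
      * apply Ccont_e2.
    + cbv beta. rewrite e2_0, e2_1. ring.
Qed.

(** * Fourier coefficients *)

Notation oo := (Rbar_locally p_infty).
Notation r0 := (at_right 0).

Lemma Ccont_Clim_right (f : R -> C) : Ccont f 0 -> Clim f r0 (f 0).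
Proof.
  intros H eps He. assert (K := Ccont_Clim _ _ H eps He).
  apply (filter_le_within (F := locally 0)). exact K.
Qed.

Lemma igen_right_ftc (F f : R -> C) :
  (forall x, 0 < x <= 1 -> Cder F x (f x)) -> (forall x, 0 < x <= 1 -> Ccont f x) -> Ccont F 0 ->
  igen f r0 (pt 1) (F 1 - F 0)%C.
Proof.
  intros H1 H2 H3. apply (igen_ftc r0 (pt 1) F f (fun x => 0 < x <= 1)); auto.
  - apply dom_0_1.
  - apply Ccont_Clim_right; auto.
  - apply Clim_point.
Qed.

(** Taken over [1, 2], away from the singularity, and therefore meaningful for every s. By
    periodicity of the character it is the contribution of Y(s, a + 1) for a in [0, 1]. *)
Definition Qn (n : Z) (s : C) : C :=
  (prim (fun x => Yz s x * e2 n x) 2 - prim (fun x => Yz s x * e2 n x) 1)%C.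

Lemma Ccont_pos_Ye (n : Z) (s : C) : Ccont_pos (fun x => Yz s x * e2 n x)%C.
Proof. intros x Hx. apply Ccont_mult; [apply Ccont_pos_Yz; auto|apply Ccont_e2]. Qed.

Lemma igen_Qn (n : Z) (s : C) : igen (fun x => Yz s x * e2 n x)%C (pt 1) (pt 2) (Qn n s).
Proof. apply igen_prim; [apply Ccont_pos_Ye|lra]. Qed.

(** By parts with dY/da = -1 - s Y(s + 1, a): the character has mean zero over [1, 2] because n is
    not 0, and the boundary term is Y(s, 2) - Y(s, 1) = -1. *)
Lemma Qn_rec (n : Z) (s : C) : n <> 0%Z -> (two_pi_i n * Qn n s = 1 - s * Qn n (s + 1))%C.
Proof.
  intros Hn. assert (Hz := two_pi_i_neq_0 n Hn).
  assert (E2 : forall m : Z, e2 m 2 = 1%C). { intros m. replace 2 with (1 + 1) by ring. rewrite e2_S. apply e2_1. }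
  assert (I1 : igen (fun x => - e2 n x)%C (pt 1) (pt 2) (0)).
  { eapply igen_eq.
    - apply (igen_points_ftc (fun x => / two_pi_i n * e2 n x)%C); [lra| |]; intros x _.
      + eapply Cder_eq; [apply Cder_scal, Cder_e2|]. field; auto.
      + apply Ccont_opp, Ccont_e2.
    - cbv beta. rewrite e2_1, E2. ring. }
  assert (A := igen_minus (pt 1) (pt 2) _ _ _ _ (igen_minus (pt 1) (pt 2) _ _ _ _ I1
      (igen_scal (pt 1) (pt 2) s _ _ (igen_Qn n (s + 1)))) (igen_scal (pt 1) (pt 2) (two_pi_i n) _ _ (igen_Qn n s))).
  assert (B : (0 - s * Qn n (s + 1) - two_pi_i n * Qn n s = Yz s 2 * e2 n 2 - Yz s 1 * e2 n 1)%C).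
  { apply (igen_unique (pt 1) (pt 2) _ _ _ A).
    apply (igen_points_ftc (fun x => Yz s x * e2 n x)%C); [lra| |]; intros x Hx.
    - eapply Cder_eq; [apply Cder_mult; [apply Yz_Cder; lra|apply Cder_e2]|]. cbv beta. ring.
    - apply Ccont_minus; [apply Ccont_minus; [apply Ccont_opp, Ccont_e2|]|].
      + apply Ccont_mult; [apply Ccont_const|apply (Ccont_pos_Ye n (s + 1)); lra].
      + apply Ccont_mult; [apply Ccont_const|apply (Ccont_pos_Ye n s); lra]. }
  assert (S2 : Yz s 2 = (Yz s 1 - 1)%C).
  { replace 2 with (1 + 1) by ring. rewrite Yz_shift by lra. rewrite cpw_one. auto. }
  rewrite E2, e2_1, S2 in B.
  replace (two_pi_i n * Qn n s)%C with (- s * Qn n (s + 1) - (0 - s * Qn n (s + 1) - two_pi_i n * Qn n s))%C by ring.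
  rewrite B. ring.
Qed.

Lemma rgen_Rpower_infty (p : R) : 0 < p -> rgen (fun x => Rpower x (- (p + 1))) (pt 1) oo (/ p).
Proof.
  intros Hp.
  assert (E : Rpower 1 (- p) = 1) by (unfold Rpower; rewrite ln_1, Rmult_0_r; apply exp_0).
  replace (/ p) with (0 - - / p * Rpower 1 (- p)) by (rewrite E; ring).
  apply (rgen_ftc _ _ (fun x => - / p * Rpower x (- p)) _ (fun x => 1 <= x)).
  - apply dom_1_infty.
  - intros x Hx. evar_last; [apply is_derive_scal, is_derive_Rpower; lra|].
    replace (- p - 1) with (- (p + 1)) by ring. field. lra.
  - intros x Hx. apply continuous_Rpower; lra.
  - apply (filterlim_point (fun x => - / p * Rpower x (- p))).
  - apply filterlim_eps; [typeclasses eauto|]. intros eps He.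
    generalize (Rpower_infty_small p (eps * p) Hp (Rmult_lt_0_compat _ _ He Hp)). apply filter_imp.
    intros x [Hx1 Hx]. rewrite Rminus_0_r, Rabs_mult, Rabs_Ropp, !Rabs_pos_eq.
    + apply (Rmult_lt_reg_l p); auto. rewrite <- Rmult_assoc, Rinv_r, Rmult_1_l; lra.
    + left; apply Rpower_pos.
    + left; apply Rinv_0_lt_compat; auto.
Qed.

(** The integrand [Lk (1 - s) z] with its exponent expressed in s, the variable of the recursion. *)
Definition gq (s z : C) (x : R) : C := (cpw x (- s) * Cexp (- (z * RtoC x)))%C.

Lemma Ccont_pos_gq (s z : C) : Ccont_pos (gq s z).
Proof. intros x Hx. unfold gq. apply Ccont_mult; [apply Ccont_cpw; auto|]. eapply Cder_cont, Cder_ezx. Qed.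

Lemma Cmod_gq (s z : C) (x : R) : 0 < x -> Cmod (gq s z x) = Rpower x (- Re s) * exp (- (Re z * x)).
Proof. intros Hx. unfold gq. rewrite Cmod_mult, Cmod_cpw, Cmod_Cexp, Re_zx; auto. Qed.

Lemma gq_infty_ex (s z : C) : 0 < Re z -> exists l, igen (gq s z) (pt 1) oo l.
Proof.
  (* On [1, oo) the power x^(-Re s) may be replaced by any larger power, and for p >= 0 the majorant
     [Wt p] decays like x^(-2). *)
  intros Hz. set (p := Rabs (Re s) + 2).
  assert (Hp : Rabs (Re s) < p - 1) by (unfold p; lra).
  assert (Hp2 : - Re s + 2 <= p) by (unfold p; generalize (Rle_abs (- Re s)); rewrite Rabs_Ropp; lra).
  destruct (Wt_dominates p (Re z) ltac:(generalize (Rabs_pos (Re s)); lra) Hz) as [K [HK H]].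
  apply (igen_dominated (pt 1) oo (fun x => 1 <= x) _ (fun x => K * Rpower x (- (1 + 1))) (K * / 1)).
  - apply dom_1_infty.
  - intros x Hx. apply Ccont_pos_gq; lra.
  - intros x Hx. apply (continuous_mult (K := R_AbsRing) (fun _ => K) (fun x => Rpower x (- (1 + 1)))); [apply continuous_const|apply continuous_Rpower; lra].
  - intros x Hx. rewrite Cmod_gq by lra.
    assert (H1 := H x ltac:(lra)).
    assert (Hlx : 0 <= ln x) by (rewrite <- ln_1; apply Rcomplements.ln_le; lra).
    assert (W := Wt_le p x ltac:(generalize (Rabs_pos (Re s)); lra) Hx).
    replace (- (1 + 1)) with (- 2) by ring.
    apply Rle_trans with (Rpower x p * exp (- (Re z * x))).
    + apply Rmult_le_compat_r; [left; apply exp_pos|]. unfold Rpower. apply exp_le. apply Rmult_le_compat_r; lra.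
    + eapply Rle_trans; [exact H1|]. apply Rmult_le_compat_l; lra.
  - apply rgen_scal; try typeclasses eauto. apply rgen_Rpower_infty; lra.
Qed.

Definition qq (s z : C) : C := RInt_gen (V := C_R_CompleteNormedModule) (gq s z) (pt 1) oo.

Lemma qq_correct (s z : C) : 0 < Re z -> igen (gq s z) (pt 1) oo (qq s z).
Proof.
  intros Hz. destruct (gq_infty_ex s z Hz) as [l Hl].
  unfold qq. apply (RInt_gen_correct (V := C_R_CompleteNormedModule)). exists l; exact Hl.
Qed.

(** The recursion of [Qn_rec] with e^(-z) in place of 1. At z = 2 pi i n the two coincide, which is
    what carries the limit from s + 1 down to s. *)
Lemma qq_rec (s z : C) : 0 < Re z -> (z * qq s z = Cexp (- z) - s * qq (s + 1) z)%C.
Proof.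
  intros Hz.
  assert (A := igen_minus (pt 1) oo _ _ _ _ (igen_scal (pt 1) oo (- s) _ _ (qq_correct (s + 1) z Hz))
    (igen_scal (pt 1) oo z _ _ (qq_correct s z Hz))).
  assert (B : (- s * qq (s + 1) z - z * qq s z = 0 - gq s z 1)%C).
  { apply (igen_unique (pt 1) oo _ _ _ A).
    apply (igen_ftc (pt 1) oo (gq s z) _ (fun x => 1 <= x)).
    - apply dom_1_infty.
    - intros x Hx. unfold gq. eapply Cder_eq; [apply Cder_mult; [apply Cder_cpw; lra|apply Cder_ezx]|].
      cbv beta. replace (- (s + 1))%C with (- s - 1)%C by ring. ring.
    - intros x Hx. apply Ccont_minus; (apply Ccont_mult; [apply Ccont_const|apply Ccont_pos_gq; lra]).
    - apply Clim_point.
    - intros eps He.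
      destruct (Wt_dominates (Rabs (Re s)) (Re z) ltac:(generalize (Rabs_pos (Re s)); lra) Hz) as [K [HK H]].
      generalize (Rpower_infty_small 2 (eps / K) ltac:(lra) ltac:(apply Rdiv_lt_0_compat; lra)). apply filter_imp.
      intros x [Hx1 Hx]. replace (gq s z x - 0)%C with (gq s z x) by ring. rewrite Cmod_gq by lra.
      assert (H1 := H x ltac:(lra)).
      assert (Hlx : 0 <= ln x) by (rewrite <- ln_1; apply Rcomplements.ln_le; lra).
      assert (W := Wt_le (Rabs (Re s)) x (Rabs_pos _) ltac:(lra)).
      apply Rle_lt_trans with (Rpower x (Rabs (Re s)) * exp (- (Re z * x))).
      + apply Rmult_le_compat_r; [left; apply exp_pos|]. unfold Rpower. apply exp_le. apply Rmult_le_compat_r; [lra|].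
        generalize (Rle_abs (- Re s)). rewrite Rabs_Ropp. lra.
      + eapply Rle_lt_trans; [exact H1|]. apply Rle_lt_trans with (K * Rpower x (- 2)); [apply Rmult_le_compat_l; lra|].
        apply (Rmult_lt_compat_l K) in Hx; auto. replace (K * (eps / K)) with eps in Hx by (field; lra). exact Hx. }
  unfold gq in B at 1. rewrite cpw_one in B.
  replace (z * RtoC 1)%C with z in B by ring.
  replace (z * qq s z)%C with (- s * qq (s + 1) z - (- s * qq (s + 1) z - z * qq s z))%C by ring. rewrite B. ring.
Qed.

Lemma igen_prim_lim (f : R -> C) (l : C) : Ccont_pos f -> igen f (pt 1) oo l ->
  Clim (fun b => prim f b - prim f 1)%C oo l.
Proof.
  intros Hf H eps He.
  assert (HB : locally (T := C_UniformSpace) l (fun z => Cmod (z - l) < eps)).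
  { assert (He2 : 0 < eps / 2) by lra. exists (mkposreal _ He2). intros z Hz.
    apply C_NormedModule_mixin_compat2 in Hz. simpl in Hz.
    change (Cmod (z - l) < sqrt 2 * (eps / 2)) in Hz. assert (K := sqrt2_le_2).
    eapply Rlt_le_trans; [exact Hz|]. nra. }
  specialize (H _ HB). unfold filtermapi in H.
  destruct H as [Q R1 HQ HR H]. unfold at_point in HQ.
  assert (Hgt := p_infty_gt 1).
  generalize (filter_and (F := oo) _ _ HR Hgt). apply filter_imp. intros b [Hb Hb1].
  destruct (H 1 b HQ Hb) as [y [Hy1 Hy2]]. simpl in Hy1.
  replace (prim f b - prim f 1)%C with y; auto.
  apply (igen_unique (pt 1) (pt b) f).
  - apply (is_RInt_gen_at_point (V := C_R_NormedModule)). exact Hy1.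
  - apply igen_prim; auto. lra.
Qed.

Lemma gq_e2 (s : C) (n : Z) (x : R) : gq s (two_pi_i n) x = (cpw x (- s) * e2 n x)%C.
Proof. reflexivity. Qed.

Lemma e2_nat_shift (n : Z) (m : nat) (a : R) : e2 n (INR m + a) = e2 n a.
Proof.
  induction m as [|m IH]; [simpl; f_equal; ring|].
  rewrite S_INR, <- IH, <- (e2_S n (INR m + a)). f_equal. ring.
Qed.

(* For Re s > 2, unfolding the series turns the integral over [1,2] into one over [1,oo). *)
Lemma Qn_infty (n : Z) (s l : C) : n <> 0%Z -> 2 < Re s -> igen (gq s (two_pi_i n)) (pt 1) oo l -> Qn n s = l.
Proof.
  intros Hn Hs Hl. set (g := gq s (two_pi_i n)) in *.
  assert (Hg : Ccont_pos g) by apply Ccont_pos_gq.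
  destruct (igen_Mtest (pt 1) (pt 2) (fun x => 1 <= x <= 2) (fun m x => hz s m x * e2 n x)%C (fun x => Sf s x * e2 n x)%C
    (fun m => prim g (INR (S m) + 1) - prim g (INR m + 1))%C (fun _ => 1) (1 * (2 - 1)) (fun m => Rpower (INR m + 1) (- Re s)))
    as [L [HL1 HL2]].
  - apply dom_points; auto; lra.
  - intros; apply continuous_const.
  - apply rgen_const; lra.
  - intros m x Hx. rewrite Cmod_mult, Cmod_e2, !Rmult_1_r. apply hz_bound; lra.
  - apply ex_series_hurwitz; lra.
  - intros x Hx. apply Ccont_mult; [apply Ccont_pos_Sf; lra|apply Ccont_e2].
  - intros x Hx. apply (cser_ext (fun m => e2 n x * hz s m x)%C). intros; ring.
    rewrite Cmult_comm. apply cser_scal, Sf_correct; lra.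
  - intros m. rewrite S_INR. replace (INR m + 1 + 1) with (INR m + 2) by ring.
    assert (Pm := pos_INR m).
    apply (igen_points_ftc (fun x => prim g (INR m + x))); [lra| |]; intros x Hx.
    + eapply Cder_eq; [apply Cder_shift, prim_Cder; [auto|lra]|].
      unfold g. rewrite gq_e2, e2_nat_shift. reflexivity.
    + apply Ccont_mult; [apply Ccont_pos_hz; lra|apply Ccont_e2].
  - assert (E1 : L = l).
    { apply (cser_unique _ _ _ HL2).
      apply (cser_of_csum _ _ (fun N => Cmod (l - csum (fun m => prim g (INR (S m) + 1) - prim g (INR m + 1))%C N))).
      - intros; lra.
      - assert (K := igen_prim_lim g l Hg Hl).
        apply is_lim_seq_spec. intros eps. specialize (K eps (cond_pos eps)). destruct K as [B HB].
        destruct (INR_unbounded B) as [N HN]. exists N. intros m Hm. apply le_INR in Hm.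
        rewrite Rminus_0_r, Rabs_pos_eq by apply Cmod_ge_0.
        specialize (HB (INR m + 1) ltac:(lra)). rewrite <- Cmod_opp.
        replace (- (l - csum (fun m => prim g (INR (S m) + 1) - prim g (INR m + 1)) m))%C with (prim g (INR m + 1) - prim g 1 - l)%C; auto.
        assert (T : csum (fun m => prim g (INR (S m) + 1) - prim g (INR m + 1))%C m = (prim g (INR m + 1) - prim g 1)%C).
        { clear. induction m as [|m IH]; [simpl; replace (0 + 1) with 1 by ring; ring|].
          change (csum ?f (S m)) with (csum f m + f m)%C. rewrite IH. ring. }
        rewrite T. ring. }
    rewrite <- E1.
    (* The part -1 / (s - 1) of [Y] integrates to zero against a nontrivial character. *)
    assert (I0 : igen (fun x => - / (s - 1) * e2 n x)%C (pt 1) (pt 2) 0).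
    { assert (Hz := two_pi_i_neq_0 n Hn). assert (Hn1 : (s - 1)%C <> 0) by (apply C_neq_Re; lra).
      eapply igen_eq.
      - apply (igen_points_ftc (fun x => / (s - 1) * / two_pi_i n * e2 n x)%C); [lra| |]; intros x _.
        + eapply Cder_eq; [apply Cder_scal, Cder_e2|]. field; auto.
        + apply Ccont_mult; [apply Ccont_const|apply Ccont_e2].
      - cbv beta. replace 2 with (1 + 1) by ring. rewrite e2_S, e2_1. ring. }
    apply (igen_unique (pt 1) (pt 2) (fun x => Yz s x * e2 n x)%C); [apply igen_Qn|].
    eapply igen_eq; [apply (igen_ext_all (pt 1) (pt 2) (fun x => Sf s x * e2 n x + - / (s - 1) * e2 n x)%C)|].
    + intros x. rewrite Yz_big by lra. ring.
    + apply igen_plus; try typeclasses eauto; eauto.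
    + ring.
Qed.

Definition zeps (n : Z) (e : R) : C := (two_pi_i n + RtoC e)%C.

Lemma Re_zeps (n : Z) (e : R) : Re (zeps n e) = e.
Proof. unfold zeps. simpl. unfold Re, two_pi_i; simpl. ring. Qed.

Lemma Im_zeps (n : Z) (e : R) : Im (zeps n e) = 2 * PI * IZR n.
Proof. unfold zeps. simpl. unfold Im, two_pi_i; simpl. ring. Qed.

Lemma one_sub_exp (y : R) : 0 <= y -> Rabs (exp (- y) - 1) <= y.
Proof.
  intros Hy. assert (K := exp_ineq1_le (- y)).
  assert (exp (- y) <= 1) by (rewrite <- exp_0; apply exp_le; lra).
  rewrite Rabs_left1; lra.
Qed.

Lemma Cexp_zeps (n : Z) (e x : R) : Cexp (- (zeps n e * RtoC x)) = (RtoC (exp (- (e * x))) * e2 n x)%C.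
Proof.
  unfold zeps, e2. rewrite <- Cexp_RtoC, <- Cexp_plus. f_equal. rewrite RtoC_opp, RtoC_mult. ring.
Qed.

(** From |e^(-y) - 1| <= y. The price is one power of x, harmless on (0, 1] but asking for Re s > 2
    if the bound is to be integrable at infinity. *)
Lemma gq_diff_bound (n : Z) (s : C) (e x : R) : 0 < e -> 0 < x ->
  Cmod (gq s (zeps n e) x - gq s (two_pi_i n) x) <= e * Rpower x (- (Re s - 1)).
Proof.
  intros He Hx. unfold gq at 1. rewrite Cexp_zeps, gq_e2.
  replace (cpw x (- s) * (RtoC (exp (- (e * x))) * e2 n x) - cpw x (- s) * e2 n x)%C
    with (cpw x (- s) * e2 n x * RtoC (exp (- (e * x)) - 1))%C by (rewrite RtoC_minus; ring).
  rewrite !Cmod_mult, Cmod_e2, Cmod_cpw, Cmod_R, Rmult_1_r by auto.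
  replace (- (Re s - 1)) with (Re (- s)%C + 1) by (rewrite Re_opp; ring).
  rewrite Rpower_plus, Rpower_1 by auto.
  assert (P := Rpower_pos x (Re (- s)%C)).
  assert (B := one_sub_exp (e * x) ltac:(apply Rmult_le_pos; lra)).
  replace (e * (Rpower x (Re (- s)%C) * x)) with (Rpower x (Re (- s)%C) * (e * x)) by ring.
  apply Rmult_le_compat_l; lra.
Qed.

Lemma Qn_lim (n : Z) (s : C) : n <> 0%Z -> Clim (fun e => qq s (zeps n e)) r0 (Qn n s).
Proof.
  intros Hn.
  assert (K : forall k s, 2 < Re s + INR k -> Clim (fun e => qq s (zeps n e)) r0 (Qn n s)).
  2:{ destruct (INR_unbounded (2 - Re s)) as [k Hk]. apply (K k). lra. }
  clear s. induction k as [|k IH]; intros s Hs.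
  - simpl in Hs.
    assert (Hex : exists l, igen (gq s (two_pi_i n)) (pt 1) oo l).
    { apply (igen_dominated (pt 1) oo (fun x => 1 <= x) _ (fun x => Rpower x (- (Re s - 1 + 1))) (/ (Re s - 1))).
      - apply dom_1_infty.
      - intros x Hx. apply Ccont_pos_gq; lra.
      - intros x Hx. apply continuous_Rpower; lra.
      - intros x Hx. rewrite Cmod_gq, Re_two_pi_i by lra. rewrite Rmult_0_l, Ropp_0, exp_0, Rmult_1_r.
        replace (Re s - 1 + 1) with (Re s) by ring. lra.
      - apply rgen_Rpower_infty; lra. }
    destruct Hex as [l Hl]. rewrite (Qn_infty n s l); auto; [|lra].
    intros eps He.
    assert (Hd : 0 < eps * (Re s - 2)) by (apply Rmult_lt_0_compat; lra).
    generalize (at_right_pos _ Hd). apply filter_imp. intros e He1.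
    assert (D := igen_minus (pt 1) oo _ _ _ _ (qq_correct s (zeps n e) ltac:(rewrite Re_zeps; lra)) Hl).
    assert (B : Cmod (qq s (zeps n e) - l) <= e * / (Re s - 2)).
    { refine (igen_norm (pt 1) oo (fun x => 1 <= x) _ (fun x => e * Rpower x (- (Re s - 2 + 1))) _ _ dom_1_infty _ D _).
      - intros x Hx. eapply Rle_trans; [apply gq_diff_bound; lra|]. right. f_equal. f_equal. ring.
      - apply rgen_scal; try typeclasses eauto. apply rgen_Rpower_infty; lra. }
    eapply Rle_lt_trans; [exact B|]. apply (Rmult_lt_reg_r (Re s - 2)); [lra|]. rewrite Rmult_assoc, Rinv_l; lra.
  - assert (Hs1 : 2 < Re (s + 1)%C + INR k). { rewrite S_INR in Hs. simpl. unfold Re in *. lra. }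
    specialize (IH _ Hs1). intros eps He.
    assert (Hz := two_pi_i_neq_0 n Hn).
    (* The recursion divides by z, whose modulus is at least c for every e because the imaginary
       part does not move. [eta] is chosen so that the three error terms, together below eta (2 +
       |s| + |Q(s)|), stay below eps c. *)
    set (c := Cmod (two_pi_i n)). assert (Hc : 0 < c) by (apply Cmod_gt_0; auto).
    assert (HcI : c = Rabs (2 * PI * IZR n)).
    { unfold c, two_pi_i. rewrite Cmod_mult, Cmod_Ci, Cmod_R. ring. }
    set (eta := eps * c / (2 + Cmod s + Cmod (Qn n s))).
    assert (P1 := Cmod_ge_0 s). assert (P2 := Cmod_ge_0 (Qn n s)).
    assert (Heta : 0 < eta). { unfold eta. apply Rdiv_lt_0_compat; [apply Rmult_lt_0_compat; auto|lra]. }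
    generalize (filter_and _ _ (IH eta Heta) (at_right_pos eta Heta)). apply filter_imp. intros e [E1 E2].
    assert (R1 := qq_rec s (zeps n e) ltac:(rewrite Re_zeps; lra)).
    assert (R2 := Qn_rec n s Hn).
    assert (Hzc : c <= Cmod (zeps n e)).
    { rewrite HcI, <- (Im_zeps n e). apply im_le_Cmod. }
    assert (Hexp : Cmod (Cexp (- zeps n e) - 1) <= e).
    { replace (- zeps n e)%C with (- (zeps n e * RtoC 1))%C by ring. rewrite Cexp_zeps, e2_1, Cmult_1_r, Rmult_1_r, <- RtoC_minus, Cmod_R.
      apply one_sub_exp; lra. }
    assert (M : Cmod (zeps n e) * Cmod (qq s (zeps n e) - Qn n s) <= e + Cmod s * Cmod (qq (s + 1) (zeps n e) - Qn n (s + 1)) + e * Cmod (Qn n s)).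
    { rewrite <- Cmod_mult.
      replace (zeps n e * (qq s (zeps n e) - Qn n s))%C with
        ((Cexp (- zeps n e) - 1) + - (s * (qq (s + 1) (zeps n e) - Qn n (s + 1))) + - (RtoC e * Qn n s))%C.
      - eapply Rle_trans; [apply Cmod_triangle|]. rewrite Cmod_opp, Cmod_mult, Cmod_R, Rabs_pos_eq by lra.
        apply Rplus_le_compat_r. eapply Rle_trans; [apply Cmod_triangle|]. rewrite Cmod_opp, Cmod_mult. lra.
      - replace (zeps n e * (qq s (zeps n e) - Qn n s))%C with (zeps n e * qq s (zeps n e) - two_pi_i n * Qn n s - RtoC e * Qn n s)%C
          by (unfold zeps; ring).
        rewrite R1, R2. ring. }
    assert (P3 := Cmod_ge_0 (qq s (zeps n e) - Qn n s)).
    apply (Rmult_lt_reg_l c); auto.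
    apply Rle_lt_trans with (e + Cmod s * Cmod (qq (s + 1) (zeps n e) - Qn n (s + 1)) + e * Cmod (Qn n s)).
    + eapply Rle_trans; [|exact M]. apply Rmult_le_compat_r; auto.
    + assert (X : eta * (2 + Cmod s + Cmod (Qn n s)) = eps * c) by (unfold eta; field; lra).
      assert (Cmod s * Cmod (qq (s + 1) (zeps n e) - Qn n (s + 1)) <= Cmod s * eta) by (apply Rmult_le_compat_l; lra).
      assert (e * Cmod (Qn n s) <= eta * Cmod (Qn n s)) by (apply Rmult_le_compat_r; lra). lra.
Qed.

Lemma Clog_two_pi_i (n : Z) : n <> 0%Z ->
  Clog (two_pi_i n) = (ln (Rabs (2 * PI * IZR n)), if Rle_dec 0 (2 * PI * IZR n) then PI / 2 else - (PI / 2)).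
Proof.
  intros Hn. unfold Clog, Carg. rewrite Re_two_pi_i, Im_two_pi_i.
  replace (Cmod (two_pi_i n)) with (Rabs (2 * PI * IZR n)).
  - replace (0 / Rabs (2 * PI * IZR n)) with 0 by (unfold Rdiv; ring). rewrite acos_0. reflexivity.
  - unfold two_pi_i. rewrite Cmod_mult, Cmod_Ci, Cmod_R. ring.
Qed.

(* [Lg (zeps n e)] for e > 0, rewritten so as to be continuous at e = 0. *)
Definition Le (y e : R) : C :=
  (ln (e ^ 2 + y ^ 2) / 2, (if Rle_dec 0 y then PI / 2 else - (PI / 2)) - atan (e / y)).

Lemma Lg_Le (n : Z) (e : R) : n <> 0%Z -> 0 < e -> Lg (zeps n e) = Le (2 * PI * IZR n) e.
Proof.
  intros Hn He. unfold Lg, Le. rewrite Re_zeps, Im_zeps. f_equal.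
  assert (Hy : 2 * PI * IZR n <> 0).
  { assert (Hz := two_pi_i_neq_0 n Hn). intros E. apply Hz. unfold two_pi_i. rewrite E. ring. }
  set (y := 2 * PI * IZR n) in *.
  destruct (Rle_dec 0 y) as [H|H].
  - replace (y / e) with (/ (e / y)) by (field; lra). apply atan_inv. apply Rdiv_lt_0_compat; lra.
  - replace (y / e) with (- / (e / - y)) by (field; lra). rewrite atan_opp, atan_inv by (apply Rdiv_lt_0_compat; lra).
    replace (e / y) with (- (e / - y)) by (field; lra). rewrite atan_opp. ring.
Qed.

Lemma Ccont_Le (y : R) : y <> 0 -> Ccont (Le y) 0.
Proof.
  intros Hy. assert (0 < y ^ 2) by (apply pow2_gt_0; auto).
  split; unfold Le; simpl.
  - eapply continuous_of_ex_derive. instantiate (1 := 0). auto_derive; [simpl in *; nra|]. field. simpl in *. nra.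
  - eapply continuous_of_ex_derive. instantiate (1 := - / y). auto_derive; auto. field; auto.
Qed.

Lemma Le_0 (n : Z) : n <> 0%Z -> Le (2 * PI * IZR n) 0 = Clog (two_pi_i n).
Proof.
  intros Hn. rewrite Clog_two_pi_i; auto. unfold Le.
  assert (Hy : 2 * PI * IZR n <> 0).
  { assert (Hz := two_pi_i_neq_0 n Hn). intros E. apply Hz. unfold two_pi_i. rewrite E. ring. }
  f_equal.
  - rewrite <- (pow2_abs (2 * PI * IZR n)). replace (0 ^ 2 + Rabs (2 * PI * IZR n) ^ 2) with (Rabs (2 * PI * IZR n) * Rabs (2 * PI * IZR n)) by ring.
    rewrite ln_mult by (apply Rabs_pos_lt; auto). field.
  - unfold Rdiv. rewrite Rmult_0_l, atan_0. ring.
Qed.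

Lemma gq_01_ex (n : Z) (s : C) : Re s < 1 -> exists P, igen (gq s (two_pi_i n)) r0 (pt 1) P.
Proof.
  intros Hs.
  apply (igen_dominated r0 (pt 1) (fun x => 0 < x <= 1) _ (fun x => Rpower x (1 - Re s - 1)) (/ (1 - Re s))).
  - apply dom_0_1.
  - intros x Hx. apply Ccont_pos_gq; lra.
  - intros x Hx. apply continuous_Rpower; lra.
  - intros x Hx. rewrite Cmod_gq, Re_two_pi_i by lra. rewrite Rmult_0_l, Ropp_0, exp_0, Rmult_1_r.
    replace (1 - Re s - 1) with (- Re s) by ring. lra.
  - apply rgen_Rpower_01; lra.
Qed.

(** For z = e + 2 pi i n with e > 0 the Laplace integral splits at x = 1 and is evaluated by
    [Lint_Gamma]. Both pieces and the value converge as e tends to 0, and the principal logarithm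
    appears because [Le] extends [Lg] continuously to the imaginary axis. *)
Lemma PQ_value (n : Z) (s P : C) : n <> 0%Z -> Re s < 1 -> igen (gq s (two_pi_i n)) r0 (pt 1) P ->
  (P + Qn n s = Gamma (1 - s) * Cpower (two_pi_i n) (s - 1))%C.
Proof.
  intros Hn Hs HP.
  assert (Hw : 0 < Re (1 - s)%C) by (simpl; unfold Re in *; lra).
  assert (Hy : 2 * PI * IZR n <> 0).
  { assert (Hz := two_pi_i_neq_0 n Hn). intros E. apply Hz. unfold two_pi_i. rewrite E. ring. }
  set (V := fun e => (Gamma (1 - s) * Cexp (- ((1 - s) * Le (2 * PI * IZR n) e)))%C).
  assert (HV : Clim V r0 (V 0)).
  { apply Ccont_Clim_right. unfold V. apply Ccont_mult; [apply Ccont_const|]. apply Ccont_Cexp, Ccont_opp.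
    apply Ccont_mult; [apply Ccont_const|]. apply Ccont_Le; auto. }
  assert (V0 : V 0 = (Gamma (1 - s) * Cpower (two_pi_i n) (s - 1))%C).
  { unfold V, Cpower. rewrite Le_0; auto. f_equal. f_equal. ring. }
  rewrite <- V0.
  destruct (Req_dec (Cmod (P + Qn n s - V 0)) 0) as [E|E].
  { apply Cmod_eq_0 in E. replace (P + Qn n s)%C with (P + Qn n s - V 0 + V 0)%C by ring. rewrite E. ring. }
  (* If the two sides were at distance d, a single small e would bring each of the three quantities
     within d/3 of its limit. The integral over (0, 1] moves by at most e / (2 - Re s), which
     dictates the range of e. *)
  exfalso. set (d := Cmod (P + Qn n s - V 0)) in *.
  assert (Hd : 0 < d) by (unfold d in *; generalize (Cmod_ge_0 (P + Qn n s - V 0)); lra).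
  assert (Hd3 : 0 < d / 3) by lra.
  assert (Hr : 0 < d / 3 * (2 - Re s)) by (apply Rmult_lt_0_compat; lra).
  assert (F := filter_and _ _ (HV _ Hd3) (filter_and _ _ (Qn_lim n s Hn _ Hd3) (at_right_pos _ Hr))).
  apply filter_ex in F. destruct F as [e [F1 [F2 F3]]].
  assert (Hze : 0 < Re (zeps n e)) by (rewrite Re_zeps; lra).
  assert (HPe : exists Pe, igen (gq s (zeps n e)) r0 (pt 1) Pe).
  { apply (igen_dominated r0 (pt 1) (fun x => 0 < x <= 1) _ (fun x => Rpower x (1 - Re s - 1)) (/ (1 - Re s))).
    - apply dom_0_1.
    - intros x Hx. apply Ccont_pos_gq; lra.
    - intros x Hx. apply continuous_Rpower; lra.
    - intros x Hx. rewrite Cmod_gq by lra. replace (1 - Re s - 1) with (- Re s) by ring.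
      rewrite <- (Rmult_1_r (Rpower x (- Re s))) at 2. apply Rmult_le_compat_l; [left; apply Rpower_pos|].
      rewrite <- exp_0. apply exp_le. rewrite Re_zeps. assert (0 < e * x) by (apply Rmult_lt_0_compat; lra). lra.
    - apply rgen_Rpower_01; lra. }
  destruct HPe as [Pe HPe].
  assert (T : (Pe + qq s (zeps n e) = V e)%C).
  { unfold V. rewrite <- Lg_Le by (auto; lra). rewrite <- Lint_Gamma; auto.
    apply (igen_unique r0 oo (gq s (zeps n e))).
    - apply (is_RInt_gen_Chasles (V := C_R_NormedModule) (Fa := r0) (Fc := oo) (gq s (zeps n e)) 1); [exact HPe|apply qq_correct; auto].
    - apply (igen_ext_all r0 oo (Lk (1 - s) (zeps n e))); [|apply Lint_correct; auto].
      intros x. unfold Lk, gq. f_equal. f_equal. ring. }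
  assert (D := igen_minus r0 (pt 1) _ _ _ _ HPe HP).
  assert (B : Cmod (Pe - P) <= e * / (2 - Re s)).
  { refine (igen_norm r0 (pt 1) (fun x => 0 < x <= 1) _ (fun x => e * Rpower x (2 - Re s - 1)) _ _ dom_0_1 _ D _).
    - intros x Hx. eapply Rle_trans; [apply gq_diff_bound; lra|]. right. f_equal. f_equal. ring.
    - apply rgen_scal; try typeclasses eauto. apply rgen_Rpower_01; lra. }
  assert (B2 : e * / (2 - Re s) < d / 3).
  { apply (Rmult_lt_reg_r (2 - Re s)); [lra|]. rewrite Rmult_assoc, Rinv_l; lra. }
  assert (X : d <= Cmod (Pe - P) + Cmod (qq s (zeps n e) - Qn n s) + Cmod (V e - V 0)).
  { unfold d.
    replace (P + Qn n s - V 0)%C with (- (Pe - P) + - (qq s (zeps n e) - Qn n s) + (V e - V 0))%C by (rewrite <- T; ring).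
    eapply Rle_trans; [apply Cmod_triangle|]. apply Rplus_le_compat_r.
    eapply Rle_trans; [apply Cmod_triangle|]. rewrite !Cmod_opp. lra. }
  lra.
Qed.

(** The pieces a^(-s), Y(s, a + 1) and 1 / (s - 1) are integrated separately; the last survives only
    for n = 0, and keeping it serves both kinds of coefficient. *)
Lemma igen_Zt_e2 (n : Z) (s P : C) : Re s < 1 -> igen (gq s (two_pi_i n)) r0 (pt 1) P ->
  igen (fun a => Zt s a * e2 n a)%C r0 (pt 1) (P + Qn n s + (if Z.eq_dec n 0 then RtoC 1 else RtoC 0) / (s - 1))%C.
Proof.
  intros Hs HP.
  apply (igen_ext r0 (pt 1) (fun x => 0 < x <= 1) (fun a => gq s (two_pi_i n) a + Yz s (1 + a) * e2 n (1 + a) + / (s - 1) * e2 n a)%C).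
  { apply dom_0_1. }
  { intros a Ha. rewrite gq_e2. unfold Zt.
    replace (Yz s a) with (cpw a (- s) + Yz s (a + 1))%C by (rewrite Yz_shift by lra; ring).
    rewrite (Rplus_comm 1 a), e2_S. ring. }
  apply igen_plus; try typeclasses eauto; [apply igen_plus; try typeclasses eauto; auto|].
  - unfold Qn. set (f := fun x => (Yz s x * e2 n x)%C). replace 2 with (1 + 1) by ring.
    replace (prim f 1) with (prim f (1 + 0)) by (f_equal; ring).
    apply (igen_right_ftc (fun u => prim f (1 + u))).
    + intros x Hx. apply (Cder_shift (prim f)). apply prim_Cder; [apply Ccont_pos_Ye|lra].
    + intros x Hx. apply (Ccont_shift f). apply Ccont_pos_Ye. lra.
    + apply Ccont_shift. apply Ccont_pos_prim; [apply Ccont_pos_Ye|lra].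
  - unfold Cdiv. rewrite Cmult_comm. apply igen_scal; try typeclasses eauto.
    destruct (Z.eq_dec n 0) as [->|Hn].
    + apply (igen_ext_all r0 (pt 1) (fun _ => RtoC 1)).
      { intros x. rewrite e2_zero; auto. }
      eapply igen_eq; [apply (igen_right_ftc (fun x => RtoC x))|].
      * intros x _. apply Cder_id.
      * intros; apply Ccont_const.
      * eapply Cder_cont, Cder_id.
      * ring.
    + assert (Hz := two_pi_i_neq_0 n Hn).
      eapply igen_eq; [apply (igen_right_ftc (fun x => - / two_pi_i n * e2 n x)%C)|].
      * intros x _. eapply Cder_eq; [apply Cder_scal, Cder_e2|]. field; auto.
      * intros x _. apply Ccont_e2.
      * apply Ccont_mult; [apply Ccont_const|apply Ccont_e2].
      * cbv beta. rewrite e2_0, e2_1. ring.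
Qed.

Lemma fourier_zeta (n : Z) (s : C) : Re s < 1 -> n <> 0%Z ->
  igen (fun a => Zt s a * e2 n a)%C r0 (pt 1) (Gamma (1 - s) * Cpower (two_pi_i n) (s - 1))%C.
Proof.
  intros Hs Hn. destruct (gq_01_ex n s Hs) as [P HP].
  assert (K := igen_Zt_e2 n s P Hs HP). destruct (Z.eq_dec n 0) as [E|_]; [contradiction|].
  rewrite <- (PQ_value n s P); auto. eapply igen_eq; [exact K|]. unfold Cdiv; ring.
Qed.

(** The mean 1 / (1 - s) of a^(-s) cancels the constant 1 / (s - 1), and int_1^2 Y vanishes by
    [Yz_mean] at a = 1. *)
Lemma fourier_zeta_0 (s : C) : Re s < 1 -> igen (fun a => Zt s a * e2 0 a)%C r0 (pt 1) 0.
Proof.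
  intros Hs. assert (Hn : (s - 1)%C <> 0) by (apply C_neq_Re; lra).
  assert (Hn2 : (1 - s)%C <> 0). { apply Cminus_sym_neq_0; auto. }
  assert (E0 := e2_zero).
  assert (HP : igen (gq s (two_pi_i 0)) r0 (pt 1) (/ (1 - s) * cpw 1 (1 - s) - 0)%C).
  { apply (igen_ftc r0 (pt 1) (fun x => / (1 - s) * cpw x (1 - s))%C _ (fun x => 0 < x <= 1)).
    - apply dom_0_1.
    - intros x Hx. eapply Cder_eq; [apply Cder_scal, Cder_cpw; lra|].
      rewrite gq_e2, E0. replace (1 - s - 1)%C with (- s)%C by ring. field; auto.
    - intros x Hx. apply Ccont_pos_gq; lra.
    - intros eps He. assert (Hc : 0 < Cmod (1 - s)) by (apply Cmod_gt_0; auto).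
      destruct (Rpower_small (1 - Re s) (eps * Cmod (1 - s)) ltac:(lra) ltac:(apply Rmult_lt_0_compat; auto)) as [d [Hd H]].
      generalize (at_right_pos d Hd). apply filter_imp. intros x Hx.
      replace (/ (1 - s) * cpw x (1 - s) - 0)%C with (/ (1 - s) * cpw x (1 - s))%C by ring.
      rewrite Cmod_mult, Cmod_inv, Cmod_cpw by (auto; lra).
      replace (Re (1 - s)%C) with (1 - Re s) by reflexivity.
      apply (Rmult_lt_reg_l (Cmod (1 - s))); auto. rewrite <- Rmult_assoc, Rinv_r by lra.
      specialize (H x Hx). lra.
    - apply (Clim_point (fun x => / (1 - s) * cpw x (1 - s))%C). }
  assert (K := igen_Zt_e2 0 s _ Hs HP). simpl in K. eapply igen_eq; [exact K|].
  assert (Q0 : Qn 0 s = 0).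
  { unfold Qn. assert (M := Yz_mean s 1 ltac:(lra)).
    replace (fun x => Yz s x * e2 0 x)%C with (Yz s).
    - replace 2 with (1 + 1) by ring. rewrite M. unfold Epw. ring.
    - apply functional_extensionality. intros x. rewrite E0. ring. }
  rewrite Q0, cpw_one. field. auto.
Qed.

(** * From zeta to its derivatives in s *)

Lemma Rpower_le_small (a p q : R) : 0 < a <= 1 -> p <= q -> Rpower a q <= Rpower a p.
Proof.
  intros Ha Hpq. unfold Rpower. apply exp_le.
  assert (ln a <= 0) by (rewrite <- ln_1; apply Rcomplements.ln_le; lra). nra.
Qed.

(** On (0, 1] a power with exponent at least -beta is below a^(-beta), and beta >= 0 lets this power
    absorb the constant as well; [rho] is taken so small that both -Re s0 + rho and -Re s0 - rho
    qualify. *)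
Lemma zeta_coef_bound (s0 : C) (A : nat -> R -> C) (beta : R) : s0 <> 1%C -> Re s0 < beta -> 0 <= beta ->
  (forall rho, 0 < rho <= Rmin (1 / 2) (Cmod (s0 - 1)) -> exists M, 0 <= M /\ forall k a, 0 < a ->
     a <= 1 -> Cmod (A k a) * rho ^ k <= Rpower a (- Re s0) * (Rpower a rho + Rpower a (- rho)) + M) ->
  exists rho K, 0 < rho < Rmin 1 (Cmod (s0 - 1)) /\ Re s0 + rho <= beta /\
    forall k a, 0 < a <= 1 -> Cmod (A k a) * rho ^ k <= K * Rpower a (- beta).
Proof.
  intros Hs Hb Hb0 H.
  assert (Hv0 := Cmod_minus_pos s0 1 Hs).
  set (m := Rmin (1 / 2) (Cmod (s0 - 1))).
  assert (Hm : 0 < m) by (apply Rmin_pos; lra).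
  assert (Hm1 : m <= 1 / 2) by apply Rmin_l. assert (Hm2 : m <= Cmod (s0 - 1)) by apply Rmin_r.
  set (rho := Rmin (m / 2) (beta - Re s0)).
  assert (Hr : 0 < rho) by (apply Rmin_pos; lra).
  assert (Hr1 : rho <= m / 2) by apply Rmin_l. assert (Hr2 : rho <= beta - Re s0) by apply Rmin_r.
  destruct (H rho ltac:(fold m; lra)) as [M [HM0 HM]].
  exists rho, (2 + M). split; [|split].
  - split; auto. apply Rmin_glb_lt; lra.
  - lra.
  - intros k a Ha. eapply Rle_trans; [apply HM; lra|].
    rewrite Rmult_plus_distr_l, <- !Rpower_plus.
    assert (K1 := Rpower_le_small a (- beta) (- Re s0 + rho) Ha ltac:(lra)).
    assert (K2 := Rpower_le_small a (- beta) (- Re s0 + - rho) Ha ltac:(lra)).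
    assert (K3 : 1 <= Rpower a (- beta)).
    { rewrite <- (Rpower_O a) by lra. apply Rpower_le_small; lra. }
    nra.
Qed.

Lemma neq_1_Re (s : C) : Re s < 1 -> s <> 1%C.
Proof. intros H E. rewrite E in H. simpl in H. lra. Qed.

(** Termwise integration gives a power series for [c (s0 + h)] whose coefficients are the integrals
    in question; uniqueness of Taylor coefficients equates them with the [D k], which are known from
    a closed form. *)
Lemma zeta_coef_fourier (s0 : C) (A : nat -> R -> C) (n : Z) (c : C -> C) (D : nat -> C) (rD : R) : Re s0 < 1 ->
  (forall k, Ccont_pos (A k)) ->
  (forall rho, 0 < rho <= Rmin (1 / 2) (Cmod (s0 - 1)) -> exists M, 0 <= M /\ forall k a, 0 < a ->
     a <= 1 -> Cmod (A k a) * rho ^ k <= Rpower a (- Re s0) * (Rpower a rho + Rpower a (- rho)) + M) ->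
  (forall h a, Cmod h < Rmin 1 (Cmod (s0 - 1)) -> 0 < a -> cser (fun k => A k a * h ^ k)%C (Zt (s0 + h) a)) ->
  (forall s, Re s < 1 -> igen (fun a => Zt s a * e2 n a)%C r0 (pt 1) (c s)) ->
  0 < rD -> (forall h, Cmod h < rD -> Re (s0 + h)%C < 1 -> cser (fun k => D k * h ^ k)%C (c (s0 + h)%C)) ->
  forall k, igen (fun a => A k a * e2 n a)%C r0 (pt 1) (D k).
Proof.
  intros Hs HA HB HS HF HrD HD.
  (* Midway between max(Re s0, 0) and 1, so that a^(-beta) dominates the coefficients and is
     integrable on (0, 1]. *)
  set (beta := (1 + Rmax (Re s0) 0) / 2).
  assert (Hmx : Rmax (Re s0) 0 < 1) by (apply Rmax_lub_lt; lra).
  assert (H1 := Rmax_l (Re s0) 0). assert (H2 := Rmax_r (Re s0) 0).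
  destruct (zeta_coef_bound s0 A beta (neq_1_Re _ Hs) ltac:(unfold beta; lra) ltac:(unfold beta; lra) HB)
    as [rho [K [Hr [Hrb HK]]]].
  assert (HM : rgen (fun x => K * Rpower x (1 - beta - 1)) r0 (pt 1) (K * / (1 - beta))).
  { apply rgen_scal; try typeclasses eauto. apply rgen_Rpower_01. unfold beta; lra. }
  assert (HMc : forall x, 0 < x <= 1 -> continuous (fun x => K * Rpower x (1 - beta - 1)) x).
  { intros x Hx. apply (continuous_mult (K := R_AbsRing) (fun _ => K)); [apply continuous_const|apply continuous_Rpower; lra]. }
  assert (HKe : forall k x, 0 < x <= 1 -> Cmod (A k x * e2 n x) * rho ^ k <= K * Rpower x (1 - beta - 1)).
  { intros k x Hx. rewrite Cmod_mult, Cmod_e2, Rmult_1_r. replace (1 - beta - 1) with (- beta) by ring. auto. }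
  assert (HI : exists I, forall k, igen (fun a => A k a * e2 n a)%C r0 (pt 1) (I k)).
  { apply (choice_C (fun k l => igen (fun a => A k a * e2 n a)%C r0 (pt 1) l)). intros k.
    assert (Pr : 0 < rho ^ k) by (apply pow_lt; lra).
    apply (igen_dominated r0 (pt 1) (fun x => 0 < x <= 1) _ (fun x => / rho ^ k * (K * Rpower x (1 - beta - 1))) (/ rho ^ k * (K * / (1 - beta)))).
    - apply dom_0_1.
    - intros x Hx. apply Ccont_mult; [apply HA; lra|apply Ccont_e2].
    - intros x Hx. apply (continuous_mult (K := R_AbsRing) (fun _ => / rho ^ k)); [apply continuous_const|auto].
    - intros x Hx. apply (Rmult_le_reg_l (rho ^ k)); auto. rewrite <- (Rmult_assoc _ (/ rho ^ k)), Rinv_r, Rmult_1_l by lra.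
      rewrite Rmult_comm. auto.
    - apply rgen_scal; auto; typeclasses eauto. }
  destruct HI as [I HI].
  assert (HIs : forall h, Cmod h < rho -> cser (fun k => I k * h ^ k)%C (c (s0 + h)%C)).
  { intros h Hh.
    assert (Hsh : Re (s0 + h)%C < 1).
    { assert (Q := re_le_Cmod h). assert (Q2 : Rabs (Re h) < rho) by lra. apply Rabs_def2 in Q2.
      unfold beta in *. simpl. unfold Re in *. lra. }
    destruct (igen_series r0 (pt 1) (fun x => 0 < x <= 1) (fun k a => A k a * e2 n a)%C (fun a => Zt (s0 + h) a * e2 n a)%C I
       (fun x => K * Rpower x (1 - beta - 1)) (K * / (1 - beta)) rho h) as [L [L1 L2]]; auto; try lra.
    - apply dom_0_1.
    - intros x Hx. apply Ccont_mult; [|apply Ccont_e2]. unfold Zt. apply Ccont_plus; [apply Ccont_pos_Yz; lra|apply Ccont_const].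
    - intros x Hx. apply (cser_ext (fun k => e2 n x * (A k x * h ^ k))%C). intros; ring.
      rewrite Cmult_comm. apply cser_scal, HS; lra.
    - rewrite (igen_unique r0 (pt 1) _ _ _ (HF _ Hsh) L1). auto. }
  assert (Hm : 0 < Rmin rho rD) by (apply Rmin_pos; lra).
  assert (Hm1 := Rmin_l rho rD). assert (Hm2 := Rmin_r rho rD).
  assert (E : forall k, I k = D k).
  { apply (ps_coef_unique I D s0 (Rmin rho rD / 2) c).
    - apply (ps_of_cser _ _ _ (Rmin rho rD)); [lra|]. intros h Hh. apply HIs; lra.
    - apply (ps_of_cser _ _ _ (Rmin rho rD)); [lra|]. intros h Hh. apply HD; [lra|].
      assert (Q := re_le_Cmod h). assert (Q2 : Rabs (Re h) < rho) by lra. apply Rabs_def2 in Q2.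
      unfold beta in *. simpl. unfold Re in *. lra. }
  intros k. rewrite <- E. auto.
Qed.

(** The coefficient of h^m in e^(hL) Gamma(1 - s - h), as a Cauchy product; the sign comes from
    expanding Gamma in powers of -h. *)
Definition Dcoef (s L : C) (g : nat -> C) (m : nat) : C :=
  csum (fun k => expc L k * (g (m - k)%nat * RtoC ((-1) ^ (m - k))))%C (S m).

Lemma Dcoef_series (s z : C) (g : nat -> C) (rho : R) (h : C) :
  ps g (1 - s) rho Gamma -> Cmod h < rho ->
  cser (fun k => Cpower z (s - 1) * Dcoef s (Clog z) g k * h ^ k)%C (Gamma (1 - (s + h)) * Cpower z (s + h - 1))%C.
Proof.
  intros Hg Hh. set (L := Clog z).
  assert (E1 : cser (fun k => expc L k * h ^ k)%C (Cexp (h * L))).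
  { apply (cser_ext (expc (h * L))); [|apply Cexp_series]. intros k. unfold expc. rewrite Cpow_mult_l. ring. }
  assert (E2 : cser (fun k => g k * RtoC ((-1) ^ k) * h ^ k)%C (Gamma (1 - (s + h)))).
  { destruct Hg as [H1 [H2 H3]]. assert (K := H3 (- h)%C ltac:(rewrite Cmod_opp; auto)).
    replace (1 - s + - h)%C with (1 - (s + h))%C in K by ring.
    revert K. apply cser_ext. intros k. replace (- h)%C with (RtoC (-1) * h)%C.
    - rewrite Cpow_mult_l, <- RtoC_pow. ring.
    - replace (-1) with (- (1)) by ring. rewrite RtoC_opp. ring. }
  assert (A1 : ex_series (fun k => Cmod (expc L k * h ^ k))).
  { apply (ps_ex_series (expc L) (Cmod h + 1) h).
    - generalize (Cmod_ge_0 h). lra.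
    - exists (exp (Cmod L * (Cmod h + 1))). intros k. assert (Hh0 := Cmod_ge_0 h). assert (HL0 := Cmod_ge_0 L).
      unfold expc. rewrite Cmod_mult, Cmod_pow, Cmod_R, Rabs_pos_eq by (left; apply Rinv_0_lt_compat, INR_fact_lt_0).
      eapply Rle_trans; [|apply (pow_fact_le_exp _ k)].
      + right. rewrite Rpow_mult_distr. unfold Rdiv. ring.
      + apply Rmult_le_pos; lra.
    - lra. }
  assert (A2 : ex_series (fun k => Cmod (g k * RtoC ((-1) ^ k) * h ^ k))).
  { apply (ex_series_ext (fun k => Cmod (g k * h ^ k))).
    - intros k. rewrite !Cmod_mult, Cmod_R, pow_1_abs. rewrite Rmult_1_r; auto.
    - destruct Hg as [H1 [H2 _]]. apply (ps_ex_series g rho h); auto. }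
  assert (M := cser_mult _ _ _ _ E1 E2 A1 A2).
  replace (Gamma (1 - (s + h)) * Cpower z (s + h - 1))%C with (Cpower z (s - 1) * (Cexp (h * L) * Gamma (1 - (s + h))))%C.
  - apply (cser_scal (Cpower z (s - 1))) in M. revert M. apply cser_ext. intros m.
    rewrite <- !Cmult_assoc. f_equal. unfold Dcoef.
    rewrite Cmult_comm, <- csum_scal. apply csum_ext. intros k Hk.
    replace (h ^ m)%C with (h ^ k * h ^ (m - k))%C.
    + ring.
    + rewrite <- Cpow_add_r. f_equal. lia.
  - unfold Cpower. fold L. replace ((s + h - 1) * L)%C with ((s - 1) * L + h * L)%C by ring. rewrite Cexp_plus. ring.
Qed.

(** A Taylor coefficient of Gamma of order r - k is its derivative over (r - k)!, so multiplication
    by r! / k! produces the binomial coefficient. *)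
Lemma Dcoef_gamma_log_sum (r : nat) (s L : C) (g : nat -> C) (rho : R) : ps g (1 - s) rho Gamma ->
  (RtoC (INR (fact r)) * Dcoef s L g r)%C = gamma_log_sum r s L.
Proof.
  intros Hg. unfold Dcoef, gamma_log_sum. rewrite csum_sum_n, <- csum_scal. apply csum_ext. intros k Hk.
  rewrite (C_derive_n_ps (r - k) _ _ _ _ Hg). unfold expc, Binomial.C.
  assert (F1 := INR_fact_neq_0 r). assert (F2 := INR_fact_neq_0 k). assert (F3 := INR_fact_neq_0 (r - k)).
  rewrite !RtoC_mult, RtoC_div, RtoC_mult, RtoC_inv; auto.
  assert (N2 : RtoC (INR (fact k)) <> 0) by (intros E; apply RtoC_inj in E; auto).
  assert (N3 : RtoC (INR (fact (r - k))) <> 0) by (intros E; apply RtoC_inj in E; auto).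
  field. auto.
Qed.

(** Packages everything used later into one function that is continuous for a > 0, so that neither
    the choice operator nor a derivative in s enters the Parseval argument. *)
Lemma zeta_derive_fourier (r : nat) (s : C) : Re s < 1 -> exists f : R -> C,
  Ccont_pos f /\ (forall a, 0 < a -> hurwitz_zeta_derive r s a = f a) /\
  (forall beta, Re s < beta -> 0 <= beta -> exists K, forall a, 0 < a <= 1 -> Cmod (f a) <= K * Rpower a (- beta)) /\
  igen (fun a => f a * e2 0 a)%C r0 (pt 1) 0 /\
  (forall n, n <> 0%Z -> igen (fun a => f a * e2 n a)%C r0 (pt 1)
     (Cpower (two_pi_i n) (s - 1) * gamma_log_sum r s (Clog (two_pi_i n)))%C).
Proof.
  intros Hs. destruct (zeta_taylor s (neq_1_Re _ Hs)) as [A [A1 [A2 A3]]].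
  assert (Hw : 0 < Re (1 - s)%C) by (simpl; unfold Re in *; lra).
  destruct (Gamma_ps (1 - s) Hw) as [g [rho Hg]].
  assert (Hrho : 0 < rho) by (destruct Hg; auto).
  exists (fun a => RtoC (INR (fact r)) * A r a)%C. split; [|split; [|split; [|split]]].
  - intros x Hx. apply Ccont_mult; [apply Ccont_const|apply A1; auto].
  - intros a Ha. apply hurwitz_zeta_derive_eq; auto. apply neq_1_Re; auto.
  - intros beta Hb Hb0. destruct (zeta_coef_bound s A beta (neq_1_Re _ Hs) Hb Hb0 A2) as [rr [K [Hr [_ HK]]]].
    exists (INR (fact r) * / rr ^ r * K). intros a Ha.
    assert (Pr : 0 < rr ^ r) by (apply pow_lt; lra).
    rewrite Cmod_mult, Cmod_R, Rabs_pos_eq, !Rmult_assoc by (left; apply INR_fact_lt_0).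
    apply Rmult_le_compat_l; [left; apply INR_fact_lt_0|].
    apply (Rmult_le_reg_l (rr ^ r)); auto. rewrite <- (Rmult_assoc _ (/ rr ^ r)), Rinv_r, Rmult_1_l by lra.
    rewrite Rmult_comm. auto.
  - apply (igen_ext_all r0 (pt 1) (fun a => RtoC (INR (fact r)) * (A r a * e2 0 a))%C). intros; ring.
    eapply igen_eq; [apply igen_scal; try typeclasses eauto|].
    + apply (zeta_coef_fourier s A 0 (fun _ => RtoC 0) (fun _ => RtoC 0) 1); auto; try lra.
      * intros z Hz. apply fourier_zeta_0; auto.
      * intros h _ _. apply (cser_ext (fun _ => RtoC 0)); [intros; ring|apply cser_zero].
    + ring.
  - intros n Hn.
    apply (igen_ext_all r0 (pt 1) (fun a => RtoC (INR (fact r)) * (A r a * e2 n a))%C). intros; ring.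
    eapply igen_eq; [apply igen_scal; try typeclasses eauto|].
    + apply (zeta_coef_fourier s A n (fun z => Gamma (1 - z) * Cpower (two_pi_i n) (z - 1))%C
        (fun k => Cpower (two_pi_i n) (s - 1) * Dcoef s (Clog (two_pi_i n)) g k)%C rho); auto.
      * intros z Hz. apply fourier_zeta; auto.
      * intros h Hh _. apply (Dcoef_series s (two_pi_i n) g rho h); auto.
    + rewrite <- (Dcoef_gamma_log_sum r s _ g rho Hg). ring.
Qed.

(** * Parseval's equation *)

(** Trigonometric polynomials of degree at most N. Closure under pointwise equality is a
    constructor, so that sums may be rearranged freely, and inductions on the predicate replace
    lists of coefficients. *)
Inductive TP (N : nat) : (R -> C) -> Prop :=
| TP_zero : TP N (fun _ => RtoC 0)
| TP_add : forall p d n, TP N p -> (Z.abs n <= Z.of_nat N)%Z -> TP N (fun x => p x + d * e2 n x)%C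
| TP_ext : forall p q, TP N p -> (forall x, p x = q x) -> TP N q.

Lemma TP_plus (N : nat) (p q : R -> C) : TP N p -> TP N q -> TP N (fun x => p x + q x)%C.
Proof.
  intros Hp Hq. induction Hq as [|q d n Hq IH Hn|q q' Hq IH E].
  - apply (TP_ext N p); auto. intros; ring.
  - apply (TP_ext N (fun x => (p x + q x) + d * e2 n x)%C); [|intros; ring]. apply TP_add; auto.
  - apply (TP_ext N (fun x => p x + q x)%C); auto. intros; rewrite E; auto.
Qed.

Lemma TP_scal (N : nat) (c : C) (p : R -> C) : TP N p -> TP N (fun x => c * p x)%C.
Proof.
  intros Hp. induction Hp as [|q d n Hq IH Hn|q q' Hq IH E].
  - apply (TP_ext N (fun _ => RtoC 0)); [apply TP_zero|intros; ring].
  - apply (TP_ext N (fun x => c * q x + (c * d) * e2 n x)%C); [|intros; ring]. apply TP_add; auto.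
  - apply (TP_ext N (fun x => c * q x)%C); auto. intros; rewrite E; auto.
Qed.

Lemma TP_minus (N : nat) (p q : R -> C) : TP N p -> TP N q -> TP N (fun x => p x - q x)%C.
Proof.
  intros Hp Hq. apply (TP_ext N (fun x => p x + - (1) * q x)%C); [|intros; ring].
  apply TP_plus; auto. apply TP_scal; auto.
Qed.

Lemma TP_mono (N M : nat) (p : R -> C) : (N <= M)%nat -> TP N p -> TP M p.
Proof.
  intros HNM Hp. induction Hp as [|q d n Hq IH Hn|q q' Hq IH E].
  - apply TP_zero.
  - apply TP_add; auto. lia.
  - apply (TP_ext M q); auto.
Qed.

Lemma TP_e2 (N : nat) (n : Z) (d : C) : (Z.abs n <= Z.of_nat N)%Z -> TP N (fun x => d * e2 n x)%C.
Proof.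
  intros Hn. apply (TP_ext N (fun x => 0 + d * e2 n x)%C); [|intros; ring].
  apply (TP_add N (fun _ => RtoC 0)); auto. apply TP_zero.
Qed.

Lemma TP_mult_e2 (N : nat) (m : Z) (p : R -> C) : (Z.abs m <= 1)%Z -> TP N p -> TP (S N) (fun x => p x * e2 m x)%C.
Proof.
  intros Hm Hp. induction Hp as [|q d n Hq IH Hn|q q' Hq IH E].
  - apply (TP_ext (S N) (fun _ => RtoC 0)); [apply TP_zero|intros; ring].
  - apply (TP_ext (S N) (fun x => q x * e2 m x + d * e2 (n + m) x)%C).
    + apply TP_add; auto. lia.
    + intros x. rewrite <- e2_plus. ring.
  - apply (TP_ext (S N) (fun x => q x * e2 m x)%C); auto. intros; rewrite E; auto.
Qed.

Lemma TP_Ccont (N : nat) (p : R -> C) (x : R) : TP N p -> Ccont p x.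
Proof.
  intros Hp. induction Hp as [|q d n Hq IH Hn|q q' Hq IH E].
  - apply Ccont_const.
  - apply Ccont_plus; auto. apply Ccont_mult; [apply Ccont_const|apply Ccont_e2].
  - apply (Ccont_ext q); auto.
Qed.

Lemma Cconj_e2 (n : Z) (x : R) : Cconj (e2 n x) = e2 (- n) x.
Proof.
  assert (E : (e2 n x * e2 (- n) x = 1)%C).
  { rewrite e2_plus. replace (n + - n)%Z with 0%Z by lia.
    apply e2_zero. }
  assert (E2 : (e2 n x * Cconj (e2 n x) = 1)%C) by (rewrite <- Cmod2_conj, Cmod_e2; apply f_equal; ring).
  rewrite <- (Cmult_1_l (Cconj _)), <- E.
  rewrite (Cmult_comm (e2 n x)), <- Cmult_assoc, E2. ring.
Qed.

Lemma Cconj_plus (z w : C) : Cconj (z + w) = (Cconj z + Cconj w)%C.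
Proof. apply C_eq; simpl; ring. Qed.
Lemma Cconj_mult (z w : C) : Cconj (z * w) = (Cconj z * Cconj w)%C.
Proof. apply C_eq; simpl; ring. Qed.
Lemma Cconj_0 : Cconj 0 = 0.
Proof. apply C_eq; simpl; ring. Qed.

Lemma TP_orthogonal (N : nat) (p g : R -> C) : TP N p ->
  (forall m, (Z.abs m <= Z.of_nat N)%Z -> igen (fun x => g x * e2 m x)%C r0 (pt 1) 0) ->
  igen (fun x => g x * Cconj (p x))%C r0 (pt 1) 0.
Proof.
  intros Hp Hg. induction Hp as [|q d n Hq IH Hn|q q2 Hq IH E].
  - apply (igen_ext_all r0 (pt 1) (fun _ => RtoC 0)); [|apply igen_zero; typeclasses eauto].
    intros x. rewrite Cconj_0. ring.
  - apply (igen_ext_all r0 (pt 1) (fun x => g x * Cconj (q x) + Cconj d * (g x * e2 (- n) x))%C).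
    { intros x. rewrite Cconj_plus, Cconj_mult, Cconj_e2. ring. }
    eapply igen_eq; [apply igen_plus; try typeclasses eauto; [exact IH|apply igen_scal; try typeclasses eauto; apply Hg; lia]|]. ring.
  - apply (igen_ext_all r0 (pt 1) (fun x => g x * Cconj (q x))%C); auto. intros x; rewrite E; auto.
Qed.

(** Brings proper integrals of continuous functions into the setting improper at 0, where the
    integrals of [f] live. *)
Lemma igen_pt_right (f : R -> C) (l : C) : (forall x, Ccont f x) -> igen f (pt 0) (pt 1) l -> igen f r0 (pt 1) l.
Proof.
  intros Hf Hl.
  (* shift the variable so that prim, based at 1/2, is differentiable on a neighbourhood of 0 *)
  set (h := fun x => f (x - 1)).
  assert (Hh : Ccont_pos h).
  { intros x _. unfold h. apply (Ccont_comp f (fun t => t - 1)); auto.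
    apply (continuous_minus (V := R_NormedModule) (fun t => t) (fun _ => 1)); [apply continuous_id|apply continuous_const]. }
  assert (E : forall x, h (1 + x) = f x) by (intros x; unfold h; f_equal; ring).
  assert (D : forall x, 0 <= x -> Cder (fun x => prim h (1 + x)) x (f x)).
  { intros x Hx. rewrite <- E. apply Cder_shift, prim_Cder; auto. lra. }
  assert (El : l = (prim h (1 + 1) - prim h (1 + 0))%C).
  { apply (igen_unique (pt 0) (pt 1) f _ _ Hl).
    apply (igen_points_ftc (fun x => prim h (1 + x))); [lra| |]; intros x Hx; auto. apply D; lra. }
  rewrite El. apply (igen_right_ftc (fun x => prim h (1 + x))); auto.
  - intros x Hx. apply D; lra.
  - eapply Cder_cont. apply D. lra.
Qed.

Lemma igen_e2_right (n : Z) : igen (e2 n) r0 (pt 1) (if Z.eq_dec n 0 then RtoC 1 else RtoC 0).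
Proof. apply igen_pt_right; [apply Ccont_e2|apply igen_e2]. Qed.

Section Parseval.

Context (f : R -> C) (c : Z -> C) (I : R).
Hypothesis Hc : forall n, igen (fun x => f x * e2 n x)%C r0 (pt 1) (c n).
Hypothesis HI : rgen (fun x => Cmod (f x) ^ 2) r0 (pt 1) I.

Fixpoint SN (N : nat) (x : R) : C :=
  match N with
  | O => (c 0 * e2 0 x)%C
  | S k => (SN k x + c (Z.of_nat (S k)) * e2 (- Z.of_nat (S k)) x + c (- Z.of_nat (S k)) * e2 (Z.of_nat (S k)) x)%C
  end.

Fixpoint BN (N : nat) : R :=
  match N with
  | O => Cmod (c 0) ^ 2
  | S k => BN k + Cmod (c (Z.of_nat (S k))) ^ 2 + Cmod (c (- Z.of_nat (S k))) ^ 2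
  end.

Lemma TP_SN (N : nat) : TP N (SN N).
Proof.
  induction N as [|N IH].
  - apply TP_e2. simpl; lia.
  - apply (TP_add (S N) (fun x => SN N x + c (Z.of_nat (S N)) * e2 (- Z.of_nat (S N)) x)%C); [|lia].
    apply (TP_add (S N) (SN N)); [|lia]. apply (TP_mono N); auto.
Qed.

Lemma SN_coef (N : nat) (m : Z) :
  igen (fun x => SN N x * e2 m x)%C r0 (pt 1) (if Z_le_dec (Z.abs m) (Z.of_nat N) then c m else RtoC 0).
Proof.
  induction N as [|N IH].
  - apply (igen_ext_all r0 (pt 1) (fun x => c 0%Z * e2 (0 + m) x)%C).
    { intros x. rewrite <- (e2_plus 0 m). change (SN 0 x) with (c 0%Z * e2 0 x)%C. ring. }
    eapply igen_eq; [apply igen_scal; try typeclasses eauto; apply igen_e2_right|].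
    destruct (Z.eq_dec (0 + m) 0) as [E|E]; destruct (Z_le_dec (Z.abs m) (Z.of_nat 0)) as [L|L]; simpl in *; try lia.
    + replace m with 0%Z by lia. ring.
    + ring.
  - set (k := Z.of_nat (S N)) in *.
    apply (igen_ext_all r0 (pt 1) (fun x => SN N x * e2 m x + c k * e2 (- k + m) x + c (- k)%Z * e2 (k + m) x)%C).
    { intros x. rewrite <- !e2_plus. change (SN (S N) x) with (SN N x + c k * e2 (- k) x + c (- k)%Z * e2 k x)%C. ring. }
    eapply igen_eq; [apply igen_plus; try typeclasses eauto; [apply igen_plus; try typeclasses eauto; [exact IH|]|];
      (apply igen_scal; try typeclasses eauto; apply igen_e2_right)|].
    destruct (Z.eq_dec (- k + m) 0) as [E|E]; destruct (Z.eq_dec (k + m) 0) as [E'|E'];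
    destruct (Z_le_dec (Z.abs m) (Z.of_nat N)) as [L|L]; destruct (Z_le_dec (Z.abs m) k) as [L'|L'];
      unfold k in *; try lia; try ring.
    + replace m with (Z.of_nat (S N)) by lia. ring.
    + replace m with (- Z.of_nat (S N))%Z by lia. ring.
Qed.

Lemma igen_f_SN (N : nat) : igen (fun x => f x * Cconj (SN N x))%C r0 (pt 1) (RtoC (BN N)).
Proof.
  induction N as [|N IH].
  - apply (igen_ext_all r0 (pt 1) (fun x => Cconj (c 0%Z) * (f x * e2 0 x))%C).
    { intros x. simpl. rewrite Cconj_mult, Cconj_e2. simpl. ring. }
    eapply igen_eq; [apply igen_scal; try typeclasses eauto; apply Hc|].
    change (BN 0) with (Cmod (c 0%Z) ^ 2). rewrite Cmod2_conj. ring.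
  - set (k := Z.of_nat (S N)).
    apply (igen_ext_all r0 (pt 1) (fun x => f x * Cconj (SN N x) + Cconj (c k) * (f x * e2 k x) + Cconj (c (- k)%Z) * (f x * e2 (- k) x))%C).
    { intros x. change (SN (S N) x) with (SN N x + c k * e2 (- k) x + c (- k)%Z * e2 k x)%C.
      rewrite !Cconj_plus, !Cconj_mult, !Cconj_e2, Z.opp_involutive. ring. }
    eapply igen_eq; [apply igen_plus; try typeclasses eauto; [apply igen_plus; try typeclasses eauto; [exact IH|]|];
      (apply igen_scal; try typeclasses eauto; apply Hc)|].
    change (BN (S N)) with (BN N + Cmod (c k) ^ 2 + Cmod (c (- k)%Z) ^ 2).
    rewrite !RtoC_plus, !Cmod2_conj. ring.
Qed.

Lemma igen_res_e2 (N : nat) (m : Z) : (Z.abs m <= Z.of_nat N)%Z ->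
  igen (fun x => (f x - SN N x) * e2 m x)%C r0 (pt 1) 0.
Proof.
  intros Hm. apply (igen_ext_all r0 (pt 1) (fun x => f x * e2 m x - SN N x * e2 m x)%C). intros; ring.
  eapply igen_eq; [apply igen_minus; try typeclasses eauto; [apply Hc|apply SN_coef]|].
  destruct (Z_le_dec (Z.abs m) (Z.of_nat N)); [ring|contradiction].
Qed.

Lemma rgen_res (N : nat) : rgen (fun x => Cmod (f x - SN N x) ^ 2) r0 (pt 1) (I - BN N).
Proof.
  assert (A := igen_Re _ _ _ _ _ _ (TP_orthogonal N (SN N) _ (TP_SN N) (igen_res_e2 N))).
  assert (B := igen_Re _ _ _ _ _ _ (igen_f_SN N)).
  (* |f - S|^2 = |f|^2 - Re (f conj S) - Re ((f - S) conj S) *)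
  apply (rgen_ext_all r0 (pt 1) (fun x => Cmod (f x) ^ 2 - Re (f x * Cconj (SN N x))%C - Re ((f x - SN N x) * Cconj (SN N x))%C)).
  - intros x. rewrite !Cmod2_alt. unfold Re, Im; simpl. ring.
  - replace (I - BN N) with (I - BN N - Re 0) by (simpl; ring).
    apply rgen_minus; try typeclasses eauto; [|exact A]. apply rgen_minus; try typeclasses eauto; auto.
Qed.

Lemma BN_le (N : nat) : BN N <= I.
Proof.
  assert (K := rgen_le r0 (pt 1) (fun x => 0 < x <= 1) (fun _ => 0) _ 0 (I - BN N) dom_0_1 (fun x _ => pow2_ge_0 (Cmod (f x - SN N x)))).
  assert (0 <= I - BN N); [|lra]. apply K; [|apply rgen_res].
  apply (igen_Re (fun _ => RtoC 0) r0 (pt 1) 0); try typeclasses eauto. apply igen_zero; typeclasses eauto.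
Qed.

(** Write f - q = (f - S_N) + (S_N - q): the second summand has degree at most N and is orthogonal
    to the first, and dropping its square leaves the inequality. *)
Lemma best_approximation (N : nat) (q : R -> C) (J : R) : TP N q ->
  rgen (fun x => Cmod (f x - q x) ^ 2) r0 (pt 1) J -> I - BN N <= J.
Proof.
  intros Hq HJ.
  assert (A := igen_Re _ _ _ _ _ _ (TP_orthogonal N (fun x => SN N x - q x)%C _ (TP_minus N _ _ (TP_SN N) Hq) (igen_res_e2 N))).
  assert (B := rgen_scal r0 (pt 1) 2 _ _ A).
  assert (D := rgen_plus r0 (pt 1) _ _ _ _ (rgen_res N) B).
  replace (I - BN N) with (I - BN N + 2 * Re 0) by (simpl; ring).
  refine (rgen_le r0 (pt 1) (fun x => 0 < x <= 1) _ _ _ _ dom_0_1 _ D HJ).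
  intros x _. rewrite !Cmod2_alt. unfold Re, Im; simpl.
  generalize (fst (f x)) (snd (f x)) (fst (SN N x)) (snd (SN N x)) (fst (q x)) (snd (q x)).
  intros a b u v p w.
  assert (0 <= (u - p) ^ 2 + (v - w) ^ 2) by (generalize (pow2_ge_0 (u - p)) (pow2_ge_0 (v - w)); lra).
  nra.
Qed.

End Parseval.

(** * Uniform approximation by trigonometric polynomials *)

Definition ker (m : nat) (v : R) : R := (cos (PI * v) ^ 2) ^ m.

Lemma e2_cos (v : R) : (e2 1 v + e2 (-1) v = RtoC (2 * cos (2 * PI * v)))%C.
Proof.
  assert (K : forall n, e2 n v = (cos (2 * PI * IZR n * v), - sin (2 * PI * IZR n * v))).
  { intros n. unfold e2, Cexp. rewrite Re_zx, Re_two_pi_i.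
    replace (Im (- (two_pi_i n * RtoC v))%C) with (- (2 * PI * IZR n * v)) by (rewrite <- Im_two_pi_i; unfold Im; simpl; ring).
    rewrite cos_neg, sin_neg, Rmult_0_l, Ropp_0, exp_0, !Rmult_1_l. reflexivity. }
  rewrite !K. replace (2 * PI * IZR (-1) * v) with (- (2 * PI * v)) by (replace (IZR (-1)) with (-1) by reflexivity; ring).
  rewrite cos_neg, sin_neg. rewrite Rmult_1_r. apply C_eq; simpl; ring.
Qed.

(** Each factor cos^2(pi v) = 1/2 + (e2 1 v + e2 (-1) v) / 4 raises the degree by one. *)
Lemma TP_ker (m : nat) : TP m (fun v => RtoC (ker m v)).
Proof.
  induction m as [|m IH].
  - apply (TP_ext 0 (fun x => 1 * e2 0 x)%C).
    + apply TP_e2. simpl; lia.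
    + intros x. unfold ker; simpl. rewrite e2_zero. ring.
  - apply (TP_ext (S m) (fun v => (RtoC (/ 2) * RtoC (ker m v) + RtoC (/ 4) * (RtoC (ker m v) * e2 1 v)) + RtoC (/ 4) * (RtoC (ker m v) * e2 (-1) v))%C).
    + apply TP_plus; [apply TP_plus|]; apply (TP_scal (S m)).
      * apply (TP_mono m); auto.
      * apply TP_mult_e2; [lia|auto].
      * apply TP_mult_e2; [lia|auto].
    + intros v.
      replace (RtoC (/ 2) * RtoC (ker m v) + RtoC (/ 4) * (RtoC (ker m v) * e2 1 v) + RtoC (/ 4) * (RtoC (ker m v) * e2 (-1) v))%C
        with (RtoC (/ 2) * RtoC (ker m v) + RtoC (/ 4) * RtoC (ker m v) * (e2 1 v + e2 (-1) v))%C by ring.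
      rewrite e2_cos, <- !RtoC_mult, <- RtoC_plus. f_equal. unfold ker. rewrite <- (tech_pow_Rmult _ m).
      replace (2 * PI * v) with (2 * (PI * v)) by ring. rewrite cos_2a_cos. field.
Qed.

Lemma e2_minus_var (n : Z) (x u : R) : e2 n (x - u) = (e2 n x * e2 (- n) u)%C.
Proof.
  unfold e2. rewrite <- Cexp_plus. f_equal. unfold two_pi_i. rewrite opp_IZR, RtoC_minus.
  replace (2 * PI * - IZR n) with (- (2 * PI * IZR n)) by ring. rewrite RtoC_opp. ring.
Qed.

Lemma igen_cont_ex (f : R -> C) : (forall x, 0 <= x <= 1 -> Ccont f x) -> exists l, igen f (pt 0) (pt 1) l.
Proof.
  intros H.
  destruct (ex_RInt_Ccont f (fun x => 0 <= x <= 1) 0 1 ltac:(lra) ltac:(auto) H) as [l Hl].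
  exists l. apply (is_RInt_gen_at_point (V := C_R_NormedModule)). exact Hl.
Qed.

(** A character of x - u separates into one of x and one of u, so integration over u only changes
    the coefficients. *)
Lemma convolution (N : nat) (k G : R -> C) : TP N k -> (forall x, 0 <= x <= 1 -> Ccont G x) ->
  exists q, TP N q /\ forall x, igen (fun u => G u * k (x - u)%R)%C (pt 0) (pt 1) (q x).
Proof.
  intros Hk HG. induction Hk as [|k d n Hk [q [Hq IH]] Hn|k k' Hk [q [Hq IH]] E].
  - exists (fun _ => RtoC 0). split; [apply TP_zero|]. intros x.
    apply (igen_ext_all (pt 0) (pt 1) (fun _ => RtoC 0)); [intros; ring|apply igen_zero; typeclasses eauto].
  - destruct (igen_cont_ex (fun u => G u * e2 (- n) u)%C) as [l Hl].
    { intros x Hx. apply Ccont_mult; auto. apply Ccont_e2. }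
    exists (fun x => q x + (d * l) * e2 n x)%C. split; [apply TP_add; auto|]. intros x.
    apply (igen_ext_all (pt 0) (pt 1) (fun u => G u * k (x - u)%R + (d * e2 n x) * (G u * e2 (- n) u))%C).
    { intros u. rewrite e2_minus_var. ring. }
    eapply igen_eq; [apply igen_plus; try typeclasses eauto; [apply IH|apply igen_scal; try typeclasses eauto; exact Hl]|]. ring.
  - exists q. split; auto. intros x. apply (igen_ext_all (pt 0) (pt 1) (fun u => G u * k (x - u)%R)%C); auto. intros u; rewrite E; auto.
Qed.

Lemma TP_mean (N : nat) (k : R -> C) : TP N k -> exists gam, forall x, igen (fun u => k (x - u)) (pt 0) (pt 1) gam.
Proof.
  intros Hk. induction Hk as [|k d n Hk [gam IH] Hn|k k' Hk [gam IH] E].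
  - exists (RtoC 0). intros x. apply (igen_zero (pt 0) (pt 1)).
  - exists (gam + d * (if Z.eq_dec n 0 then RtoC 1 else RtoC 0))%C. intros x.
    apply (igen_ext_all (pt 0) (pt 1) (fun u => k (x - u)%R + (d * e2 n x) * e2 (- n) u)%C).
    { intros u. rewrite e2_minus_var. ring. }
    eapply igen_eq; [apply igen_plus; try typeclasses eauto; [apply IH|apply igen_scal; try typeclasses eauto; apply igen_e2]|].
    destruct (Z.eq_dec n 0) as [Hn0|Hn0]; destruct (Z.eq_dec (- n) 0) as [E|E]; try lia.
    + rewrite Hn0. rewrite e2_zero. ring.
    + ring.
  - exists gam. intros x. apply (igen_ext_all (pt 0) (pt 1) (fun u => k (x - u))); auto.
Qed.

Lemma ker_pos (m : nat) (v : R) : 0 <= ker m v.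
Proof. apply pow_le, pow2_ge_0. Qed.

(** Inserting the factor sin(pi u) <= 1 turns the integrand into the derivative of a multiple of
    cos^(2m+1)(pi u), which gives the lower bound. Order 1/m is enough, since away from the integers
    the kernel decays geometrically in m. *)
Lemma ker_mean (m : nat) : exists gam, 2 / (PI * INR (2 * m + 1)) <= gam /\
  forall x, rgen (fun u => ker m (x - u)) (pt 0) (pt 1) gam.
Proof.
  destruct (TP_mean m _ (TP_ker m)) as [gam Hg].
  assert (HR : forall x, rgen (fun u => ker m (x - u)) (pt 0) (pt 1) (Re gam)).
  { intros x. apply (igen_Re (fun u => RtoC (ker m (x - u))) (pt 0) (pt 1)); try typeclasses eauto. apply Hg. }
  exists (Re gam). split; auto.
  assert (HP := PI_RGT_0). assert (Hm : 0 < INR (2 * m + 1)) by (apply lt_0_INR; lia).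
  assert (F : rgen (fun u => ker m u * sin (PI * u)) (pt 0) (pt 1)
    (- cos (PI * 1) ^ (2 * m + 1) / (PI * INR (2 * m + 1)) - - cos (PI * 0) ^ (2 * m + 1) / (PI * INR (2 * m + 1)))).
  { apply (rgen_ftc (pt 0) (pt 1) (fun u => - cos (PI * u) ^ (2 * m + 1) / (PI * INR (2 * m + 1))) _ (fun x => 0 <= x <= 1)).
    - apply dom_points; auto; lra.
    - intros x _. unfold ker. rewrite <- pow_mult. auto_derive; auto.
      change (m + (m + 0))%nat with (2 * m)%nat.
      replace (Init.Nat.pred (2 * m + 1)) with (2 * m)%nat by lia. field. lra.
    - intros x _. unfold ker. eapply continuous_of_ex_derive. auto_derive; auto.
    - apply (filterlim_point (fun u => - cos (PI * u) ^ (2 * m + 1) / (PI * INR (2 * m + 1)))).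
    - apply (filterlim_point (fun u => - cos (PI * u) ^ (2 * m + 1) / (PI * INR (2 * m + 1)))). }
  replace (2 / (PI * INR (2 * m + 1))) with
    (- cos (PI * 1) ^ (2 * m + 1) / (PI * INR (2 * m + 1)) - - cos (PI * 0) ^ (2 * m + 1) / (PI * INR (2 * m + 1))).
  - apply (rgen_le (pt 0) (pt 1) (fun x => 0 <= x <= 1) (fun u => ker m u * sin (PI * u)) (fun u => ker m (0 - u))); auto.
    + apply dom_points; auto; lra.
    + intros u Hu. replace (ker m (0 - u)) with (ker m u).
      * assert (K := ker_pos m u). assert (S1 : sin (PI * u) <= 1) by apply SIN_bound. nra.
      * unfold ker. replace (PI * (0 - u)) with (- (PI * u)) by ring. rewrite cos_neg; auto.
  - rewrite Rmult_1_r, Rmult_0_r, cos_0, cos_PI, pow1.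
    replace (2 * m + 1)%nat with (S (2 * m)) at 1 by lia. rewrite pow_1_odd. field. lra.
Qed.

(** Between pi eta and pi - pi eta the cosine decreases from cos(pi eta) to its negative. *)
Lemma cos2_far (d eta : R) : 0 < eta <= 1 / 4 -> eta <= Rabs d <= 1 - eta -> cos (PI * d) ^ 2 <= cos (PI * eta) ^ 2.
Proof.
  intros He Hd. assert (HP := PI_RGT_0).
  assert (E : cos (PI * d) = cos (PI * Rabs d)).
  { unfold Rabs. destruct (Rcase_abs d); auto. replace (PI * - d) with (- (PI * d)) by ring. rewrite cos_neg; auto. }
  rewrite E.
  assert (H1 : cos (PI * Rabs d) <= cos (PI * eta)) by (apply cos_decr_1; nra).
  assert (H2 : cos (PI * (1 - eta)) <= cos (PI * Rabs d)) by (apply cos_decr_1; nra).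
  replace (PI * (1 - eta)) with (- (PI * eta) + PI) in H2 by ring. rewrite neg_cos, cos_neg in H2.
  nra.
Qed.

Lemma uniform_continuity01 (G : R -> C) (eps : R) : 0 < eps -> (forall x, 0 <= x <= 1 -> Ccont G x) ->
  exists d, 0 < d /\ forall x y, 0 <= x <= 1 -> 0 <= y <= 1 -> Rabs (x - y) < d -> Cmod (G x - G y) < eps.
Proof.
  intros He HG. assert (He2 : 0 < eps / 2) by lra.
  destruct (Heine_cor2 (f := fun x => Re (G x)) (a := 0) (b := 1)
    (fun x Hx => proj2 (continuity_pt_filterlim _ _) (proj1 (HG x Hx))) (mkposreal _ He2)) as [d1 H1].
  destruct (Heine_cor2 (f := fun x => Im (G x)) (a := 0) (b := 1)
    (fun x Hx => proj2 (continuity_pt_filterlim _ _) (proj2 (HG x Hx))) (mkposreal _ He2)) as [d2 H2].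
  exists (Rmin d1 d2). split; [apply Rmin_pos; apply cond_pos|].
  intros x y Hx Hy Hxy. simpl in H1, H2.
  eapply Rle_lt_trans; [apply Cmod_le_sum|].
  assert (A1 := H1 x y Hx Hy (Rlt_le_trans _ _ _ Hxy (Rmin_l _ _))).
  assert (A2 := H2 x y Hx Hy (Rlt_le_trans _ _ _ Hxy (Rmin_r _ _))).
  change (Re (G x - G y)%C) with (Re (G x) - Re (G y)). change (Im (G x - G y)%C) with (Im (G x) - Im (G y)). lra.
Qed.

(** The approximant is the convolution with the kernel divided by its mean. Near x modulo 1 the
    continuity of [G] is used, elsewhere the kernel is at most [rr ^ m]; the zeros at 0 and 1 make
    the periodic extension of [G] continuous. *)
Lemma trig_approx (G : R -> C) (eps : R) : 0 < eps -> (forall x, 0 <= x <= 1 -> Ccont G x) -> G 0 = 0 -> G 1 = 0 ->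
  exists N q, TP N q /\ forall x, 0 <= x <= 1 -> Cmod (G x - q x) <= eps.
Proof.
  intros He HG G0 G1.
  (* A quarter of eps, because a comparison across the ends of the interval passes through both 0
     and 1 and uses continuity twice. *)
  destruct (uniform_continuity01 G (eps / 4) ltac:(lra) HG) as [d [Hd Hu]].
  destruct (continuity_ab_maj (fun x => Cmod (G x)) 0 1 ltac:(lra)) as [xm [Hxm Hxm1]].
  { intros x Hx. apply continuity_pt_filterlim. apply (continuous_Cmod G x). auto. }
  set (B := Cmod (G xm)). assert (HB0 : 0 <= B) by apply Cmod_ge_0.
  set (eta := Rmin (d / 2) (1 / 4)).
  assert (Heta : 0 < eta) by (apply Rmin_pos; lra).
  assert (Heta1 : eta <= d / 2) by apply Rmin_l. assert (Heta2 : eta <= 1 / 4) by apply Rmin_r.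
  assert (HP := PI_RGT_0).
  set (rr := cos (PI * eta) ^ 2).
  assert (Hrr : 0 < rr < 1).
  { assert (C1 : 0 < cos (PI * eta)) by (apply cos_gt_0; nra).
    assert (C2 : cos (PI * eta) < 1) by (rewrite <- cos_0; apply cos_decreasing_1; nra).
    unfold rr. nra. }
  (* The far part, at most 2 B rr^m, must be small against the mean, which is at least 2 / (pi (2m +
     1)); since (m + 1)^2 rr^m tends to 0, some m works. *)
  assert (L : exists m, 2 * B * rr ^ m * (PI * INR (2 * m + 1) / 2) < eps / 2).
  { assert (K := ex_series_lim_0 _ (ex_series_sq_geom rr Hrr)). apply is_lim_seq_spec in K.
    assert (Hk : 0 < eps / 2 / (2 * B * PI + 1)) by (apply Rdiv_lt_0_compat; [lra|nra]).
    destruct (K (mkposreal _ Hk)) as [m Hm]. exists m. specialize (Hm m (Nat.le_refl m)). simpl in Hm.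
    rewrite Rminus_0_r in Hm. apply Rle_lt_trans with ((2 * B * PI) * (INR (S m) ^ 2 * rr ^ m)).
    - rewrite plus_INR, mult_INR, (S_INR m). simpl (INR 2). simpl (INR 1).
      assert (Pm := pos_INR m). assert (Pr : 0 <= rr ^ m) by (apply pow_le; lra).
      assert (0 <= B * PI * rr ^ m) by (apply Rmult_le_pos; [apply Rmult_le_pos|]; lra).
      replace (2 * B * rr ^ m * (PI * ((1 + 1) * INR m + 1) / 2)) with ((B * PI * rr ^ m) * ((2 * INR m + 1))) by field.
      replace (2 * B * PI * ((INR m + 1) ^ 2 * rr ^ m)) with ((B * PI * rr ^ m) * (2 * (INR m + 1) ^ 2)) by ring.
      apply Rmult_le_compat_l; auto. nra.
    - apply Rle_lt_trans with ((2 * B * PI) * (eps / 2 / (2 * B * PI + 1))).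
      + apply Rmult_le_compat_l; [nra|]. apply Rle_trans with (Rabs (INR (S m) ^ 2 * rr ^ m)); [apply Rle_abs|]. left. exact Hm.
      + apply Rlt_le_trans with ((2 * B * PI + 1) * (eps / 2 / (2 * B * PI + 1))); [apply Rmult_lt_compat_r; auto; lra|].
        right. field. nra. }
  destruct L as [m Lm].
  destruct (ker_mean m) as [gam [Hg1 Hg2]].
  assert (Hg0 : 0 < gam).
  { eapply Rlt_le_trans; [|exact Hg1]. apply Rdiv_lt_0_compat; [lra|]. apply Rmult_lt_0_compat; auto. apply lt_0_INR; lia. }
  destruct (convolution m _ G (TP_ker m) HG) as [q [Hq1 Hq2]].
  exists m, (fun x => RtoC (/ gam) * q x)%C. split; [apply TP_scal; auto|].
  intros x Hx.
  assert (D := igen_minus (pt 0) (pt 1) _ _ _ _ (igen_scal (pt 0) (pt 1) (G x) _ _ (igen_RtoC (pt 0) (pt 1) _ _ (Hg2 x))) (Hq2 x)).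
  assert (M : rgen (fun u => eps / 2 * ker m (x - u) + 2 * B * rr ^ m * 1) (pt 0) (pt 1) (eps / 2 * gam + 2 * B * rr ^ m * 1)).
  { apply rgen_plus; try typeclasses eauto; apply rgen_scal; try typeclasses eauto; auto. apply rgen_one. }
  assert (E : Cmod (G x * RtoC gam - q x) <= eps / 2 * gam + 2 * B * rr ^ m * 1).
  { refine (igen_norm (pt 0) (pt 1) (fun u => 0 <= u <= 1) _ _ _ _ (dom_points 0 1 _ Rle_0_1 (fun x H => H)) _ D M).
    intros u Hu1. cbv beta.
    replace (G x * RtoC (ker m (x - u)) - G u * RtoC (ker m (x - u)))%C with ((G x - G u) * RtoC (ker m (x - u)))%C by ring.
    assert (Kp := ker_pos m (x - u)).
    rewrite Cmod_mult, Cmod_R, Rabs_pos_eq by auto.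
    assert (Far : 0 <= 2 * B * rr ^ m * 1). { apply Rmult_le_pos; [|lra]. apply Rmult_le_pos; [lra|]. apply pow_le; lra. }
    assert (Near : Cmod (G x - G u) <= eps / 2 -> Cmod (G x - G u) * ker m (x - u) <= eps / 2 * ker m (x - u) + 2 * B * rr ^ m * 1).
    { intros Hn. apply Rle_trans with (eps / 2 * ker m (x - u)); [apply Rmult_le_compat_r; auto|lra]. }
    (* Points near opposite ends are close modulo 1; the common value G 0 = G 1 = 0 links them. *)
    assert (Wrap : forall a b, 0 <= a <= 1 -> 0 <= b <= 1 -> a < eta -> 1 - eta < b -> Cmod (G a - G b) <= eps / 2).
    { intros a b Ha Hb Ha1 Hb1. replace (G a - G b)%C with ((G a - G 0) + (G 1 - G b))%C by (rewrite G0, G1; ring).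
      eapply Rle_trans; [apply Cmod_triangle|].
      assert (A1 := Hu a 0 Ha ltac:(lra) ltac:(rewrite Rminus_0_r, Rabs_pos_eq; lra)).
      assert (A2 := Hu 1 b ltac:(lra) Hb ltac:(rewrite Rabs_pos_eq; lra)). lra. }
    destruct (Rlt_dec (Rabs (x - u)) eta) as [H1|H1].
    - apply Near. assert (A := Hu x u Hx Hu1 ltac:(lra)). lra.
    - destruct (Rlt_dec (1 - eta) (Rabs (x - u))) as [H2|H2].
      + apply Near. unfold Rabs in H2. destruct (Rcase_abs (x - u)).
        * apply Wrap; lra.
        * rewrite <- Cmod_opp. replace (- (G x - G u))%C with (G u - G x)%C by ring. apply Wrap; lra.
      + apply Rle_trans with (2 * B * rr ^ m * 1).
        * rewrite Rmult_1_r. apply Rmult_le_compat; auto; [apply Cmod_ge_0| |].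
          -- eapply Rle_trans; [apply Cmod_triangle|]. rewrite Cmod_opp. unfold B.
             assert (A1 := Hxm x Hx). assert (A2 := Hxm u Hu1). simpl in A1, A2. lra.
          -- unfold ker, rr. apply pow_incr. split; [apply pow2_ge_0|]. apply cos2_far; lra.
        * assert (0 <= eps / 2 * ker m (x - u)) by (apply Rmult_le_pos; lra). lra. }
  replace (G x - RtoC (/ gam) * q x)%C with (RtoC (/ gam) * (G x * RtoC gam - q x))%C.
  - rewrite Cmod_mult, Cmod_R, Rabs_pos_eq by (left; apply Rinv_0_lt_compat; auto).
    apply (Rmult_le_reg_l gam); auto. rewrite <- Rmult_assoc, Rinv_r, Rmult_1_l by lra.
    eapply Rle_trans; [exact E|].
    assert (X : 2 * B * rr ^ m <= eps / 2 * gam); [|lra].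
    apply Rle_trans with (eps / 2 * (2 / (PI * INR (2 * m + 1)))); [|apply Rmult_le_compat_l; lra].
    assert (Pn : 0 < PI * INR (2 * m + 1) / 2).
    { apply Rdiv_lt_0_compat; [|lra]. apply Rmult_lt_0_compat; auto. apply lt_0_INR; lia. }
    apply (Rmult_le_reg_r (PI * INR (2 * m + 1) / 2)); auto.
    replace (eps / 2 * (2 / (PI * INR (2 * m + 1))) * (PI * INR (2 * m + 1) / 2)) with (eps / 2); [lra|].
    field. split; [apply Rgt_not_eq, lt_0_INR; lia|lra].
  - rewrite RtoC_inv by lra. field. intros E'; apply RtoC_inj in E'; lra.
Qed.

Lemma rgen_dominated_sq (g : R -> C) (M : R -> R) (m : R) :
  (forall x, 0 < x <= 1 -> Ccont g x) -> (forall x, 0 < x <= 1 -> continuous M x) ->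
  (forall x, 0 < x <= 1 -> Cmod (g x) ^ 2 <= M x) -> rgen M r0 (pt 1) m ->
  exists J, rgen (fun x => Cmod (g x) ^ 2) r0 (pt 1) J /\ J <= m.
Proof.
  intros Hg HM H Hm.
  destruct (igen_dominated r0 (pt 1) (fun x => 0 < x <= 1) (fun x => RtoC (Cmod (g x) ^ 2)) M m) as [l Hl]; auto.
  - apply dom_0_1.
  - intros x Hx. apply Ccont_RtoC. simpl.
    assert (Q := continuous_Cmod g x (Hg x Hx)).
    apply (continuous_mult (K := R_AbsRing) (fun t => Cmod (g t)) (fun t => Cmod (g t) * 1)); auto.
    apply (continuous_mult (K := R_AbsRing) (fun t => Cmod (g t)) (fun _ => 1)); auto. apply continuous_const.
  - intros x Hx. rewrite Cmod_R, Rabs_pos_eq by apply pow2_ge_0. auto.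
  - apply igen_Re in Hl; try typeclasses eauto. exists (Re l). split; auto.
    apply (rgen_le r0 (pt 1) (fun x => 0 < x <= 1) (fun x => Cmod (g x) ^ 2) M); auto. apply dom_0_1.
Qed.

Lemma Cmod_sq_plus (z w : C) : Cmod (z + w) ^ 2 <= 2 * Cmod z ^ 2 + 2 * Cmod w ^ 2.
Proof.
  assert (K := Cmod_triangle z w). assert (P := Cmod_ge_0 (z + w)).
  assert (P1 := Cmod_ge_0 z). assert (P2 := Cmod_ge_0 w).
  assert (Cmod (z + w) ^ 2 <= (Cmod z + Cmod w) ^ 2) by (apply pow_incr; lra).
  assert (Q := pow2_ge_0 (Cmod z - Cmod w)). nra.
Qed.

(** The factor x / (x + d) tames the singularity at 0 and 1 - x^j produces a zero at 1, as
    [trig_approx] requires; inside (0, 1) both tend to 1 as d tends to 0 and j to infinity. *)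
Definition damp (d : R) (j : nat) (x : R) : R := x / (x + d) * (1 - x ^ j).

Lemma damp_bounds (d kap x : R) (j : nat) : 0 < d -> 0 < kap <= 1 -> 0 < x <= 1 ->
  0 <= damp d j x /\ damp d j x <= x / d /\ damp d j x <= 1 /\
  1 - damp d j x <= Rpower d kap * Rpower x (- kap) + x ^ j.
Proof.
  intros Hd Hk Hx.
  assert (A : 0 < x / (x + d)) by (apply Rdiv_lt_0_compat; lra).
  assert (B : x / (x + d) <= 1) by (apply Rmult_le_reg_r with (x + d); [lra|unfold Rdiv; rewrite Rmult_assoc, Rinv_l; lra]).
  assert (D : 0 <= x ^ j) by (apply pow_le; lra).
  assert (E : x ^ j <= 1) by (rewrite <- (pow1 j); apply pow_incr; lra).
  assert (F : x / (x + d) <= x / d).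
  { unfold Rdiv. apply Rmult_le_compat_l; [lra|]. apply Rinv_le_contravar; lra. }
  unfold damp. split; [|split; [|split]].
  - apply Rmult_le_pos; lra.
  - apply Rle_trans with (x / (x + d) * 1); [apply Rmult_le_compat_l; lra|lra].
  - nra.
  (* d / (x + d) is at most min(1, d / x), hence at most (d / x)^kap for kap <= 1: a small power of
     d is gained for a small loss of integrability at 0. *)
  - assert (G : 1 - x / (x + d) <= Rpower d kap * Rpower x (- kap)).
    { replace (1 - x / (x + d)) with (d / (x + d)) by (field; lra).
      replace (Rpower d kap * Rpower x (- kap)) with (exp (kap * (ln d - ln x))) by (unfold Rpower; rewrite <- exp_plus; f_equal; ring).
      destruct (Rle_dec d x) as [L|L].
      - apply Rle_trans with (d / x).
        + unfold Rdiv. apply Rmult_le_compat_l; [lra|]. apply Rinv_le_contravar; lra.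
        + replace (d / x) with (exp (ln d - ln x)).
          * apply exp_le. assert (ln d <= ln x) by (apply Rcomplements.ln_le; lra). nra.
          * unfold Rminus. rewrite exp_plus, exp_Ropp, !exp_ln by lra. reflexivity.
      - apply Rle_trans with 1.
        + apply Rmult_le_reg_r with (x + d); [lra|]. unfold Rdiv. rewrite Rmult_assoc, Rinv_l; lra.
        + rewrite <- exp_0. apply exp_le. assert (ln x <= ln d) by (apply Rcomplements.ln_le; lra). nra. }
    nra.
Qed.

(** At 0 the product is O(x^(1 - beta) / d), which tends to 0 because beta < 1. *)
Lemma Ccont_damped (f : R -> C) (d K beta : R) (j : nat) : Ccont_pos f -> 0 < d -> beta < 1 ->
  (forall a, 0 < a <= 1 -> Cmod (f a) <= K * Rpower a (- beta)) ->
  forall x, 0 <= x <= 1 -> Ccont (fun x => if Rle_dec x 0 then RtoC 0 else (f x * RtoC (damp d j x))%C) x.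
Proof.
  intros Hf Hd Hb HK x Hx.
  destruct (Req_dec x 0) as [->|Hn].
  - apply Ccont_eps. intros eps He. destruct (Rle_dec 0 0) as [_|n]; [|lra].
    assert (HK0 : 0 <= K).
    { assert (Q := HK 1 ltac:(lra)). unfold Rpower in Q. rewrite ln_1, Rmult_0_r, exp_0 in Q. generalize (Cmod_ge_0 (f 1)). lra. }
    assert (Pp : 0 < eps * d / (K + 1)) by (apply Rdiv_lt_0_compat; [apply Rmult_lt_0_compat; auto|lra]).
    destruct (Rpower_small (1 - beta) (eps * d / (K + 1)) ltac:(lra) Pp) as [e [He1 He2]].
    assert (Hm : 0 < Rmin e 1) by (apply Rmin_pos; lra).
    exists (mkposreal _ Hm). intros y Hy. change (Rabs (y - 0) < Rmin e 1) in Hy. rewrite Rminus_0_r in Hy.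
    destruct (Rle_dec y 0) as [L|L].
    + replace (0 - 0)%C with (RtoC 0) by ring. rewrite Cmod_0; auto.
    + rewrite Rabs_pos_eq in Hy by lra. assert (M1 := Rmin_l e 1). assert (M2 := Rmin_r e 1).
      destruct (damp_bounds d 1 y j Hd ltac:(lra) ltac:(lra)) as [B1 [B2 _]].
      replace (f y * RtoC (damp d j y) - 0)%C with (f y * RtoC (damp d j y))%C by ring.
      rewrite Cmod_mult, Cmod_R, Rabs_pos_eq by auto.
      apply Rle_lt_trans with (K * Rpower y (- beta) * (y / d)).
      * apply Rmult_le_compat; auto; [apply Cmod_ge_0|apply HK; lra].
      * specialize (He2 y ltac:(lra)).
        replace (1 - beta) with (- beta + 1) in He2 by ring. rewrite Rpower_plus, Rpower_1 in He2 by lra.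
        assert (P1 : 0 < Rpower y (- beta) * y) by (apply Rmult_lt_0_compat; [apply Rpower_pos|lra]).
        apply (Rmult_lt_reg_r d); auto.
        replace (K * Rpower y (- beta) * (y / d) * d) with (K * (Rpower y (- beta) * y)) by (field; lra).
        apply (Rmult_lt_compat_l (K + 1)) in He2; [|lra].
        replace ((K + 1) * (eps * d / (K + 1))) with (eps * d) in He2 by (field; lra). nra.
  - assert (Hx0 : 0 < x) by lra.
    apply (Ccont_ext_loc (fun x => f x * RtoC (damp d j x))%C).
    + generalize (locally_pos x Hx0). apply filter_imp. intros y Hy. destruct (Rle_dec y 0); [lra|auto].
    + apply Ccont_mult; auto. apply Ccont_RtoC. unfold damp.
      eapply continuous_of_ex_derive. auto_derive; [lra|reflexivity].
Qed.

(** Bessel's inequality keeps the partial sums below [I]; best approximation, tested on a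
    trigonometric polynomial close to the damped function, brings them within any eps of [I]. *)
Lemma parseval (f : R -> C) (c : Z -> C) (K beta : R) : Ccont_pos f -> 0 < beta < 1 / 2 ->
  (forall a, 0 < a <= 1 -> Cmod (f a) <= K * Rpower a (- beta)) ->
  (forall n, igen (fun x => f x * e2 n x)%C r0 (pt 1) (c n)) ->
  exists I, rgen (fun x => Cmod (f x) ^ 2) r0 (pt 1) I /\ is_lim_seq (BN c) I.
Proof.
  intros Hf Hb HK Hc.
  assert (HK2 : forall a, 0 < a <= 1 -> Cmod (f a) ^ 2 <= K ^ 2 * Rpower a (1 - 2 * beta - 1)).
  { intros a Ha. apply Rle_trans with ((K * Rpower a (- beta)) ^ 2).
    - apply pow_incr. split; [apply Cmod_ge_0|auto].
    - right. rewrite Rpow_mult_distr. f_equal. replace (1 - 2 * beta - 1) with (- beta + - beta) by ring.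
      rewrite Rpower_plus. ring. }
  assert (HKc : forall q x, 0 < x <= 1 -> continuous (fun x => K ^ 2 * Rpower x q) x).
  { intros q x Hx. apply (continuous_mult (K := R_AbsRing) (fun _ => K ^ 2)); [apply continuous_const|apply continuous_Rpower; lra]. }
  assert (Hrr := fun q Hq => rgen_scal r0 (pt 1) (K ^ 2) _ _ (rgen_Rpower_01 q Hq)).
  destruct (rgen_dominated_sq f (fun x => K ^ 2 * Rpower x (1 - 2 * beta - 1)) _ ltac:(intros; apply Hf; lra)
    (HKc (1 - 2 * beta - 1)) HK2 (Hrr (1 - 2 * beta) ltac:(lra))) as [I [HI _]].
  exists I. split; auto.
  assert (Happ : forall eps, 0 < eps -> exists N, I - BN c N <= eps).
  { intros eps He. set (kap := (1 - 2 * beta) / 2). assert (Hkap : 0 < kap < 1) by (unfold kap; lra).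
    assert (HKp : 0 <= K ^ 2) by apply pow2_ge_0.
    (* The thresholds for [d], [j] and [eta] make each of three errors at most eps/8; with the
       factor 2 of [Cmod_sq_plus] they total at most 3 eps / 4. *)
    assert (P1 : 0 < eps * kap / (8 * (K ^ 2 + 1))) by (apply Rdiv_lt_0_compat; [apply Rmult_lt_0_compat; lra|lra]).
    destruct (Rpower_small kap _ ltac:(lra) P1) as [d0 [Hd0 Hd1]].
    set (d := d0 / 2). assert (Hd : 0 < d) by (unfold d; lra).
    assert (Hdk := Hd1 d ltac:(unfold d; lra)).
    destruct (INR_unbounded (8 * (K ^ 2 + 1) / eps)) as [j Hj].
    set (G := fun x => if Rle_dec x 0 then RtoC 0 else (f x * RtoC (damp d j x))%C).
    assert (Hj0 : j <> O). { intros ->. simpl in Hj. assert (0 < 8 * (K ^ 2 + 1) / eps) by (apply Rdiv_lt_0_compat; lra). lra. }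
    set (eta := Rmin 1 (eps / 8)). assert (Heta : 0 < eta) by (apply Rmin_pos; lra).
    destruct (trig_approx G eta Heta) as [N [q [Hq Happ]]].
    { apply (Ccont_damped f d K beta j); auto; lra. }
    { unfold G. destruct (Rle_dec 0 0); auto; lra. }
    { unfold G. destruct (Rle_dec 1 0); [lra|]. unfold damp. rewrite pow1, Rminus_diag, Rmult_0_r. ring. }
    exists N.
    assert (PI0 := pos_INR j).
    set (M := fun x => 2 * (Rpower d kap * (K ^ 2 * Rpower x (1 - 2 * beta - kap - 1)) + K ^ 2 * Rpower x (INR j + 1 - 2 * beta - 1)) + 2 * eta ^ 2 * Rpower x (1 - 1)).
    assert (HM : rgen M r0 (pt 1) (2 * (Rpower d kap * (K ^ 2 * / (1 - 2 * beta - kap)) + K ^ 2 * / (INR j + 1 - 2 * beta)) + 2 * eta ^ 2 * / 1)).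
    { unfold M. apply rgen_plus; try typeclasses eauto.
      - apply rgen_scal; try typeclasses eauto. apply rgen_plus; try typeclasses eauto.
        + apply rgen_scal; try typeclasses eauto. apply Hrr. unfold kap; lra.
        + apply Hrr. lra.
      - apply rgen_scal; try typeclasses eauto. apply rgen_Rpower_01. lra. }
    edestruct (rgen_dominated_sq (fun x => f x - q x)%C M) as [J [HJ1 HJ2]]; [ | | |exact HM| ].
    - intros x Hx. apply Ccont_minus; [apply Hf; lra|apply (TP_Ccont N); auto].
    - intros x Hx. unfold M.
      apply (continuous_plus (V := R_NormedModule)
        (fun x => 2 * (Rpower d kap * (K ^ 2 * Rpower x (1 - 2 * beta - kap - 1)) + K ^ 2 * Rpower x (INR j + 1 - 2 * beta - 1)))
        (fun x => 2 * eta ^ 2 * Rpower x (1 - 1))).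
      + apply (continuous_mult (K := R_AbsRing) (fun _ => 2)); [apply continuous_const|].
        apply (continuous_plus (V := R_NormedModule) (fun x => Rpower d kap * (K ^ 2 * Rpower x (1 - 2 * beta - kap - 1)))); auto.
        apply (continuous_mult (K := R_AbsRing) (fun _ => Rpower d kap)); [apply continuous_const|auto].
      + apply (continuous_mult (K := R_AbsRing) (fun _ => 2 * eta ^ 2)); [apply continuous_const|apply continuous_Rpower; lra].
    - intros x Hx.
      replace (f x - q x)%C with ((f x - G x) + (G x - q x))%C by ring.
      eapply Rle_trans; [apply Cmod_sq_plus|]. unfold M.
      destruct (damp_bounds d kap x j Hd ltac:(lra) Hx) as [D1 [_ [D3 D4]]].
      assert (EG : (f x - G x)%C = (f x * RtoC (1 - damp d j x))%C).
      { unfold G. destruct (Rle_dec x 0); [lra|]. rewrite RtoC_minus. ring. }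
      rewrite Rminus_diag, Rpower_O, Rmult_1_r by lra.
      apply Rplus_le_compat.
      + apply Rmult_le_compat_l; [lra|]. rewrite EG, Cmod_mult, Cmod_R, Rpow_mult_distr, pow2_abs.
        (* Since 1 - damp lies in [0, 1], its square is at most itself, and [damp_bounds] applies
           without squaring. *)
        apply Rle_trans with (K ^ 2 * Rpower x (1 - 2 * beta - 1) * (Rpower d kap * Rpower x (- kap) + x ^ j)).
        * apply Rmult_le_compat; auto; [apply pow2_ge_0|apply pow2_ge_0|]. nra.
        * right. rewrite <- (Rpower_pow j x) by lra.
          replace (1 - 2 * beta - kap - 1) with ((1 - 2 * beta - 1) + - kap) by ring.
          replace (INR j + 1 - 2 * beta - 1) with ((1 - 2 * beta - 1) + INR j) by ring.
          rewrite !Rpower_plus. ring.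
      + apply Rmult_le_compat_l; [lra|]. apply pow_incr. split; [apply Cmod_ge_0|]. apply Happ; lra.
    - eapply Rle_trans; [apply (best_approximation f c I Hc HI N q J Hq HJ1)|].
      eapply Rle_trans; [exact HJ2|].
      replace (1 - 2 * beta - kap) with kap by (unfold kap; field).
      assert (T1 : Rpower d kap * (K ^ 2 * / kap) <= eps / 8).
      { apply (Rmult_le_reg_r kap); [lra|]. replace (Rpower d kap * (K ^ 2 * / kap) * kap) with (Rpower d kap * K ^ 2) by (field; lra).
        apply Rle_trans with (eps * kap / (8 * (K ^ 2 + 1)) * (K ^ 2 + 1)).
        - apply Rmult_le_compat; try lra. left; apply Rpower_pos.
        - right. field. lra. }
      assert (T2 : K ^ 2 * / (INR j + 1 - 2 * beta) <= eps / 8).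
      { apply (Rmult_le_reg_r (INR j + 1 - 2 * beta)); [lra|]. rewrite Rmult_assoc, Rinv_l, Rmult_1_r by lra.
        apply (Rmult_lt_compat_l (eps / 8)) in Hj; [|lra].
        replace (eps / 8 * (8 * (K ^ 2 + 1) / eps)) with (K ^ 2 + 1) in Hj by (field; lra). nra. }
      assert (T3 : eta ^ 2 <= eps / 8).
      { assert (E1 : eta <= 1) by apply Rmin_l. assert (E2 : eta <= eps / 8) by apply Rmin_r. nra. }
      lra. }
  apply is_lim_seq_spec. intros eps.
  destruct (Happ (eps / 2) ltac:(generalize (cond_pos eps); lra)) as [N HN].
  exists N. intros n Hn.
  assert (Hmon : BN c N <= BN c n).
  { induction Hn as [|n Hn IH]; [lra|]. simpl BN. eapply Rle_trans; [exact IH|].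
    generalize (pow2_ge_0 (Cmod (c (Z.of_nat (S n))))) (pow2_ge_0 (Cmod (c (- Z.of_nat (S n))%Z))). simpl. lra. }
  assert (Hle := BN_le f c I Hc HI n). generalize (cond_pos eps). intros.
  apply Rabs_def1; lra.
Qed.

(** The modulus of z^(s-1) depends on t through e^(-t arg z); with arg z equal to pi/2 or -pi/2 its
    square is the origin of the factors e^(-pi t) and e^(pi t). *)
Lemma Cmod2_Cpower_two_pi_i (n : Z) (s : C) : n <> 0%Z ->
  Cmod (Cpower (two_pi_i n) (s - 1)) ^ 2 =
  Rpower (Rabs (2 * PI * IZR n)) (2 * Re s - 2) * exp (- 2 * Im s * snd (Clog (two_pi_i n))).
Proof.
  intros Hn. unfold Cpower. rewrite Cmod_Cexp, !Clog_two_pi_i by auto.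
  assert (E : forall u, exp u ^ 2 = exp (u + u)) by (intros; rewrite exp_plus; ring). rewrite E.
  unfold Rpower. rewrite <- exp_plus. f_equal. unfold Re, Im; simpl. ring.
Qed.

Lemma Clog_pos (k : nat) :
  Clog (two_pi_i (Z.of_nat (S k))) = (RtoC (ln (2 * PI * INR (S k))) + RtoC PI * Ci / RtoC 2)%C.
Proof.
  assert (HP := PI_RGT_0). assert (Hk : 0 < INR (S k)) by (apply lt_0_INR; lia).
  assert (Hy : 0 < 2 * PI * INR (S k)) by nra.
  rewrite Clog_two_pi_i by lia. rewrite <- INR_IZR_INZ.
  destruct (Rle_dec 0 (2 * PI * INR (S k))) as [_|n]; [|lra].
  rewrite Rabs_pos_eq by lra. apply C_eq; simpl Re; simpl Im; field.
Qed.

Lemma Clog_neg (k : nat) :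
  Clog (two_pi_i (- Z.of_nat (S k))) = (RtoC (ln (2 * PI * INR (S k))) - RtoC PI * Ci / RtoC 2)%C.
Proof.
  assert (HP := PI_RGT_0). assert (Hk : 0 < INR (S k)) by (apply lt_0_INR; lia).
  assert (Hy : 0 < 2 * PI * INR (S k)) by nra.
  rewrite Clog_two_pi_i by lia. rewrite opp_IZR, <- INR_IZR_INZ.
  replace (2 * PI * - INR (S k)) with (- (2 * PI * INR (S k))) by ring.
  destruct (Rle_dec 0 (- (2 * PI * INR (S k)))) as [n|_]; [lra|].
  rewrite Rabs_Ropp, Rabs_pos_eq by lra. apply C_eq; simpl Re; simpl Im; field.
Qed.

Theorem mainTheorem7 (r : nat) (s : C) :
  (Re s < 1 ->
     is_integral01 (V := C_R_NormedModule)
       (fun alpha : R => hurwitz_zeta_derive r s alpha) (RtoC 0)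
     /\
     forall n : Z, n <> 0%Z ->
       is_integral01 (V := C_R_NormedModule)
         (fun alpha : R =>
            (hurwitz_zeta_derive r s alpha * Cexp (- (two_pi_i n * RtoC alpha)))%C)
         (Cpower (two_pi_i n) (s - 1) * gamma_log_sum r s (Clog (two_pi_i n)))%C)
  /\
  (Re s < 1 / 2 ->
     let coef_plus (n : nat) : R :=
       Rpower (2 * PI * INR n) (2 * Re s - 2)
       * Cmod (gamma_log_sum r s
                 (RtoC (ln (2 * PI * INR n)) + RtoC PI * Ci / RtoC 2)%C) ^ 2 in
     let coef_minus (n : nat) : R :=
       Rpower (2 * PI * INR n) (2 * Re s - 2)
       * Cmod (gamma_log_sum r s
                 (RtoC (ln (2 * PI * INR n)) - RtoC PI * Ci / RtoC 2)%C) ^ 2 in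
     ex_series (fun k : nat => coef_plus (S k))
     /\ ex_series (fun k : nat => coef_minus (S k))
     /\ is_integral01 (V := R_NormedModule)
          (fun alpha : R => Cmod (hurwitz_zeta_derive r s alpha) ^ 2)
          (exp (- (PI * Im s)) * Series (fun k : nat => coef_plus (S k))
           + exp (PI * Im s) * Series (fun k : nat => coef_minus (S k)))).
Proof.
  split.
  - intros Hs. destruct (zeta_derive_fourier r s Hs) as [f [_ [Hf2 [_ [Hf4 Hf5]]]]]. split.
    + apply (igen_ext r0 (pt 1) (fun x => 0 < x <= 1) (fun a => f a * e2 0 a)%C); auto.
      * apply dom_0_1.
      * intros x Hx. rewrite Hf2, e2_zero by lra. ring.
    + intros n Hn. apply (igen_ext r0 (pt 1) (fun x => 0 < x <= 1) (fun a => f a * e2 n a)%C); auto.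
      * apply dom_0_1.
      * intros x Hx. rewrite Hf2 by lra. reflexivity.
  - intros Hs coef_plus coef_minus.
    destruct (zeta_derive_fourier r s ltac:(lra)) as [f [Hf1 [Hf2 [Hf3 [Hf4 Hf5]]]]].
    (* Strictly between max(Re s, 0) and 1/2, as the pointwise bound and square integrability
       demand. *)
    set (beta := (1 / 2 + Rmax (Re s) 0) / 2).
    assert (Hmx : Rmax (Re s) 0 < 1 / 2) by (apply Rmax_lub_lt; lra).
    assert (H1 := Rmax_l (Re s) 0). assert (H2 := Rmax_r (Re s) 0).
    destruct (Hf3 beta ltac:(unfold beta; lra) ltac:(unfold beta; lra)) as [K HK].
    (* The vanishing mean is entered as the coefficient of index 0, so that index adds nothing to
       Parseval's sum. *)
    set (c := fun n => if Z.eq_dec n 0 then RtoC 0 else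
      (Cpower (two_pi_i n) (s - 1) * gamma_log_sum r s (Clog (two_pi_i n)))%C).
    assert (Hc : forall n, igen (fun x => f x * e2 n x)%C r0 (pt 1) (c n)).
    { intros n. unfold c. destruct (Z.eq_dec n 0) as [->|Hn]; auto. }
    destruct (parseval f c K beta Hf1 ltac:(unfold beta; lra) HK Hc) as [I [HI HB]].
    set (u := exp (- (PI * Im s))). set (v := exp (PI * Im s)).
    assert (Hu : 0 < u) by apply exp_pos. assert (Hv : 0 < v) by apply exp_pos.
    assert (Cp : forall k, Cmod (c (Z.of_nat (S k))) ^ 2 = u * coef_plus (S k)).
    { intros k. unfold c. destruct (Z.eq_dec (Z.of_nat (S k)) 0) as [E|Hn]; [lia|].
      rewrite Cmod_mult, Rpow_mult_distr, Cmod2_Cpower_two_pi_i, Clog_pos by auto.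
      unfold coef_plus. rewrite <- INR_IZR_INZ, Rabs_pos_eq.
      - unfold u. replace (-2 * Im s * snd _) with (- (PI * Im s)) by (simpl; field). ring.
      - assert (HP := PI_RGT_0). assert (P := pos_INR (S k)). nra. }
    assert (Cm : forall k, Cmod (c (- Z.of_nat (S k))%Z) ^ 2 = v * coef_minus (S k)).
    { intros k. unfold c. destruct (Z.eq_dec (- Z.of_nat (S k)) 0) as [E|Hn]; [lia|].
      rewrite Cmod_mult, Rpow_mult_distr, Cmod2_Cpower_two_pi_i, Clog_neg by auto.
      unfold coef_minus. rewrite opp_IZR, <- INR_IZR_INZ.
      replace (2 * PI * - INR (S k)) with (- (2 * PI * INR (S k))) by ring. rewrite Rabs_Ropp, Rabs_pos_eq.
      - unfold v. replace (-2 * Im s * snd _) with (PI * Im s) by (simpl; field). ring.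
      - assert (HP := PI_RGT_0). assert (P := pos_INR (S k)). nra. }
    assert (HS : is_series (fun k => u * coef_plus (S k) + v * coef_minus (S k)) I).
    (* [BN c 0] is zero; the shift by one aligns [BN] with the partial sums of a series whose k-th
       term collects the indices k + 1 and -(k + 1). *)
    { apply is_lim_seq_incr_1 in HB.
      change (is_lim_seq (sum_n (fun k => u * coef_plus (S k) + v * coef_minus (S k))) I).
      apply is_lim_seq_ext with (2 := HB). intros N.
      assert (E : forall N, BN c N = match N with O => 0 | S m => sum_n (fun k => u * coef_plus (S k) + v * coef_minus (S k)) m end).
      { induction N0 as [|m IH].
        - simpl. unfold c. simpl. rewrite Cmod_0. ring.
        - change (BN c (S m)) with (BN c m + Cmod (c (Z.of_nat (S m))) ^ 2 + Cmod (c (- Z.of_nat (S m))%Z) ^ 2).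
          rewrite Cp, Cm, IH. destruct m as [|m]; [rewrite sum_O; ring|]. rewrite sum_Sn. pl. ring. }
      apply (E (S N)). }
    assert (Pp : forall k, 0 <= coef_plus (S k)).
    { intros k. unfold coef_plus. apply Rmult_le_pos; [left; apply Rpower_pos|apply pow2_ge_0]. }
    assert (Pm : forall k, 0 <= coef_minus (S k)).
    { intros k. unfold coef_minus. apply Rmult_le_pos; [left; apply Rpower_pos|apply pow2_ge_0]. }
    (* Convergence is known only for the combined series; nonnegativity of both parts lets each be
       compared with their sum. *)
    assert (Ex : forall w (g : nat -> R), 0 < w -> (forall k, 0 <= g k) ->
       (forall k, w * g k <= u * coef_plus (S k) + v * coef_minus (S k)) -> ex_series g).
    { intros w g Hw Hg Hle. apply (ex_series_ext (fun k => / w * (w * g k))).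
      { intros k. change (/ w * (w * g k) = g k). field. lra. }
      apply (ex_series_scal (K := R_AbsRing) (V := R_NormedModule)).
      apply (ex_series_le (V := R_CompleteNormedModule) _ (fun k => u * coef_plus (S k) + v * coef_minus (S k))); [|exists I; auto].
      intros k. change (Rabs (w * g k) <= u * coef_plus (S k) + v * coef_minus (S k)).
      rewrite Rabs_pos_eq; auto. apply Rmult_le_pos; [lra|auto]. }
    assert (E1 : ex_series (fun k => coef_plus (S k))).
    { apply (Ex u); auto. intros k. assert (0 <= v * coef_minus (S k)) by (apply Rmult_le_pos; [lra|auto]). lra. }
    assert (E2 : ex_series (fun k => coef_minus (S k))).
    { apply (Ex v); auto. intros k. assert (0 <= u * coef_plus (S k)) by (apply Rmult_le_pos; [lra|auto]). lra. }
    split; [exact E1|split; [exact E2|]].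
    assert (EI : u * Series (fun k => coef_plus (S k)) + v * Series (fun k => coef_minus (S k)) = I).
    { rewrite <- (is_series_unique _ _ HS), Series_plus, !Series_scal_l; auto;
        apply (ex_series_scal (K := R_AbsRing) (V := R_NormedModule)); auto. }
    rewrite EI.
    apply (rgen_ext r0 (pt 1) (fun x => 0 < x <= 1) (fun x => Cmod (f x) ^ 2)); auto.
    + apply dom_0_1.
    + intros x Hx. rewrite Hf2 by lra. reflexivity.
Qed.
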